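(* Let $\mathbf{M}$ be a full exceptional sequence of $\Lambda_n$-modules. Then $\mathbf{M}$ is (up to isomorphism of its terms) of the form $$\left(\nabla(m_1),\nabla(m_2),\dots,\nabla(m_i),L(1),\Delta(n_1),\Delta(n_2),\dots,\Delta(n_j)\right)$$ where $i+j=n-1$, $\{m_1,m_2,\dots,m_i,n_1,n_2,\dots,n_j\}=\{2,3,\dots,n\}$, $m_1>m_2>\dots>m_i$ and $n_1<n_2<\dots<n_j$.
   Context: Let $\Bbbk$ be an algebraically closed field and $n\geq 2$. $\Lambda_n$ is the path algebra over $\Bbbk$ of the quiver with vertices $1,\dots,n$ and arrows $\alpha_i:i\to i+1$, $\alpha_i':i+1\to i$ ($1\leq i\leq n-1$), modulo the relations $\alpha_{i+1}\alpha_i=0$, $\alpha_i'\alpha_{i+1}'=0$ ($1\leq i\leq n-2$) and $\alpha_i\alpha_i'=0$ ($1\leq i\leq n-1$); products are composed right to left ($\beta\alpha$ means first $\alpha$, then $\beta$). Modules are finite-dimensional left modules. $L(i)$ is the simple module at vertex $i$. $\Lambda_n$ is quasi-hereditary for the natural order on $\{1,\dots,n\}$, with standard modules $\Delta(1)=L(1)$ and, for $i\geq 2$, $\Delta(i)$ uniserial of length two with top $L(i)$ and socle $L(i-1)$, and costandard modules $\nabla(1)=L(1)$ and, for $i\geq2$, $\nabla(i)$ uniserial of length two with top $L(i-1)$ and socle $L(i)$. An indecomposable module $M$ over a finite-dimensional $\Bbbk$-algebra $\Lambda$ is exceptional if $\operatorname{End}_\Lambda(M)\cong\Bbbk$ and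 $\operatorname{Ext}^i_\Lambda(M,M)=0$ for all $i>0$. A sequence $(M_1,\dots,M_k)$ of $\Lambda$-modules is an exceptional sequence if each $M_x$ is exceptional and $\operatorname{Ext}^i_\Lambda(M_x,M_y)=0$ for all $1\leq y<x\leq k$ and all $i\geq0$ (with $\operatorname{Ext}^0=\operatorname{Hom}$). It is full if it generates the bounded derived category $D^b(\Lambda)$ as a triangulated category. *)

(* Defs.v *)
From HB Require Import structures.
From mathcomp Require Import all_boot all_order all_algebra.
From mathcomp Require Import generic_quotient ring_quotient.
From mathcomp Require Import boolp.
From mathcomp.multinomials Require Import freeg.
From mathcomp Require Import zify.

Set Implicit Arguments.
Unset Strict Implicit.
Unset Printing Implicit Defensive.

Import GRing.Theory.
Local Open Scope ring_scope.
Local Open Scope quotient_scope.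

Record quiver := Quiver {
  Q0 : finType;
  Q1 : finType;
  src : Q1 -> Q0;
  tgt : Q1 -> Q0
}.

Section Paths.
Variable Q : quiver.
Implicit Types (v w : Q0 Q) (a : Q1 Q) (s t : seq (Q1 Q)).

Fixpoint is_path v s : bool :=
  if s is a :: s' then (src a == v) && is_path (tgt a) s' else true.

Definition endpoint v s : Q0 Q := foldl (fun _ a => tgt a) v s.

(* A path is a start vertex with the list of its arrows in the order in which
   they are traversed; [(v, [::])] is the trivial path at v. *)
Record qpath := QPath { path_val :> Q0 Q * seq (Q1 Q);
                        _ : is_path path_val.1 path_val.2 }.
HB.instance Definition _ := [isSub for path_val].
HB.instance Definition _ := [Choice of qpath by <:].

Definition psrc (p : qpath) : Q0 Q := p.1.
Definition ptgt (p : qpath) : Q0 Q := endpoint p.1 p.2.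

Definition trivial_path v : qpath := @QPath (v, [::]) isT.

Lemma arrow_path_subproof a : is_path (src a) [:: a].
Proof. by rewrite /= eqxx. Qed.
Definition arrow_path a : qpath := @QPath (src a, [:: a]) (arrow_path_subproof a).

(* [pcat p q] is the path "first q, then p"; it is only meaningful when
   [psrc p = ptgt q], see [pcatP]. *)
Definition pcat (p q : qpath) : qpath := insubd q (q.1, q.2 ++ p.2).

Lemma is_path_cat v s t :
  is_path v (s ++ t) = is_path v s && is_path (endpoint v s) t.
Proof. by elim: s v => //= a s IHs v; rewrite IHs andbA. Qed.

Lemma endpoint_cat v s t : endpoint v (s ++ t) = endpoint (endpoint v s) t.
Proof. exact: foldl_cat. Qed.

Lemma pathP (p : qpath) : is_path p.1 p.2.
Proof. by case: p. Qed.

Lemma pcatP p q : psrc p = ptgt q -> pcat p q = (q.1, q.2 ++ p.2) :> _ * _.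
Proof.
move=> pq; rewrite /pcat; apply: insubdK.
by rewrite unfold_in /= is_path_cat pathP /= -[endpoint _ _]/(ptgt q) -pq pathP.
Qed.

Lemma psrc_pcat p q : psrc p = ptgt q -> psrc (pcat p q) = psrc q.
Proof. by move=> pq; rewrite /psrc pcatP. Qed.

Lemma ptgt_pcat p q : psrc p = ptgt q -> ptgt (pcat p q) = ptgt p.
Proof.
by move=> pq; rewrite /ptgt pcatP //= endpoint_cat -[endpoint q.1 _]/(ptgt q) -pq.
Qed.

Lemma pcatA p q r : psrc p = ptgt q -> psrc q = ptgt r ->
  pcat p (pcat q r) = pcat (pcat p q) r.
Proof.
move=> pq qr; apply: val_inj => /=.
by rewrite !pcatP ?psrc_pcat ?ptgt_pcat //= catA.
Qed.

End Paths.

Section FreegExtra.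
Variables (k : nzRingType) (K : choiceType) (V : lmodType k).

Lemma freegUZ (c : k) (x : K) : << c *g x >> = c *: << x >> :> {freeg K / k}.
Proof. by apply/eqP/freeg_eqP => y; rewrite coeffZ !coeffU mul1r. Qed.

Lemma fgrp_ind (P : {freeg K / k} -> Prop) :
  P 0 -> (forall x, P << x >>) -> (forall D E, P D -> P E -> P (D + E)) ->
  (forall (c : k) D, P D -> P (c *: D)) -> forall D, P D.
Proof.
move=> P0 P1 PD PZ; apply: freeg_ind_dom0 => // a x D _ _ PDD.
by apply: PD => //; rewrite freegUZ; apply: PZ; apply: P1.
Qed.

Lemma fglift_is_linear (f : K -> V) : linear (fglift f).
Proof.
have addf : additive (fglift f) := lift_is_additive f.
have lift0 : fglift f 0 = 0 by rewrite -[0 in LHS](subrr 0) addf subrr.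
have liftD D E : fglift f (D + E) = fglift f D + fglift f E.
  by rewrite -[E in LHS]opprK addf -[- E]add0r addf lift0 sub0r opprK.
have liftUZ c x : fglift f (c *: << x >>) = c *: fglift f << x >>.
  by rewrite -freegUZ !liftU scale1r.
move=> c D E; rewrite liftD; congr (_ + _).
elim/fgrp_ind: D c => [|x|D1 D2 IH1 IH2|a D IHD] c.
- by rewrite scaler0 lift0 scaler0.
- exact: liftUZ.
- by rewrite scalerDr !liftD IH1 IH2 scalerDr.
- by rewrite scalerA !IHD scalerA.
Qed.

HB.instance Definition _ (f : K -> V) :=
  GRing.isLinear.Build k {freeg K / k} V *:%R (fglift f) (fglift_is_linear f).

Lemma fgliftU (f : K -> V) x : fglift f << x >> = f x.
Proof. by rewrite liftU scale1r. Qed.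

Lemma freeg_linear_ext (f g : {linear {freeg K / k} -> V}) :
  (forall x, f << x >> = g << x >>) -> f =1 g.
Proof.
move=> fg; elim/fgrp_ind => [|x|D E IHD IHE|a D IHD]; rewrite ?linear0 //.
- by rewrite !linearD IHD IHE.
- by rewrite !linearZ IHD.
Qed.

End FreegExtra.

Section PathAlgebra.
Variables (k : fieldType) (Q : quiver).

Definition path_algebra := {freeg (qpath Q) / k}.
HB.instance Definition _ := GRing.Lmodule.on path_algebra.

Definition pbasis (p : qpath Q) : path_algebra := << p >>.

Definition pbasis_mul (p q : qpath Q) : path_algebra :=
  if psrc p == ptgt q then pbasis (pcat p q) else 0.

Definition pa_mul (x y : path_algebra) : path_algebra :=
  fglift (fun p => fglift (fun q => pbasis_mul p q) y : path_algebra) x.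

Definition pa_one : path_algebra := \sum_(v : Q0 Q) pbasis (trivial_path v).

Lemma pa_ind (P : path_algebra -> Prop) :
  P 0 -> (forall p, P (pbasis p)) -> (forall x y, P x -> P y -> P (x + y)) ->
  (forall (c : k) x, P x -> P (c *: x)) -> forall x, P x.
Proof. exact: fgrp_ind. Qed.

Lemma pa_mulZDl c x y z : pa_mul (c *: x + y) z = c *: pa_mul x z + pa_mul y z.
Proof. by rewrite /pa_mul linearP. Qed.

Lemma pa_mulUl p y : pa_mul (pbasis p) y = fglift (fun q => pbasis_mul p q) y.
Proof. by rewrite /pa_mul fgliftU. Qed.

Lemma pa_mulUU p q : pa_mul (pbasis p) (pbasis q) = pbasis_mul p q.
Proof. by rewrite pa_mulUl fgliftU. Qed.

Lemma pa_mul0l z : pa_mul 0 z = 0. Proof. by rewrite /pa_mul linear0. Qed.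
Lemma pa_mulDl x y z : pa_mul (x + y) z = pa_mul x z + pa_mul y z.
Proof. by rewrite -[x]scale1r pa_mulZDl !scale1r. Qed.
Lemma pa_mulZl c x z : pa_mul (c *: x) z = c *: pa_mul x z.
Proof. by rewrite -[c *: x]addr0 pa_mulZDl pa_mul0l addr0. Qed.

Lemma pa_mulZDr c x y z : pa_mul z (c *: x + y) = c *: pa_mul z x + pa_mul z y.
Proof.
elim/pa_ind: z => [|p|z1 z2 IH1 IH2|d z IHz].
- by rewrite !pa_mul0l scaler0 addr0.
- by rewrite !pa_mulUl linearP.
- by rewrite !pa_mulDl IH1 IH2 scalerDr addrACA.
- by rewrite !pa_mulZl IHz scalerDr !scalerA mulrC.
Qed.

Lemma pa_mul0r z : pa_mul z 0 = 0.
Proof. by rewrite -[0 in LHS](addNr 0) -scaleN1r pa_mulZDr scaleN1r addNr. Qed.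
Lemma pa_mulDr x y z : pa_mul z (x + y) = pa_mul z x + pa_mul z y.
Proof. by rewrite -[x]scale1r pa_mulZDr !scale1r. Qed.
Lemma pa_mulZr c x z : pa_mul z (c *: x) = c *: pa_mul z x.
Proof. by rewrite -[c *: x]addr0 pa_mulZDr pa_mul0r addr0. Qed.

Lemma pbasis_mulA p q r :
  pa_mul (pbasis p) (pbasis_mul q r) = pa_mul (pbasis_mul p q) (pbasis r).
Proof.
rewrite /pbasis_mul; case: eqP => [qr|nqr]; case: eqP => [pq|npq];
  rewrite ?pa_mul0l ?pa_mul0r ?pa_mulUU // /pbasis_mul.
- by rewrite ptgt_pcat // psrc_pcat // pq qr !eqxx pcatA.
- by rewrite ptgt_pcat //; case: eqP npq.
- by rewrite psrc_pcat //; case: eqP nqr.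
Qed.

Lemma pa_mulA : associative pa_mul.
Proof.
move=> x y z; elim/pa_ind: x => [|p|x1 x2 IH1 IH2|c x IHx].
- by rewrite !pa_mul0l.
- elim/pa_ind: y => [|q|y1 y2 IH1 IH2|c y IHy].
  + by rewrite !(pa_mul0l, pa_mul0r).
  + elim/pa_ind: z => [|r|z1 z2 IH1 IH2|c z IHz].
    * by rewrite !pa_mul0r.
    * by rewrite !pa_mulUU pbasis_mulA.
    * by rewrite !pa_mulDr IH1 IH2.
    * by rewrite !pa_mulZr IHz.
  + by rewrite !(pa_mulDl, pa_mulDr) IH1 IH2.
  + by rewrite !(pa_mulZl, pa_mulZr) IHy.
- by rewrite !pa_mulDl IH1 IH2.
- by rewrite !pa_mulZl IHx.
Qed.

Lemma pa_suml (I : finType) (F : I -> path_algebra) z :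
  pa_mul (\sum_i F i) z = \sum_i pa_mul (F i) z.
Proof. by apply: (big_morph (pa_mul^~ z)) => [x y|]; rewrite ?pa_mulDl ?pa_mul0l. Qed.
Lemma pa_sumr (I : finType) (F : I -> path_algebra) z :
  pa_mul z (\sum_i F i) = \sum_i pa_mul z (F i).
Proof. by apply: (big_morph (pa_mul z)) => [x y|]; rewrite ?pa_mulDr ?pa_mul0r. Qed.

Lemma pa_mul1l : left_id pa_one pa_mul.
Proof.
elim/pa_ind => [|p|x1 x2 IH1 IH2|c x IHx].
- by rewrite pa_mul0r.
- rewrite pa_suml (bigD1 (ptgt p)) //= big1 => [|v /negPf vp].
    rewrite addr0 pa_mulUU /pbasis_mul eqxx; congr pbasis.
    by apply: val_inj; rewrite /= pcatP //= cats0 -surjective_pairing.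
  by rewrite pa_mulUU /pbasis_mul /psrc /= vp.
- by rewrite pa_mulDr IH1 IH2.
- by rewrite pa_mulZr IHx.
Qed.

Lemma pa_mul1r : right_id pa_one pa_mul.
Proof.
elim/pa_ind => [|p|x1 x2 IH1 IH2|c x IHx].
- by rewrite pa_mul0l.
- rewrite pa_sumr (bigD1 (psrc p)) //= big1 => [|v /negPf vp].
    rewrite addr0 pa_mulUU /pbasis_mul eqxx; congr pbasis.
    by apply: val_inj; rewrite /= pcatP //= -surjective_pairing.
  by rewrite pa_mulUU /pbasis_mul /ptgt /= eq_sym vp.
- by rewrite pa_mulDl IH1 IH2.
- by rewrite pa_mulZl IHx.
Qed.

HB.instance Definition _ := GRing.Zmodule_isPzRing.Build path_algebra
  pa_mulA pa_mul1l pa_mul1r (fun x y z => pa_mulDl x y z)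
  (fun z x y => pa_mulDr x y z).

Definition vertex (v : Q0 Q) : path_algebra := pbasis (trivial_path v).
Definition arrow (a : Q1 Q) : path_algebra := pbasis (arrow_path a).

End PathAlgebra.

Section Ideal.
Variable A : pzRingType.

Record two_sided_ideal (J : A -> Prop) : Prop := TwoSidedIdeal {
  ideal0 : J 0;
  idealB : forall x y, J x -> J y -> J (x - y);
  idealMl : forall a x, J x -> J (a * x);
  idealMr : forall a x, J x -> J (x * a)
}.

Definition generated_ideal (R : A -> Prop) (x : A) : Prop :=
  forall J : A -> Prop, two_sided_ideal J -> (forall r, R r -> J r) -> J x.

Lemma generated_idealP (R : A -> Prop) : two_sided_ideal (generated_ideal R).
Proof.
split=> [J idJ _|x y Ix Iy J idJ RJ|a x Ix J idJ RJ|a x Ix J idJ RJ].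
- exact: ideal0 idJ.
- by apply: (idealB idJ); [apply: Ix | apply: Iy].
- by apply: (idealMl idJ); apply: Ix.
- by apply: (idealMr idJ); apply: Ix.
Qed.

(* boolean by classical logic, as the quotient construction requires *)
Definition in_ideal (R : A -> Prop) : A -> bool := fun x => `[< generated_ideal R x >].

Lemma in_idealP (R : A -> Prop) x :
  reflect (generated_ideal R x) (x \in in_ideal R).
Proof. exact: asboolP. Qed.

Lemma in_ideal_zmod (R : A -> Prop) : zmod_closed (in_ideal R).
Proof.
have idI := generated_idealP R.
split=> [|x y]; first by apply/in_idealP; apply: ideal0 idI.
by move=> /in_idealP Ix /in_idealP Iy; apply/in_idealP; exact: (idealB idI Ix Iy).
Qed.

HB.instance Definition _ (R : A -> Prop) :=
  GRing.isZmodClosed.Build A (in_ideal R) (in_ideal_zmod R).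

End Ideal.

Section BoundQuiverAlgebra.
Variables (k : fieldType) (Q : quiver) (R : path_algebra k Q -> Prop).
Local Notation kQ := (path_algebra k Q).

(* kQ modulo the two-sided ideal generated by R.  It is only declared a
   possibly trivial ring (R is arbitrary), so the k-algebra structure is given
   by an lmodType instance together with the lemmas [bqa_scaleAl], [bqa_scaleAr]. *)
Definition bqa := {ideal_quot (GRing.ZmodClosed.clone kQ (in_ideal R) _)}.
HB.instance Definition _ := GRing.Zmodule.on bqa.
HB.instance Definition _ := EqQuotient.on bqa.

Definition bqa_proj (x : kQ) : bqa := \pi_bqa x.

Lemma bqa_projP x y : bqa_proj x = bqa_proj y <-> generated_ideal R (x - y).
Proof.
rewrite /bqa_proj; split=> [/eqP|Ixy].
  by rewrite -Quotient.idealrBE => /in_idealP.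
by apply/eqP; rewrite -Quotient.idealrBE; apply/in_idealP.
Qed.

Definition bqa_one : bqa := bqa_proj 1.
Definition bqa_mul (x y : bqa) : bqa := bqa_proj (repr x * repr y).
Definition bqa_scale (c : k) (x : bqa) : bqa := bqa_proj (c *: repr x).

Lemma bqa_reprK x : bqa_proj (repr x) = x. Proof. exact: reprK. Qed.

Lemma bqa_projD x y : bqa_proj (x + y) = bqa_proj x + bqa_proj y.
Proof. by rewrite /bqa_proj !piE. Qed.

Lemma pa_scaleAl (c : k) (x y : kQ) : c *: (x * y) = (c *: x) * y.
Proof. by rewrite -[LHS]pa_mulZl. Qed.
Lemma pa_scaleAr (c : k) (x y : kQ) : c *: (x * y) = x * (c *: y).
Proof. by rewrite -[LHS]pa_mulZr. Qed.

Lemma bqa_projM x y : bqa_proj (x * y) = bqa_mul (bqa_proj x) (bqa_proj y).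
Proof.
apply/bqa_projP; set x' := repr _; set y' := repr _.
have Ix : generated_ideal R (x - x') by apply/bqa_projP; rewrite bqa_reprK.
have Iy : generated_ideal R (y - y') by apply/bqa_projP; rewrite bqa_reprK.
have idI := generated_idealP R.
have -> : x * y - x' * y' = (x - x') * y - x' * - (y - y').
  by rewrite mulrN opprK mulrBl mulrBr addrA subrK.
apply: (idealB idI); first exact: (idealMr idI).
by rewrite -[- (y - y')]sub0r; exact: (idealMl idI _ (idealB idI (ideal0 idI) Iy)).
Qed.

Lemma bqa_projZ c x : bqa_proj (c *: x) = bqa_scale c (bqa_proj x).
Proof.
apply/bqa_projP; set x' := repr _.
have Ix : generated_ideal R (x - x') by apply/bqa_projP; rewrite bqa_reprK.
rewrite -scalerBr -[x - x']mul1r pa_scaleAl.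
exact: (idealMl (generated_idealP R) _ Ix).
Qed.

Lemma bqa_ind (P : bqa -> Prop) : (forall x, P (bqa_proj x)) -> forall x, P x.
Proof. by move=> IH x; rewrite -(bqa_reprK x). Qed.

Let mulA : associative bqa_mul.
Proof. by do 3![elim/bqa_ind=> ?]; rewrite -!bqa_projM mulrA. Qed.
Let mul1l : left_id bqa_one bqa_mul.
Proof. by elim/bqa_ind => x; rewrite -bqa_projM mul1r. Qed.
Let mul1r : right_id bqa_one bqa_mul.
Proof. by elim/bqa_ind => x; rewrite -bqa_projM mulr1. Qed.
Let mulDl : left_distributive bqa_mul +%R.
Proof.
by do 3![elim/bqa_ind=> ?]; rewrite -!(bqa_projM, bqa_projD) mulrDl.
Qed.
Let mulDr : right_distributive bqa_mul +%R.
Proof.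
by do 3![elim/bqa_ind=> ?]; rewrite -!(bqa_projM, bqa_projD) mulrDr.
Qed.
HB.instance Definition _ :=
  GRing.Zmodule_isPzRing.Build bqa mulA mul1l mul1r mulDl mulDr.

Let scaleA a b x : bqa_scale a (bqa_scale b x) = bqa_scale (a * b) x.
Proof. by elim/bqa_ind: x => x; rewrite -!bqa_projZ scalerA. Qed.
Let scale1 : left_id 1 bqa_scale.
Proof. by elim/bqa_ind => x; rewrite -!bqa_projZ scale1r. Qed.
Let scaleDr : right_distributive bqa_scale +%R.
Proof.
by move=> c; do 2![elim/bqa_ind=> ?]; rewrite -!(bqa_projZ, bqa_projD) scalerDr.
Qed.
Let scaleDl x : {morph bqa_scale^~ x : a b / a + b}.
Proof.
by elim/bqa_ind: x => x a b; rewrite /= -!(bqa_projZ, bqa_projD) scalerDl.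
Qed.
HB.instance Definition _ :=
  GRing.Zmodule_isLmodule.Build k bqa scaleA scale1 scaleDr scaleDl.

Lemma bqa_scaleAl (c : k) (x y : bqa) : c *: (x * y) = (c *: x) * y.
Proof.
elim/bqa_ind: x => x; elim/bqa_ind: y => y.
by rewrite -[LHS]/(bqa_scale c (bqa_mul _ _)) -bqa_projM -bqa_projZ
           pa_scaleAl bqa_projM bqa_projZ.
Qed.
Lemma bqa_scaleAr (c : k) (x y : bqa) : c *: (x * y) = x * (c *: y).
Proof.
elim/bqa_ind: x => x; elim/bqa_ind: y => y.
by rewrite -[LHS]/(bqa_scale c (bqa_mul _ _)) -bqa_projM -bqa_projZ
           pa_scaleAr bqa_projM bqa_projZ.
Qed.

End BoundQuiverAlgebra.

Section Representations.
Variables (k : fieldType) (Q : quiver).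
Local Notation kQ := (path_algebra k Q).

(* A finite-dimensional representation of Q with a chosen homogeneous basis:
   the basis vector number i sits at the vertex [rep_vtx i], and the arrow a
   acts by the matrix [rep_mx a] (on column vectors, from the left). *)
Record qrep := QRep {
  rep_dim : nat;
  rep_vtx : 'I_rep_dim -> Q0 Q;
  rep_mx : Q1 Q -> 'M[k]_rep_dim;
  rep_graded : forall a i j,
    rep_mx a i j != 0 -> rep_vtx j = src a /\ rep_vtx i = tgt a
}.

Variable V : qrep.
Local Notation d := (rep_dim V).

Definition rep_proj (v : Q0 Q) : 'M[k]_d :=
  \matrix_(i, j) ((i == j) && (rep_vtx j == v))%:R.

Definition path_mx (p : qpath Q) : 'M[k]_d :=
  foldl (fun X a => rep_mx V a *m X) (rep_proj p.1) p.2.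

Definition rep_act (x : kQ) : 'M[k]_d := fglift path_mx x.

Let word_mx (s : seq (Q1 Q)) : 'M[k]_d := foldl (fun X a => rep_mx V a *m X) 1%:M s.

Lemma rep_proj_mull v (X : 'M[k]_d) i j :
  (rep_proj v *m X) i j = if rep_vtx i == v then X i j else 0.
Proof.
rewrite mxE (bigD1 i) //= big1 => [|l /negPf li].
  by rewrite !mxE eqxx /= addr0; case: eqP; rewrite ?mul1r ?mul0r.
by rewrite !mxE eq_sym li mul0r.
Qed.

Lemma rep_proj_mulr v (X : 'M[k]_d) i j :
  (X *m rep_proj v) i j = if rep_vtx j == v then X i j else 0.
Proof.
rewrite mxE (bigD1 j) //= big1 => [|l /negPf lj].
  by rewrite !mxE eqxx /= addr0; case: eqP; rewrite ?mulr1 ?mulr0.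
by rewrite !mxE lj mulr0.
Qed.

Lemma rep_proj_tgt a : rep_proj (tgt a) *m rep_mx V a = rep_mx V a.
Proof.
apply/matrixP => i j; rewrite rep_proj_mull.
have [->|nz] := eqVneq (rep_mx V a i j) 0; first by rewrite if_same.
by have [_ ->] := rep_graded nz; rewrite eqxx.
Qed.

Lemma rep_proj_src a : rep_mx V a *m rep_proj (src a) = rep_mx V a.
Proof.
apply/matrixP => i j; rewrite rep_proj_mulr.
have [->|nz] := eqVneq (rep_mx V a i j) 0; first by rewrite if_same.
by have [-> _] := rep_graded nz; rewrite eqxx.
Qed.

Lemma rep_projM v w :
  rep_proj v *m rep_proj w = if v == w then rep_proj v else 0.
Proof.
apply/matrixP => i j; rewrite rep_proj_mull.
have [<-|vw] := eqVneq v w; rewrite !mxE; have [->|nij] /= := eqVneq i j;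
  rewrite ?if_same //; case: eqP => // ->; by rewrite (negPf vw).
Qed.

Lemma rep_proj_sum : \sum_v rep_proj v = 1%:M.
Proof.
apply/matrixP => i j; rewrite summxE mxE (bigD1 (rep_vtx j)) //= big1.
  by rewrite mxE eqxx andbT addr0.
by move=> v /negPf vj; rewrite mxE [_ == v]eq_sym vj andbF.
Qed.

Lemma path_mx_trivial v : path_mx (trivial_path v) = rep_proj v.
Proof. by []. Qed.

Lemma path_mx_arrow a : path_mx (arrow_path a) = rep_mx V a.
Proof. exact: rep_proj_src. Qed.

Let foldl_word (X : 'M[k]_d) s :
  foldl (fun X a => rep_mx V a *m X) X s = word_mx s *m X.
Proof.
rewrite /word_mx; elim: s X => [|a s IHs] X /=; first by rewrite mul1mx.
by rewrite IHs (IHs (_ *m 1%:M)) mulmx1 mulmxA.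
Qed.

Lemma path_mx_tgt p : rep_proj (ptgt p) *m path_mx p = path_mx p.
Proof.
case: p => -[v s] /= ps; rewrite /path_mx /ptgt /=.
elim/last_ind: s ps => [|s a _] ps; first by rewrite /= rep_projM eqxx.
by rewrite /endpoint !foldl_rcons mulmxA rep_proj_tgt.
Qed.

Lemma path_mx_src p : path_mx p *m rep_proj (psrc p) = path_mx p.
Proof. by rewrite /path_mx foldl_word -mulmxA rep_projM eqxx. Qed.

Lemma path_mx_cat p q : psrc p = ptgt q ->
  path_mx (pcat p q) = path_mx p *m path_mx q.
Proof.
move=> pq; rewrite {1}/path_mx pcatP //= foldl_cat -/(path_mx q) foldl_word.
by rewrite -[in LHS](path_mx_tgt q) -pq mulmxA -foldl_word.
Qed.

Lemma rep_actU p : rep_act (pbasis k p) = path_mx p.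
Proof. exact: fgliftU. Qed.

Lemma rep_actD x y : rep_act (x + y) = rep_act x + rep_act y.
Proof. exact: linearD. Qed.
Lemma rep_actZ c x : rep_act (c *: x) = c *: rep_act x.
Proof. exact: linearZ. Qed.
Lemma rep_act0 : rep_act 0 = 0. Proof. exact: linear0. Qed.
Lemma rep_actB x y : rep_act (x - y) = rep_act x - rep_act y.
Proof. exact: linearB. Qed.

Lemma rep_actM x y : rep_act (x * y) = rep_act x *m rep_act y.
Proof.
elim/pa_ind: x => [|p|x1 x2 IH1 IH2|c x IHx].
- by rewrite mul0r rep_act0 mul0mx.
- elim/pa_ind: y => [|q|y1 y2 IH1 IH2|c y IHy].
  + by rewrite mulr0 rep_act0 mulmx0.
  + rewrite !rep_actU -[_ * _]/(pa_mul _ _) pa_mulUU /pbasis_mul.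
    case: eqP => [pq|/eqP pq]; first by rewrite rep_actU path_mx_cat.
    rewrite rep_act0 -path_mx_src -[path_mx q]path_mx_tgt mulmxA.
    by rewrite -[_ *m _ *m rep_proj _]mulmxA rep_projM (negPf pq) mulmx0 mul0mx.
  + by rewrite mulrDr !rep_actD IH1 IH2 mulmxDr.
  + by rewrite -pa_scaleAr !rep_actZ IHy scalemxAr.
- by rewrite mulrDl !rep_actD IH1 IH2 mulmxDl.
- by rewrite -pa_scaleAl !rep_actZ IHx scalemxAl.
Qed.

Lemma rep_act1 : rep_act 1 = 1%:M.
Proof.
rewrite -rep_proj_sum -[1]/(pa_one k Q) (big_morph rep_act rep_actD rep_act0).
by apply: eq_bigr => v _; rewrite rep_actU.
Qed.

Definition satisfies (R : kQ -> Prop) : Prop := forall r, R r -> rep_act r = 0.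

Variables (R : kQ -> Prop) (VR : satisfies R).
Local Notation Lambda := (bqa R).

Lemma rep_act_ideal x : generated_ideal R x -> rep_act x = 0.
Proof.
move=> Ix; apply: (Ix (fun x => rep_act x = 0)); last exact: VR.
split=> [|x1 y Hx Hy|a x1 Hx|a x1 Hx]; first exact: rep_act0.
- by rewrite rep_actB Hx Hy subrr.
- by rewrite rep_actM Hx mulmx0.
- by rewrite rep_actM Hx mul0mx.
Qed.

Definition rep_module of satisfies R := 'cV[k]_d.
Local Notation M := (rep_module VR).
HB.instance Definition _ := GRing.Zmodule.on M.

Definition rep_scale (x : Lambda) (m : M) : M := rep_act (repr x) *m m.

Lemma rep_scaleE x m : rep_scale (bqa_proj R x) m = rep_act x *m m.
Proof.
congr (_ *m _); apply/eqP; rewrite -subr_eq0 -rep_actB; apply/eqP.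
by apply: rep_act_ideal; apply/bqa_projP; rewrite bqa_reprK.
Qed.

Let scaleA x y m : rep_scale x (rep_scale y m) = rep_scale (x * y) m.
Proof.
elim/bqa_ind: x => x; elim/bqa_ind: y => y.
by rewrite -[_ * _]bqa_projM !rep_scaleE rep_actM mulmxA.
Qed.
Let scale1 : left_id 1 rep_scale.
Proof. by move=> m; rewrite -[1]/(bqa_proj R 1) rep_scaleE rep_act1 mul1mx. Qed.
Let scaleDr : right_distributive rep_scale +%R.
Proof. by move=> x m1 m2; rewrite /rep_scale mulmxDr. Qed.
Let scaleDl m : {morph rep_scale^~ m : x y / x + y}.
Proof.
do 2![elim/bqa_ind=> ?].
by rewrite /= -bqa_projD !rep_scaleE rep_actD mulmxDl.
Qed.
HB.instance Definition _ :=
  GRing.Zmodule_isLmodule.Build Lambda M scaleA scale1 scaleDr scaleDl.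

End Representations.

Section Modules.
Variables (k : fieldType) (Q : quiver) (R : path_algebra k Q -> Prop).
Local Notation A := (bqa R).

Definition kscale (M : lmodType A) (c : k) (m : M) : M := (c *: (1 : A)) *: m.

Definition findim (M : lmodType A) : Prop :=
  exists (d : nat) (b : 'I_d -> M),
    forall m : M, exists c : 'I_d -> k, m = \sum_(i < d) kscale (c i) (b i).

Record fdmod := FDMod { fd_mod :> lmodType A; fd_findim : findim fd_mod }.

Definition miso (M N : fdmod) : Prop := exists f : {linear M -> N}, bijective f.

Definition is_zero_mod (M : fdmod) : Prop := forall m : M, m = 0.

Lemma zero_findim : findim 'rV[A]_0.
Proof.
exists 0, (fun=> 0) => m; exists (fun=> 0).
by rewrite big_ord0; apply/rowP => -[].
Qed.
Definition fd_zero : fdmod := FDMod zero_findim.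

Lemma prod_findim (M N : fdmod) : findim (M * N)%type.
Proof.
have [d1 [b1 span1]] := fd_findim M; have [d2 [b2 span2]] := fd_findim N.
exists (d1 + d2)%N,
  (fun i => match split i with inl i1 => (b1 i1, 0) | inr i2 => (0, b2 i2) end).
move=> [m1 m2]; have [c1 m1E] := span1 m1; have [c2 m2E] := span2 m2.
exists (fun i => match split i with inl i1 => c1 i1 | inr i2 => c2 i2 end).
have splitl i1 : split (@lshift d1 d2 i1) = inl i1 := unsplitK (inl i1).
have splitr i2 : split (@rshift d1 d2 i2) = inr i2 := unsplitK (inr i2).
rewrite big_split_ord /=.
under eq_bigr do rewrite splitl; under [X in _ + X]eq_bigr do rewrite splitr.
apply: injective_projections => /=; rewrite !raddf_sum /=.
  by rewrite m1E [X in _ + X]big1 ?addr0 // => i _; rewrite /kscale scaler0.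
by rewrite m2E [X in X + _]big1 ?add0r // => i _; rewrite /kscale scaler0.
Qed.
Definition fd_prod (M N : fdmod) : fdmod := FDMod (prod_findim M N).

Definition indecomposable (M : fdmod) : Prop :=
  ~ is_zero_mod M /\
  forall N P : fdmod, miso M (fd_prod N P) -> is_zero_mod N \/ is_zero_mod P.

Definition projective (P : fdmod) : Prop :=
  forall (M N : fdmod) (g : {linear M -> N}) (f : {linear P -> N}),
    (forall n, exists m, g m = n) -> exists h : {linear P -> M}, g \o h =1 f.

Record proj_resolution (M : fdmod) := ProjResolution {
  pr_ob :> nat -> fdmod;
  pr_d : forall i, {linear pr_ob i.+1 -> pr_ob i};
  pr_aug : {linear pr_ob 0%N -> M};
  pr_proj : forall i, projective (pr_ob i);
  pr_surj : forall m, exists x, pr_aug x = m;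
  pr_exact0 : forall x, pr_aug x = 0 <-> exists y, pr_d 0%N y = x;
  pr_exact : forall i x, pr_d i x = 0 <-> exists y, pr_d i.+1 y = x
}.

(* Ext^i(M, N) = 0.  Ext^0 is Hom, and Ext^(i+1) is the cohomology of Hom(P, N)
   in degree i+1 for a projective resolution P of M; whether it vanishes does
   not depend on P, and every module has a resolution by finite-dimensional
   projectives as soon as A is finite-dimensional. *)
Definition Ext_vanishes (i : nat) (M N : fdmod) : Prop :=
  if i is j.+1 then
    forall (P : proj_resolution M) (f : {linear P j.+1 -> N}),
      (forall x, f (pr_d P j.+1 x) = 0) ->
      exists g : {linear P j -> N}, f =1 g \o pr_d P j
  else forall (f : {linear M -> N}) (m : M), f m = 0.

(* The k-algebra End(M) is isomorphic to k iff its structure map k -> End(M),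
   c |-> c id, is bijective, since every k-algebra map k -> End(M) is the
   structure map. *)
Definition End_is_k (M : fdmod) : Prop :=
  forall f : {linear M -> M}, exists! c : k, forall m, f m = kscale c m.

Definition exceptional (M : fdmod) : Prop :=
  [/\ indecomposable M, End_is_k M &
      forall i, (0 < i)%N -> Ext_vanishes i M M].

Definition exceptional_sequence (r : nat) (M : 'I_r -> fdmod) : Prop :=
  (forall x, exceptional (M x)) /\
  (forall x y : 'I_r, (y < x)%N -> forall i, Ext_vanishes i (M x) (M y)).

Record bcomplex := BComplex {
  cx_ob :> int -> fdmod;
  cx_d : forall i : int, {linear cx_ob i -> cx_ob (i + 1)};
  cx_dd : forall i x, cx_d (i + 1) (cx_d i x) = 0;
  cx_bounded : exists b : nat, forall i : int, (b < `|i|)%N -> is_zero_mod (cx_ob i)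
}.

Record chain_map (X Y : bcomplex) := ChainMap {
  cm_fun :> forall i : int, {linear X i -> Y i};
  cm_comm : forall i x, cm_fun (i + 1) (cx_d X i x) = cx_d Y i (cm_fun i x)
}.

(* f is bijective on cohomology in every degree (all degrees are written i+1,
   so that the incoming differential is [cx_d _ i]). *)
Definition quasi_iso (X Y : bcomplex) (f : chain_map X Y) : Prop :=
  (forall (i : int) (x : X (i + 1)), cx_d X (i + 1) x = 0 ->
     (exists y, f (i + 1) x = cx_d Y i y) -> exists x', x = cx_d X i x') /\
  (forall (i : int) (y : Y (i + 1)), cx_d Y (i + 1) y = 0 ->
     exists2 x, cx_d X (i + 1) x = 0 & exists y', y = f (i + 1) x + cx_d Y i y').

(* Isomorphism in the bounded derived category, as a roof X <- Z -> Y *)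
Definition derived_iso (X Y : bcomplex) : Prop :=
  exists (Z : bcomplex) (s : chain_map Z X) (t : chain_map Z Y),
    quasi_iso s /\ quasi_iso t.

Section Stalk.
Variable M : fdmod.
Definition stalk_ob (i : int) : fdmod := if i == 0 then M else fd_zero.
Definition stalk_d (i : int) : {linear stalk_ob i -> stalk_ob (i + 1)} := \0.
Lemma stalk_dd i x : stalk_d (i + 1) (stalk_d i x) = 0. Proof. by []. Qed.
Lemma stalk_bounded :
  exists b : nat, forall i : int, (b < `|i|)%N -> is_zero_mod (stalk_ob i).
Proof.
exists 0%N => i; rewrite /stalk_ob absz_gt0 => /negPf -> m.
by apply/rowP => -[].
Qed.
Definition stalk : bcomplex := BComplex stalk_dd stalk_bounded.
End Stalk.

Section Shift.
Variable X : bcomplex.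
Definition shift_ob (i : int) : fdmod := X (i + 1).
Definition shift_d (i : int) : {linear shift_ob i -> shift_ob (i + 1)} :=
  \- cx_d X (i + 1).
Lemma shift_dd i x : shift_d (i + 1) (shift_d i x) = 0.
Proof. by rewrite /= linearN cx_dd !oppr0. Qed.
Lemma shift_bounded :
  exists b : nat, forall i : int, (b < `|i|)%N -> is_zero_mod (shift_ob i).
Proof.
have [b bX] := cx_bounded X; exists b.+1 => i bi; apply: bX.
lia.
Qed.
Definition shift : bcomplex := BComplex shift_dd shift_bounded.
End Shift.

Section Cone.
Variables (X Y : bcomplex) (f : chain_map X Y).
Definition cone_ob (i : int) : fdmod := fd_prod (X (i + 1)) (Y i).
Definition cone_fun (i : int) (z : cone_ob i) : cone_ob (i + 1) :=
  (- cx_d X (i + 1) z.1, f (i + 1) z.1 + cx_d Y i z.2).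
Lemma cone_fun_linear i : linear (@cone_fun i).
Proof.
move=> c [x1 y1] [x2 y2]; rewrite /cone_fun /= !linearP; congr (_, _).
by rewrite /= scalerDr addrACA.
Qed.
HB.instance Definition _ i :=
  GRing.isLinear.Build A (cone_ob i) (cone_ob (i + 1)) *:%R (@cone_fun i)
    (@cone_fun_linear i).
Definition cone_d (i : int) : {linear cone_ob i -> cone_ob (i + 1)} := @cone_fun i.
Lemma cone_dd i x : cone_d (i + 1) (cone_d i x) = 0.
Proof.
case: x => x y; rewrite /= /cone_fun /= !linearN /= cx_dd oppr0 oppr0.
by rewrite linearD /= cx_dd addr0 cm_comm addNr.
Qed.
Lemma cone_bounded :
  exists b : nat, forall i : int, (b < `|i|)%N -> is_zero_mod (cone_ob i).
Proof.
have [b bX] := cx_bounded X; have [c cY] := cx_bounded Y.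
exists (maxn b.+1 c) => i; rewrite gtn_max => /andP[bi ci] [x y].
by congr (_, _); [apply: bX; lia | apply: cY].
Qed.
Definition cone : bcomplex := BComplex cone_dd cone_bounded.
End Cone.

(* T is (the class of objects of) a strictly full triangulated subcategory of
   the bounded derived category.  The standard triangles X -> Y -> cone f ->
   X[1] of chain maps are enough: a morphism of the derived category is a roof
   X <-s- Z -f-> Y with s a quasi-isomorphism, and completes to a distinguished
   triangle whose third term is isomorphic to cone f, while X and Z are
   isomorphic. *)
Record triangulated_subcategory (T : bcomplex -> Prop) : Prop := {
  tri_zero : T (stalk fd_zero);
  tri_iso : forall X Y, derived_iso X Y -> T X -> T Y;
  tri_shift : forall X, T (shift X) <-> T X;
  tri_cone : forall X Y (f : chain_map X Y), T X -> T Y -> T (cone f)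
}.

Definition generates_Db (r : nat) (M : 'I_r -> fdmod) : Prop :=
  forall T : bcomplex -> Prop, triangulated_subcategory T ->
    (forall x, T (stalk (M x))) -> forall X, T X.

Definition full_exceptional_sequence (r : nat) (M : 'I_r -> fdmod) : Prop :=
  exceptional_sequence M /\ generates_Db M.

End Modules.

Section RepFD.
Variables (k : fieldType) (Q : quiver) (R : path_algebra k Q -> Prop).
Variables (V : qrep k Q) (VR : satisfies V R).

Lemma rep_kscale (c : k) (m : 'cV[k]_(rep_dim V)) :
  kscale c (m : rep_module VR) = c *: m :> 'cV[k]_(rep_dim V).
Proof.
have cE : c *: (1 : bqa R) = bqa_proj R (c *: (1 : path_algebra k Q)).
  by rewrite bqa_projZ.
rewrite /kscale cE -[LHS]/(rep_scale _ (m : rep_module VR)).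
by rewrite rep_scaleE rep_actZ rep_act1 -scalemxAl mul1mx.
Qed.

Lemma rep_findim : findim (rep_module VR).
Proof.
exists (rep_dim V), (fun i => delta_mx i 0) => m.
exists (fun i => (m : 'cV[k]_(rep_dim V)) i 0).
rewrite [LHS](matrix_sum_delta (m : 'cV[k]_(rep_dim V))); apply: eq_bigr => i _.
by rewrite big_ord1 rep_kscale.
Qed.

Definition rep_fdmod : fdmod R := FDMod rep_findim.

End RepFD.

Section Lambda.
Variables (k : fieldType) (n : nat).

(* Vertices are numbered from 0: the ordinal i stands for the vertex i+1, and
   the arrows alpha i, alpha' i (i < n-1) join the vertices [lo i] = i and
   [hi i] = i+1. *)
Lemma hi_subproof (i : 'I_n.-1) : (i.+1 < n)%N.
Proof. by rewrite -ltn_predRL. Qed.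
Definition lo (i : 'I_n.-1) : 'I_n := widen_ord (leq_pred n) i.
Definition hi (i : 'I_n.-1) : 'I_n := Ordinal (hi_subproof i).

(* [inl i] is alpha_i : lo i -> hi i, and [inr i] is alpha'_i : hi i -> lo i. *)
Definition Lambda_quiver : quiver := {|
  Q0 := 'I_n;
  Q1 := ('I_n.-1 + 'I_n.-1)%type;
  src := fun a => match a with inl i => lo i | inr i => hi i end;
  tgt := fun a => match a with inl i => hi i | inr i => lo i end
|}.

Definition alpha (i : 'I_n.-1) : path_algebra k Lambda_quiver :=
  arrow k (inl i : Q1 Lambda_quiver).
Definition alpha' (i : 'I_n.-1) : path_algebra k Lambda_quiver :=
  arrow k (inr i : Q1 Lambda_quiver).

(* Lambda_n is [bqa Lambda_rel]; its modules are the terms of [fdmod Lambda_rel]. *)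
Inductive Lambda_rel : path_algebra k Lambda_quiver -> Prop :=
| Lambda_rel_aa (i j : 'I_n.-1) : j = i.+1 :> nat -> Lambda_rel (alpha j * alpha i)
| Lambda_rel_a'a' (i j : 'I_n.-1) : j = i.+1 :> nat -> Lambda_rel (alpha' i * alpha' j)
| Lambda_rel_aa' (i : 'I_n.-1) : Lambda_rel (alpha i * alpha' i).

Lemma rep_satisfies (V : qrep k Lambda_quiver) :
  (forall i j : 'I_n.-1, j = i.+1 :> nat ->
     @rep_mx _ _ V (inl j) *m @rep_mx _ _ V (inl i) = 0) ->
  (forall i j : 'I_n.-1, j = i.+1 :> nat ->
     @rep_mx _ _ V (inr i) *m @rep_mx _ _ V (inr j) = 0) ->
  (forall i : 'I_n.-1, @rep_mx _ _ V (inl i) *m @rep_mx _ _ V (inr i) = 0) ->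
  satisfies V Lambda_rel.
Proof.
move=> Vaa Va'a' Vaa' _ [i j ij|i j ij|i];
  by rewrite rep_actM !rep_actU !path_mx_arrow; auto.
Qed.

Lemma L_graded (i : 'I_n) (a : Q1 Lambda_quiver) (x y : 'I_1) :
  (0 : 'M[k]_1) x y != 0 -> i = src a /\ i = tgt a.
Proof. by rewrite mxE eqxx. Qed.
Definition L_rep (i : 'I_n) : qrep k Lambda_quiver :=
  @QRep k Lambda_quiver 1 (fun=> i) (fun=> 0) (L_graded i).
Lemma L_satisfies i : satisfies (L_rep i) Lambda_rel.
Proof. by apply: rep_satisfies => *; rewrite mul0mx. Qed.
Definition L (i : 'I_n) : fdmod Lambda_rel := rep_fdmod (L_satisfies i).

(* Delta(i) and nabla(i) have dimension 1 for the first vertex and 2 for the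
   others; the basis vector 0 sits at i and the basis vector 1 (if any) at the
   preceding vertex. *)
Definition std_dim (i : 'I_n) : nat := (if i == 0 :> nat then 1 else 2)%N.
Lemma std_vtx_subproof (i : 'I_n) (x : 'I_(std_dim i)) : (i - x < n)%N.
Proof. exact: leq_ltn_trans (leq_subr x i) (ltn_ord i). Qed.
Definition std_vtx (i : 'I_n) (x : 'I_(std_dim i)) : Q0 Lambda_quiver :=
  Ordinal (std_vtx_subproof x).

(* In Delta(i) the arrow alpha' from i to the preceding vertex sends the basis
   vector 0 to the basis vector 1; all other arrows act as 0. *)
Definition Delta_mx (i : 'I_n) (a : Q1 Lambda_quiver) : 'M[k]_(std_dim i) :=
  match a with
  | inl _ => 0
  | inr j => \matrix_(x, y) [&& hi j == i, x == 1%N :> nat & y == 0%N :> nat]%:R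
  end.
Lemma Delta_graded i a (x y : 'I_(std_dim i)) :
  Delta_mx i a x y != 0 -> std_vtx y = src a /\ std_vtx x = tgt a.
Proof.
case: a => j; rewrite mxE ?eqxx //; case: and3P; rewrite ?eqxx // => -[/eqP ij].
move=> /eqP x1 /eqP y0 _; split; apply: val_inj; rewrite /= ?x1 ?y0 -?ij /=; lia.
Qed.
Definition Delta_rep i : qrep k Lambda_quiver := QRep (@Delta_graded i).
Lemma Delta_satisfies i : satisfies (Delta_rep i) Lambda_rel.
Proof.
apply: rep_satisfies => [*|i1 j1 _|*]; rewrite ?mul0mx //=.
apply/matrixP => x y.
by rewrite !mxE big1 // => -[[|z] zlt] _; rewrite !mxE /= ?andbF ?mulr0 ?mul0r.
Qed.
Definition Delta (i : 'I_n) : fdmod Lambda_rel := rep_fdmod (@Delta_satisfies i).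

(* In nabla(i) the arrow alpha from the preceding vertex to i sends the basis
   vector 1 to the basis vector 0; all other arrows act as 0. *)
Definition nabla_mx (i : 'I_n) (a : Q1 Lambda_quiver) : 'M[k]_(std_dim i) :=
  match a with
  | inl j => \matrix_(x, y) [&& hi j == i, x == 0%N :> nat & y == 1%N :> nat]%:R
  | inr _ => 0
  end.
Lemma nabla_graded i a (x y : 'I_(std_dim i)) :
  nabla_mx i a x y != 0 -> std_vtx y = src a /\ std_vtx x = tgt a.
Proof.
case: a => j; rewrite mxE ?eqxx //; case: and3P; rewrite ?eqxx // => -[/eqP ij].
move=> /eqP x0 /eqP y1 _; split; apply: val_inj; rewrite /= ?x0 ?y1 -?ij /=; lia.
Qed.
Definition nabla_rep i : qrep k Lambda_quiver := QRep (@nabla_graded i).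
Lemma nabla_satisfies i : satisfies (nabla_rep i) Lambda_rel.
Proof.
apply: rep_satisfies => [i1 j1 _|*|*]; rewrite ?mul0mx ?mulmx0 //=.
apply/matrixP => x y.
by rewrite !mxE big1 // => -[[|z] zlt] _; rewrite !mxE /= ?andbF ?mulr0 ?mul0r.
Qed.
Definition nabla (i : 'I_n) : fdmod Lambda_rel := rep_fdmod (@nabla_satisfies i).

End Lambda.

(* Main.v *)
(* Lambda_n is quadratic monomial, so every module has an explicit finite
   projective resolution indexed by the Koszul words alpha^t alpha'^s.  It shows
   that the Euler form is chi(M, N) = sum_j a_j(M) a_j(N), where a_j(M) is the
   coefficient of [Delta(j)] in the class of M.  An exceptional M has
   chi(M, M) = 1, hence [M] = [Delta(j)] for some j, and such an M is Delta(j) or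
   nabla(j).  Fullness forces every j to occur, in particular j = 1, and the
   nonvanishing of Ext^(j-i)(Delta(i), Delta(j)) and Ext^(j-i)(nabla(j), nabla(i))
   for i < j forces the order.  Since L(1) is both standard and costandard, all
   terms before it are costandard and all terms after it are standard. *)
Require Import Defs.
From HB Require Import structures.
From mathcomp Require Import all_boot all_order all_algebra.
From mathcomp Require Import boolp zify.

Set Implicit Arguments.
Unset Strict Implicit.
Unset Printing Implicit Defensive.

Import Order.TTheory GRing.Theory Num.Theory.
Local Open Scope ring_scope.

(** * The algebra *)

(** [Ext_vanishes] quantifies over all projective resolutions, so vanishing may be used at one
    chosen resolution and nonvanishing may be shown there; resolutions are never compared. The
    chosen one is the Koszul bimodule complex of the algebra tensored with M: not minimal in
    general, but given by one formula for every M, with Hom complexes whose basis can be counted. A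
    sum of integer squares equal to 1 leaves a single a_j = 1 or -1, and the sign is + because the
    dimension of M at j is a_j + a_(j+1). So M has the dimension vector of Delta(j); besides
    Delta(j) and nabla(j) the only candidate is a sum of two simples, which has too many
    endomorphisms. Modules are abstract, and bases of vectors fixed by vertex idempotents turn them
    into matrices. The difficult point is exactness of the Koszul complex: dividing by the last
    arrow is a contracting homotopy only up to terms coming from alpha' alpha, the one composable
    product of two arrows that is not a relation. Fullness is tested on the alternating sum of a_i
    over the degrees of a complex, which is additive on cones. *)

Section KScale.
Variables (k : fieldType) (Q : quiver) (R : path_algebra k Q -> Prop).
Local Notation A := (bqa R).

Lemma bqa_scaleE (c : k) (x : A) : c *: x = (c *: (1 : A)) * x.
Proof. by rewrite -bqa_scaleAl mul1r. Qed.

Lemma bqa_scalar_comm (c : k) (x : A) : x * (c *: (1 : A)) = (c *: (1 : A)) * x.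
Proof. by rewrite -bqa_scaleAr mulr1 -bqa_scaleE. Qed.

Section M.
Variable M : lmodType A.
Implicit Types (m : M) (c d : k).

Lemma kscale1 m : kscale 1 m = m.
Proof. by rewrite /kscale !scale1r. Qed.
Lemma kscale0 m : kscale 0 m = 0.
Proof. by rewrite /kscale scale0r scale0r. Qed.
Lemma kscaler0 c : kscale c (0 : M) = 0.
Proof. by rewrite /kscale scaler0. Qed.
Lemma kscaleDl c d m : kscale (c + d) m = kscale c m + kscale d m.
Proof. by rewrite /kscale !scalerDl. Qed.
Lemma kscaleNl c m : kscale (- c) m = - kscale c m.
Proof. by rewrite /kscale !scaleNr. Qed.
Lemma kscaleA c d m : kscale c (kscale d m) = kscale (c * d) m.
Proof. by rewrite /kscale scalerA -bqa_scaleAl mul1r scalerA. Qed.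
Lemma kscale_comm c (x : A) m : x *: kscale c m = kscale c (x *: m).
Proof. by rewrite /kscale !scalerA bqa_scalar_comm. Qed.
Lemma kscale_bqa c (x : A) m : (c *: x) *: m = kscale c (x *: m).
Proof. by rewrite bqa_scaleE -scalerA. Qed.
Lemma kscale_sumr (I : finType) (P : pred I) c (F : I -> M) :
  kscale c (\sum_(i | P i) F i) = \sum_(i | P i) kscale c (F i).
Proof. exact: scaler_sumr. Qed.
End M.

Lemma kscale_linear (M N : lmodType A) (f : {linear M -> N}) c m :
  f (kscale c m) = kscale c (f m).
Proof. exact: linearZ. Qed.

Lemma bqa_proj0 : bqa_proj R 0 = 0.
Proof. by apply: (@addrI _ (bqa_proj R 0)); rewrite -bqa_projD !addr0. Qed.

Lemma bqa_proj_mul x y : bqa_proj R (x * y) = bqa_proj R x * bqa_proj R y.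
Proof. exact: bqa_projM. Qed.

Lemma bqa_proj_rel r : R r -> bqa_proj R r = 0.
Proof. by move=> Rr; rewrite -bqa_proj0; apply/bqa_projP; rewrite subr0 => J _; apply. Qed.

Lemma bqa_proj_scale c x : bqa_proj R (c *: x) = c *: bqa_proj R x.
Proof. exact: bqa_projZ. Qed.

End KScale.

Section Gen.
Variables (k : fieldType) (n : nat).
Local Notation R := (@Lambda_rel k n).
Local Notation Q := (Lambda_quiver n).
Local Notation Lam := (bqa R).

(* [en v] is the idempotent at v, [an v] is the arrow v -> v+1 and [bn v] the
   arrow v -> v-1, all numbered from 0 and equal to 0 when out of range. *)
Definition en (v : nat) : Lam :=
  \sum_(w : 'I_n | w == v :> nat) bqa_proj R (vertex k (w : Q0 Q)).
Definition an (v : nat) : Lam :=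
  \sum_(i : 'I_n.-1 | i == v :> nat) bqa_proj R (alpha k i).
Definition bn (v : nat) : Lam :=
  \sum_(i : 'I_n.-1 | i.+1 == v) bqa_proj R (alpha' k i).

Lemma big_ord_val (T : nmodType) (p v : nat) (F : 'I_p -> T) (vp : (v < p)%N) :
  \sum_(w : 'I_p | w == v :> nat) F w = F (Ordinal vp).
Proof. by rewrite (big_pred1 (Ordinal vp)) // => w; rewrite -val_eqE. Qed.

Lemma enE (v : 'I_n) : en v = bqa_proj R (vertex k (v : Q0 Q)).
Proof. by rewrite /en (big_ord_val _ (ltn_ord v)); congr (bqa_proj _ (vertex _ _)); apply: val_inj. Qed.
Lemma anE (i : 'I_n.-1) : an i = bqa_proj R (alpha k i).
Proof. by rewrite /an (big_ord_val _ (ltn_ord i)); congr (bqa_proj _ (alpha _ _)); apply: val_inj. Qed.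
Lemma bnE (i : 'I_n.-1) : bn i.+1 = bqa_proj R (alpha' k i).
Proof. by rewrite /bn (big_ord_val _ (ltn_ord i)); congr (bqa_proj _ (alpha' _ _)); apply: val_inj. Qed.

Lemma en_out v : (n <= v)%N -> en v = 0.
Proof. by move=> nv; rewrite /en big_pred0 // => w; apply/eqP; case: w => w /=; lia. Qed.
Lemma an_out v : (n <= v.+1)%N -> an v = 0.
Proof. by move=> nv; rewrite /an big_pred0 // => w; apply/eqP; case: w => w /=; lia. Qed.
Lemma bn_out v : (n <= v)%N -> bn v = 0.
Proof. by move=> nv; rewrite /bn big_pred0 // => w; apply/eqP; case: w => w /=; lia. Qed.
Lemma bn0 : bn 0 = 0.
Proof. by rewrite /bn big_pred0. Qed.

Variant en_spec (v : nat) : Lam -> Type :=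
 | EnIn (w : 'I_n) of v = w :> nat : en_spec v (bqa_proj R (vertex k (w : Q0 Q)))
 | EnOut of (n <= v)%N : en_spec v 0.
Lemma enP v : en_spec v (en v).
Proof.
case: (ltnP v n) => [vn|nv]; last by rewrite en_out //; constructor.
by have /= -> := enE (Ordinal vn); exact: (@EnIn v (Ordinal vn) erefl).
Qed.

Lemma pbasisM (p q : qpath Q) :
  pbasis k p * pbasis k q = pbasis_mul k p q :> path_algebra k Q.
Proof. exact: pa_mulUU. Qed.

Lemma vertexM (v w : Q0 Q) : vertex k v * vertex k w = if v == w then vertex k v else 0.
Proof.
rewrite /vertex pbasisM /pbasis_mul /psrc /ptgt /=.
case: eqP => // -> ; congr pbasis; by apply: val_inj; rewrite /= pcatP.
Qed.

Lemma arrow_tgt (a : Q1 Q) : vertex k (tgt a) * arrow k a = arrow k a.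
Proof.
rewrite /vertex pbasisM /pbasis_mul /psrc /ptgt /= eqxx.
by congr pbasis; apply: val_inj; rewrite /= pcatP.
Qed.
Lemma arrow_src (a : Q1 Q) : arrow k a * vertex k (src a) = arrow k a.
Proof.
rewrite /vertex pbasisM /pbasis_mul /psrc /ptgt /= eqxx.
by congr pbasis; apply: val_inj; rewrite /= pcatP.
Qed.

Lemma en_mul v w : en v * en w = if v == w then en v else 0.
Proof.
case: (enP v) => [v' ->|nv]; last by rewrite mul0r; case: ifP.
case: (enP w) => [w' ->|nw]; last first.
  by rewrite mulr0; case: ifP => // /eqP vw; case: v' vw => v' /=; lia.
by rewrite -bqa_proj_mul vertexM val_eqE; case: ifP => //; rewrite bqa_proj0.
Qed.

Lemma en_idem v : en v * en v = en v. Proof. by rewrite en_mul eqxx. Qed.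
Lemma en_neq v w : v != w -> en v * en w = 0.
Proof. by rewrite en_mul => /negPf ->. Qed.

Lemma bqa_proj_sum (I : finType) (F : I -> path_algebra k Q) :
  bqa_proj R (\sum_i F i) = \sum_i bqa_proj R (F i).
Proof. by apply: (big_morph _ (bqa_projD R) (bqa_proj0 R)). Qed.

Lemma sum_en : \sum_(v < n) en v = 1.
Proof.
by rewrite -[1]/(bqa_proj R (pa_one k Q)) /pa_one bqa_proj_sum; apply: eq_bigr => v _; rewrite enE.
Qed.

Lemma an_l v : en v.+1 * an v = an v.
Proof.
case: (ltnP v n.-1) => [vn|]; last by move=> nv; rewrite an_out ?mulr0 //; lia.
have /= -> := anE (Ordinal vn); have /= -> := enE (hi (Ordinal vn)).
by rewrite -bqa_proj_mul (arrow_tgt (inl (Ordinal vn))).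
Qed.
Lemma an_r v : an v * en v = an v.
Proof.
case: (ltnP v n.-1) => [vn|]; last by move=> nv; rewrite an_out ?mul0r //; lia.
have /= -> := anE (Ordinal vn); have /= -> := enE (lo (Ordinal vn)).
by rewrite -bqa_proj_mul (arrow_src (inl (Ordinal vn))).
Qed.
Lemma bn_l v : en v * bn v.+1 = bn v.+1.
Proof.
case: (ltnP v n.-1) => [vn|]; last by move=> nv; rewrite bn_out ?mulr0 //; lia.
have /= -> := bnE (Ordinal vn); have /= -> := enE (lo (Ordinal vn)).
by rewrite -bqa_proj_mul (arrow_tgt (inr (Ordinal vn))).
Qed.
Lemma bn_r v : bn v * en v = bn v.
Proof.
case: v => [|v]; first by rewrite bn0 mul0r.
case: (ltnP v n.-1) => [vn|]; last by move=> nv; rewrite bn_out ?mul0r //; lia.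
have /= -> := bnE (Ordinal vn); have /= -> := enE (hi (Ordinal vn)).
by rewrite -bqa_proj_mul (arrow_src (inr (Ordinal vn))).
Qed.

Lemma an_an v w : an w * an v = 0.
Proof.
have [->|wv] := eqVneq w v.+1; last first.
  by rewrite -(an_r w) -(an_l v) mulrA -(mulrA (an w)) en_neq // mulr0 mul0r.
case: (ltnP v.+1 n.-1) => [vn|nv]; last by rewrite an_out ?mul0r //; lia.
have /= -> := anE (Ordinal vn); have /= -> := anE (Ordinal (ltnW vn)).
by rewrite -bqa_proj_mul; apply: bqa_proj_rel; apply: Lambda_rel_aa.
Qed.
Lemma bn_bn v w : bn v * bn w = 0.
Proof.
case: w => [|w]; first by rewrite bn0 mulr0.
have [->|wv] := eqVneq v w; last first.
  by rewrite -(bn_r v) -(bn_l w) mulrA -(mulrA (bn v)) en_neq // mulr0 mul0r.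
case: w => [|w]; first by rewrite bn0 mul0r.
case: (ltnP w.+1 n.-1) => [vn|nv]; last by rewrite (@bn_out w.+2) ?mulr0 //; lia.
have /= -> := bnE (Ordinal vn); have /= -> := bnE (Ordinal (ltnW vn)).
by rewrite -bqa_proj_mul; apply: bqa_proj_rel; apply: Lambda_rel_a'a'.
Qed.
Lemma an_bn v w : an w * bn v = 0.
Proof.
case: v => [|v]; first by rewrite bn0 mulr0.
have [->|wv] := eqVneq w v; last first.
  by rewrite -(an_r w) -(bn_l v) mulrA -(mulrA (an w)) en_neq // mulr0 mul0r.
case: (ltnP v n.-1) => [vn|nv]; last by rewrite an_out ?mul0r //; lia.
have /= -> := anE (Ordinal vn); have /= -> := bnE (Ordinal vn).
by rewrite -bqa_proj_mul; apply: bqa_proj_rel; apply: Lambda_rel_aa'.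
Qed.

(** Paths grow at their end, that is by left multiplication, so for left modules it suffices to
    follow arrows acting from the left. *)
Lemma Lam_ind (P : Lam -> Prop) :
  P 0 -> (forall x y, P x -> P y -> P (x + y)) -> (forall c x, P x -> P (c *: x)) ->
  (forall v, P (en v)) -> (forall v x, P x -> P (an v * x)) ->
  (forall v x, P x -> P (bn v * x)) -> forall x, P x.
Proof.
move=> P0 PD PZ Pe Pa Pb; elim/bqa_ind; elim/pa_ind => [|p|x y Px Py|c x Px].
- by rewrite bqa_proj0.
- case: p => -[v s] ps; elim/last_ind: s ps => [|s a IHs] ps.
    have -> : QPath ps = trivial_path v by apply: val_inj.
    by have := Pe (v : 'I_n); rewrite enE.
  have ps' : is_path (v, s).1 (v, s).2.
    by move: ps; rewrite /= -cats1 is_path_cat => /andP[].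
  have sa : psrc (arrow_path a) = ptgt (QPath ps').
    by move: ps; rewrite /= -cats1 is_path_cat /= andbT => /andP[_ /eqP].
  have -> : pbasis k (QPath ps) = arrow k a * pbasis k (QPath ps').
    rewrite /arrow pbasisM /pbasis_mul sa eqxx; congr pbasis; apply: val_inj.
    by rewrite /= pcatP //= cats1.
  rewrite bqa_proj_mul; have {IHs}:= IHs ps'; case: a {ps sa} => i IHs.
    by rewrite -[arrow _ _]/(alpha k i) -anE; apply: Pa.
  by rewrite -[arrow _ _]/(alpha' k i) -bnE; apply: Pb.
- by rewrite bqa_projD; apply: PD.
- by rewrite bqa_proj_scale; apply: PZ.
Qed.

Lemma Lam_linear (M N : lmodType Lam) (f : M -> N) :
  {morph f : x y / x + y} -> (forall c m, f (kscale c m) = kscale c (f m)) ->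
  (forall v m, f (en v *: m) = en v *: f m) ->
  (forall v m, f (an v *: m) = an v *: f m) ->
  (forall v m, f (bn v *: m) = bn v *: f m) -> linear f.
Proof.
move=> fD fZ fe fa fb x m m'; rewrite fD; congr (_ + _).
have f0 : f 0 = 0 by rewrite -[in LHS](kscale0 0) fZ kscale0.
elim/Lam_ind: x m => [|x y IHx IHy|c x IHx|v|v x IHx|v x IHx] m.
- by rewrite !scale0r f0.
- by rewrite !scalerDl fD IHx IHy.
- by rewrite !kscale_bqa fZ IHx.
- exact: fe.
- by rewrite -!scalerA fa IHx.
- by rewrite -!scalerA fb IHx.
Qed.

(** The only product of two arrows starting at g that is not a relation is alpha' alpha, and every
    third arrow kills it. *)
Lemma Lam_en_span (g : nat) (x : Lam) :
  exists c1 ca cb cba : k,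
    x * en g = c1 *: en g + ca *: an g + cb *: bn g + cba *: (bn g.+1 * an g).
Proof.
elim/Lam_ind: x => [|x y [c1 [ca [cb [cba Ex]]]] [d1 [da [db [dba Ey]]]]|c x [c1 [ca [cb [cba Ex]]]]|v|v x|v x].
- by exists 0, 0, 0, 0; rewrite mul0r !scale0r !addr0.
- exists (c1 + d1), (ca + da), (cb + db), (cba + dba).
  rewrite mulrDl Ex Ey !scalerDl [LHS]addrACA; congr (_ + _).
  by rewrite [LHS]addrACA; congr (_ + _); rewrite addrACA.
- exists (c * c1), (c * ca), (c * cb), (c * cba).
  by rewrite -bqa_scaleAl Ex !scalerDr !scalerA.
- exists (v == g)%:R, 0, 0, 0; rewrite !scale0r !addr0 en_mul.
  by case: eqP => [->|_]; rewrite ?scale1r ?scale0r.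
- move=> [c1 [ca [cb [cba Ex]]]]; exists 0, ((v == g)%:R * c1), 0, 0.
  rewrite -mulrA Ex !mulrDr -!bqa_scaleAr an_an an_bn mulrA an_bn mul0r.
  rewrite !scaler0 !scale0r add0r !addr0 -scalerA scalerA mulrC -scalerA; congr (_ *: _).
  by case: eqP => [->|/eqP vg]; rewrite ?scale1r ?scale0r ?an_r // -(an_r v) -mulrA en_neq // mulr0.
- move=> [c1 [ca [cb [cba Ex]]]]; exists 0, 0, ((v == g)%:R * c1), ((v == g.+1)%:R * ca).
  rewrite -mulrA Ex !mulrDr -!bqa_scaleAr bn_bn mulrA bn_bn mul0r.
  rewrite !scaler0 !scale0r add0r !addr0 add0r [_ * c1]mulrC [_ * ca]mulrC -!scalerA; congr (_ *: _ + _ *: _).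
    by case: eqP => [->|/eqP vg]; rewrite ?scale1r ?scale0r ?bn_r // -(bn_r v) -mulrA en_neq // mulr0.
  case: eqP => [->|/eqP vg]; rewrite ?scale1r ?scale0r // -(bn_r v) -(an_l g) mulrA -(mulrA (bn v)).
  by rewrite en_neq // mulr0 mul0r.
Qed.

End Gen.

Section RepAction.
Variables (k : fieldType) (n : nat).
Local Notation R := (@Lambda_rel k n).
Variables (V : qrep k (Lambda_quiver n)) (VR : satisfies V R).
Local Notation M := (rep_fdmod VR).

Lemma rep_en (v : 'I_n) (m : M) : en k n v *: m = rep_proj V v *m (m : 'cV_(rep_dim V)).
Proof. by rewrite enE -[LHS]/(rep_scale _ _) rep_scaleE rep_actU path_mx_trivial. Qed.
Lemma rep_an (i : 'I_n.-1) (m : M) :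
  an k n i *: m = @rep_mx _ _ V (inl i) *m (m : 'cV_(rep_dim V)).
Proof. by rewrite anE -[LHS]/(rep_scale _ _) rep_scaleE rep_actU path_mx_arrow. Qed.
Lemma rep_bn (i : 'I_n.-1) (m : M) :
  bn k n i.+1 *: m = @rep_mx _ _ V (inr i) *m (m : 'cV_(rep_dim V)).
Proof. by rewrite bnE -[LHS]/(rep_scale _ _) rep_scaleE rep_actU path_mx_arrow. Qed.

End RepAction.

(* The uniserial module with layers g, g+1, g, on which [alpha' alpha] is nonzero. *)
Section UniserialLoop.
Variables (k : fieldType) (n : nat) (g : 'I_n.-1).

Definition loop_mx (a : Q1 (Lambda_quiver n)) : 'M[k]_3 :=
  match a with
  | inl j => \matrix_(x, y) [&& j == g, x == 1 :> nat & y == 0 :> nat]%:R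
  | inr j => \matrix_(x, y) [&& j == g, x == 2 :> nat & y == 1 :> nat]%:R
  end.
Definition loop_vtx (x : 'I_3) : Q0 (Lambda_quiver n) := if x == 1 :> nat then hi g else lo g.
Lemma loop_graded a (x y : 'I_3) :
  loop_mx a x y != 0 -> loop_vtx y = src a /\ loop_vtx x = tgt a.
Proof.
by case: a => j; rewrite mxE; case: and3P; rewrite ?eqxx // => -[/eqP -> /eqP x1 /eqP y0] _;
  rewrite /loop_vtx x1 y0.
Qed.
Definition loop_rep := QRep loop_graded.

Lemma loop_satisfies : satisfies loop_rep (@Lambda_rel k n).
Proof.
apply: rep_satisfies => [i j _|i j ij|i] /=; apply/matrixP => x y;
  rewrite !mxE big1 // => z _; rewrite !mxE -natrM mulnb;
  case E: (_ && _) => //; move: E; rewrite -!val_eqE /=; lia.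
Qed.

(** A quotient by relations may collapse, so nonvanishing is certified by a module on which the
    element sends the basis vector 0 to the basis vector 2. Nonvanishing of e, a and b is later
    deduced from this. *)
Lemma bnan_neq0 : bn k n g.+1 * an k n g != 0.
Proof.
apply/eqP => ba0; pose w : rep_fdmod loop_satisfies := delta_mx 0 0 : 'cV_3.
have : (bn k n g.+1 * an k n g) *: w = 0 by rewrite ba0 scale0r.
rewrite -scalerA rep_an rep_bn => /matrixP/(_ (2 : 'I_3) 0).
rewrite mxE (bigD1 (1 : 'I_3)) //= big1 => [|z]; last first.
  by rewrite -val_eqE /= => /negPf z1; rewrite !mxE eqxx /= z1 ?mul0r ?mulr0.
rewrite !mxE eqxx /= mul1r addr0 (bigD1 (0 : 'I_3)) //= big1 => [|z]; last first.
  by rewrite -val_eqE /= => /negPf z1; rewrite !mxE eqxx /= z1 ?mul0r ?mulr0.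
by rewrite !mxE !eqxx /= mulr1 addr0 => /eqP; rewrite oner_eq0.
Qed.
End UniserialLoop.

(** * Normal forms in the algebra and right division by an arrow *)

Section Coef.
Variables (k : fieldType) (n : nat) (hn : (1 < n)%N).
Local Notation Lam := (bqa (@Lambda_rel k n)).
Local Notation en := (en k n).
Local Notation an := (an k n).
Local Notation bn := (bn k n).
Implicit Types (x : Lam).

Lemma bnan_neq0' g : (g.+1 < n)%N -> bn g.+1 * an g != 0.
Proof.
move=> gn; have g' : (g < n.-1)%N by lia.
have /= h := bnan_neq0 k (Ordinal g'); exact h.
 Qed.

Lemma bqa_scale_eq0 (c : k) x : c *: x = 0 -> x != 0 -> c = 0.
Proof.
move=> cx /eqP x0; apply/eqP/negPn/negP => c0; apply: x0.
by rewrite -[x]scale1r -(mulVf c0) -scalerA cx scaler0.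
Qed.

Lemma en_neq0 g : (g < n)%N -> en g != 0.
Proof.
move=> gn; apply/eqP => e0; case: (ltnP g.+1 n) => [gn'|ng].
  by have := bnan_neq0' gn'; rewrite -(an_r k n g) e0 !mulr0 eqxx.
case: g gn e0 ng => [|g] gn e0 ng; first by lia.
by have := bnan_neq0' gn; rewrite -(an_l k n g) e0 mul0r mulr0 eqxx.
Qed.

(* Coefficients with respect to the spanning set e, a, b, ba of [Lam * en g];
   the coefficient of a spanning vector that is zero is taken to be 0. *)
Definition cvec g (c : k * k * k * k) : Lam :=
  c.1.1.1 *: en g + c.1.1.2 *: an g + c.1.2 *: bn g + c.2 *: (bn g.+1 * an g).
Definition cnorm g (c : k * k * k * k) : Prop :=
  [/\ (n <= g)%N -> c.1.1.1 = 0, (n <= g.+1)%N -> c.1.1.2 = 0,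
      (g == 0%N) || (n <= g)%N -> c.1.2 = 0 & (n <= g.+1)%N -> c.2 = 0].

Lemma coef_subproof g x : exists c, cnorm g c /\ x * en g = cvec g c.
Proof.
have [c1 [ca [cb [cba ->]]]] := Lam_en_span g x.
exists (if (g < n)%N then c1 else 0, if (g.+1 < n)%N then ca else 0,
  if (0 < g < n)%N then cb else 0, if (g.+1 < n)%N then cba else 0).
split; first by split => /=; case: ifP => //; lia.
rewrite /cvec /=; congr (_ + _ + _ + _).
- by case: ltnP => // ng; rewrite en_out // !scaler0.
- by case: ltnP => // ng; rewrite an_out // !scaler0.
- case: g => [|g]; first by rewrite bn0 !scaler0.
  by case: (ltnP g.+1 n) => //= ng; rewrite bn_out // !scaler0.
- by case: ltnP => // ng; rewrite an_out // mulr0 !scaler0.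
Qed.
Definition coef g x : k * k * k * k := projT1 (cid (coef_subproof g x)).

Lemma coef_spec g x : cnorm g (coef g x) /\ x * en g = cvec g (coef g x).
Proof. exact: (projT2 (cid (coef_subproof g x))). Qed.

(** Left multiplication isolates one coefficient at a time: by [bn g.+1] that of a, by the
    idempotent one vertex below that of b, by [an g] that of e (at the last vertex a and ba vanish
    and e is left alone). What remains is a multiple of ba. *)
Lemma cvec0 g c : cnorm g c -> cvec g c = 0 -> c = (0, 0, 0, 0).
Proof.
case: c => -[[c1 ca] cb] cba [/= n1 na nb nba] c0.
have ca0 : ca = 0.
  case: (ltnP g.+1 n) => [gn|/na//].
  apply: (@bqa_scale_eq0 _ (bn g.+1 * an g)); last exact: bnan_neq0'.
  have /(congr1 ( *%R (bn g.+1))) := c0.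
  rewrite /cvec /= mulr0 !mulrDr -!bqa_scaleAr bn_bn (mulrA _ (bn _)) bn_bn mul0r !scaler0 !addr0.
  have -> : bn g.+1 * en g = 0 by rewrite -(bn_r k n) -mulrA en_neq ?mulr0 //; lia.
  by rewrite scaler0 add0r.
have cb0 : cb = 0.
  case: g n1 na nb nba c0 => [|g] n1 na nb nba c0; first exact: nb.
  case: (ltnP g.+1 n) => [gn|gn]; last by apply: nb; rewrite gn orbT.
  apply: (@bqa_scale_eq0 _ (bn g.+1)); last first.
    by apply: contra_neq (bnan_neq0' gn) => ->; rewrite mul0r.
  have /(congr1 ( *%R (en g))) := c0.
  rewrite mulr0 /cvec /= ca0 scale0r addr0 !mulrDr -!bqa_scaleAr mulrA bn_l.
  rewrite -(bn_l k n g.+1) !mulrA !en_neq ?mul0r; try lia.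
  by rewrite !scaler0 add0r addr0.
have c10 : c1 = 0.
  case: (ltnP g n) => [gn|/n1//].
  case: (ltnP g.+1 n) => [gn'|gn']; last first.
    apply: (@bqa_scale_eq0 _ (en g)); last exact: en_neq0.
    by move: c0; rewrite /cvec /= ca0 cb0 nba // !scale0r !addr0.
  apply: (@bqa_scale_eq0 _ (an g)).
    have /(congr1 ( *%R (an g))) := c0.
    rewrite /cvec /= ca0 cb0 !scale0r !addr0 mulr0 mulrDr -!bqa_scaleAr an_r.
    by rewrite mulrA an_bn mul0r scaler0 addr0.
  by apply: contra_neq (bnan_neq0' gn') => ->; rewrite mulr0.
suff cba0 : cba = 0 by rewrite ca0 cb0 c10 cba0.
case: (ltnP g.+1 n) => [gn|/nba//].
apply: (@bqa_scale_eq0 _ (bn g.+1 * an g)); last exact: bnan_neq0'.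
by move: c0; rewrite /cvec /= ca0 cb0 c10 !scale0r !add0r.
Qed.

Definition caddN (c d : k * k * k * k) : k * k * k * k :=
  (c.1.1.1 - d.1.1.1, c.1.1.2 - d.1.1.2, c.1.2 - d.1.2, c.2 - d.2).

Lemma coef_uniq g x c : cnorm g c -> x * en g = cvec g c -> coef g x = c.
Proof.
move=> nc Ec; have [nd Ed] := coef_spec g x; set d := coef g x in nd Ed *.
have : caddN d c = (0, 0, 0, 0).
  apply: (@cvec0 g).
    case: nc nd => c1 c2 c3 c4 [d1 d2 d3 d4].
    by split => /= h; [rewrite c1 ?d1 | rewrite c2 ?d2 | rewrite c3 ?d3 | rewrite c4 ?d4];
      rewrite ?subrr.
  rewrite /cvec /= !scalerBl.
  have -> : forall a b c d a' b' c' d' : Lam,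
    a - a' + (b - b') + (c - c') + (d - d') = (a + b + c + d) - (a' + b' + c' + d').
    move=> a b e f a' b' e' f'; rewrite !opprD [RHS]addrACA; congr (_ + _).
    by rewrite [RHS]addrACA; congr (_ + _); rewrite addrACA.
  by rewrite -!/(cvec g _) -Ed -Ec subrr.
case: d c {nc Ec nd Ed} => -[[d1 d2] d3] d4 -[[[c1 c2] c3] c4] [] /=.
by do 4!(move=> /eqP; rewrite subr_eq0 => /eqP ->).
Qed.

Lemma coefD g x y : coef g (x + y) =
  ((coef g x).1.1.1 + (coef g y).1.1.1, (coef g x).1.1.2 + (coef g y).1.1.2,
   (coef g x).1.2 + (coef g y).1.2, (coef g x).2 + (coef g y).2).
Proof.
have [[c1 c2 c3 c4] Ex] := coef_spec g x; have [[d1 d2 d3 d4] Ey] := coef_spec g y.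
apply: coef_uniq.
  by split => /= h; [rewrite c1 ?d1 | rewrite c2 ?d2 | rewrite c3 ?d3 | rewrite c4 ?d4];
    rewrite ?addr0.
rewrite mulrDl Ex Ey /cvec /= !scalerDl [LHS]addrACA; congr (_ + _).
by rewrite [LHS]addrACA; congr (_ + _); rewrite addrACA.
Qed.

Lemma coefZ g c x : coef g (c *: x) =
  (c * (coef g x).1.1.1, c * (coef g x).1.1.2, c * (coef g x).1.2, c * (coef g x).2).
Proof.
have [[c1 c2 c3 c4] Ex] := coef_spec g x; apply: coef_uniq.
  by split => /= h; [rewrite c1 | rewrite c2 | rewrite c3 | rewrite c4]; rewrite ?mulr0.
by rewrite -bqa_scaleAl Ex /cvec !scalerDr !scalerA.
Qed.

Lemma coef_an p x : (p.+1 < n)%N ->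
  coef p (x * an p) = (0, (coef p.+1 x).1.1.1, 0, (coef p.+1 x).1.2).
Proof.
move=> pn; have [_ Ex] := coef_spec p.+1 x; apply: coef_uniq.
  by split => //= h; lia.
have -> : x * an p * en p = (x * en p.+1) * an p by rewrite -!mulrA an_r an_l.
rewrite Ex /cvec /= !mulrDl -!bqa_scaleAl an_l an_an -mulrA an_an mulr0 !scaler0 !scale0r.
by rewrite !addr0 add0r.
Qed.

Lemma coef_bn q x : (q.+1 < n)%N -> coef q.+1 (x * bn q.+1) = (0, 0, (coef q x).1.1.1, 0).
Proof.
move=> pn; have [_ Ex] := coef_spec q x; apply: coef_uniq.
  by split => //= h; lia.
have -> : x * bn q.+1 * en q.+1 = (x * en q) * bn q.+1 by rewrite -!mulrA bn_r bn_l.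
rewrite Ex /cvec /= !mulrDl -!bqa_scaleAl bn_l an_bn bn_bn -mulrA an_bn mulr0 !scaler0 !scale0r.
by rewrite !addr0 !add0r.
Qed.

(* Right division by a and by b. *)
Definition rhoa g x : Lam := (coef g x).1.1.2 *: en g.+1 + (coef g x).2 *: bn g.+1.
Definition rhob g x : Lam := if g is p.+1 then (coef g x).1.2 *: en p else 0.

Lemma rhoaD g : {morph rhoa g : x y / x + y}.
Proof. by move=> x y; rewrite /rhoa coefD /= !scalerDl addrACA. Qed.
Lemma rhoaZ g c x : rhoa g (c *: x) = c *: rhoa g x.
Proof. by rewrite /rhoa coefZ /= scalerDr !scalerA. Qed.
Lemma rhoa0 g : rhoa g 0 = 0.
Proof. by rewrite -[X in rhoa g X](scale0r 0) rhoaZ scale0r. Qed.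
Lemma rhobD g : {morph rhob g : x y / x + y}.
Proof. by case: g => [|g] x y /=; rewrite ?addr0 // coefD /= scalerDl. Qed.
Lemma rhobZ g c x : rhob g (c *: x) = c *: rhob g x.
Proof. by case: g => [|g] /=; rewrite ?scaler0 // coefZ /= scalerA. Qed.
Lemma rhob0 g : rhob g 0 = 0.
Proof. by rewrite -[X in rhob g X](scale0r 0) rhobZ scale0r. Qed.
Lemma rhoa_sum g (I : finType) (F : I -> Lam) : rhoa g (\sum_i F i) = \sum_i rhoa g (F i).
Proof. exact: (big_morph _ (rhoaD g) (rhoa0 g)). Qed.
Lemma rhob_sum g (I : finType) (F : I -> Lam) : rhob g (\sum_i F i) = \sum_i rhob g (F i).
Proof. exact: (big_morph _ (rhobD g) (rhob0 g)). Qed.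

Definition cba g x : k := (coef g x).2.
Lemma cbaD g : {morph cba g : x y / x + y}.
Proof. by move=> x y; rewrite /cba coefD. Qed.
Lemma cbaZ g c x : cba g (c *: x) = c * cba g x.
Proof. by rewrite /cba coefZ. Qed.
Lemma cba0 g : cba g 0 = 0.
Proof. by rewrite -[X in cba g X](scale0r 0) cbaZ mul0r. Qed.
Lemma cba_sum g (I : finType) (F : I -> Lam) : cba g (\sum_i F i) = \sum_i cba g (F i).
Proof. exact: (big_morph _ (cbaD g) (cba0 g)). Qed.

Lemma rhoa_en g x : rhoa g x * en g.+1 = rhoa g x.
Proof. by rewrite /rhoa mulrDl -!bqa_scaleAl en_idem bn_r. Qed.
Lemma rhob_en g x : rhob g.+1 x * en g = rhob g.+1 x.
Proof. by rewrite /= -bqa_scaleAl en_idem. Qed.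

(** The local contraction identity at a word ending in alpha, whose only Koszul extension is by
    alpha: the first term recovers the coefficients of e and b, the second those of a and ba. *)
Lemma rhoa_an p x : (p.+1 < n)%N -> x * en p.+1 = x ->
  rhoa p (x * an p) + rhoa p.+1 x * an p.+1 = x.
Proof.
move=> pn xe; have [[_ n2 _ n4] Ex] := coef_spec p.+1 x.
rewrite -[in RHS]xe Ex /rhoa /cvec coef_an //= mulrDl -!bqa_scaleAl an_l.
by rewrite addrACA addrA.
Qed.
Lemma rhoa_bn p x : rhoa p (x * bn p) = 0.
Proof.
case: p => [|p]; first by rewrite bn0 mulr0 rhoa0.
case: (ltnP p.+1 n) => pn; last by rewrite bn_out // mulr0 rhoa0.
by rewrite /rhoa coef_bn //= !scale0r addr0.
Qed.
(** The local contraction identity at a word ending in alpha', which can be extended by alpha and by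
    alpha'; hence one more term than in [rhoa_an]. *)
Lemma rhob_bn j x : (j.+1 < n)%N -> x * en j = x ->
  rhob j.+1 (x * bn j.+1) + rhoa j x * an j + rhob j x * bn j = x.
Proof.
move=> jn xe; have [[_ n2 n3 n4] Ex] := coef_spec j x.
rewrite -[in RHS]xe Ex /rhoa /cvec /= coef_bn //= mulrDl -!bqa_scaleAl an_l.
rewrite !addrA [RHS]addrAC; congr (_ + _).
case: j {jn xe n2 Ex n4} n3 => [|j] n3 /=; first by rewrite mul0r bn0 scaler0.
by rewrite -bqa_scaleAl bn_l.
Qed.
Lemma rhob_an p x : rhob p (x * an p) = 0.
Proof.
case: (ltnP p.+1 n) => pn; last by rewrite an_out // mulr0 rhob0.
by case: p pn => [|p] pn //; rewrite /rhob coef_an //= scale0r.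
Qed.
(** Right multiplication by a turns b into ba, so the coefficient extracted by [rhob] reappears as a
    ba coefficient, where a cycle condition can be applied. *)
Lemma cba_an j x : (j.+1 < n)%N -> rhob j.+1 x = cba j (x * an j) *: en j.
Proof. by move=> jn; rewrite /= /cba coef_an. Qed.
Lemma cba_bn j x : cba j (x * bn j) = 0.
Proof.
case: j => [|p]; first by rewrite bn0 mulr0 cba0.
case: (ltnP p.+1 n) => pn; last by rewrite bn_out // mulr0 cba0.
by rewrite /cba coef_bn.
Qed.
Lemma rho_decomp g x : x * en g = x ->
  x = (coef g x).1.1.1 *: en g + rhoa g x * an g + rhob g x * bn g.
Proof.
move=> xe; have [_ Ex] := coef_spec g x; rewrite -[LHS]xe Ex /rhoa /cvec.
rewrite mulrDl -!bqa_scaleAl an_l !addrA [LHS]addrAC; congr (_ + _).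
case: g {xe Ex} => [|g] /=; first by rewrite bn0 scaler0 mulr0.
by rewrite -bqa_scaleAl bn_l.
Qed.
End Coef.

(** * Homogeneous bases *)

Section HBasis.
Variables (k : fieldType) (n : nat).
Local Notation Lam := (bqa (@Lambda_rel k n)).
Local Notation en := (en k n).
Local Notation an := (an k n).
Local Notation bn := (bn k n).

(** Such a basis recovers a quiver representation from an abstract module. Linearity of [hb_co] is
    not part of the data: it follows from freeness. *)
Record hbasis (M : lmodType Lam) (D : nat) := HBasis {
  hb_vec : 'I_D -> M;
  hb_vtx : 'I_D -> 'I_n;
  hb_homog : forall x, en (hb_vtx x) *: hb_vec x = hb_vec x;
  hb_co : M -> 'I_D -> k;
  hb_span : forall m, m = \sum_x kscale (hb_co m x) (hb_vec x);
  hb_free : forall c : 'I_D -> k, \sum_x kscale (c x) (hb_vec x) = 0 -> forall x, c x = 0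
}.

Definition homog_span (M : lmodType Lam) (D : nat) : Prop :=
  exists (b : 'I_D -> M) (v : 'I_D -> 'I_n), (forall x, en (v x) *: b x = b x) /\
    forall m, exists c : 'I_D -> k, m = \sum_x kscale (c x) (b x).

Lemma homog_span_exists (M : fdmod (@Lambda_rel k n)) : exists D, homog_span M D.
Proof.
have [d [b span]] := fd_findim M.
pose T := ('I_d * 'I_n)%type.
exists #|{: T}|, (fun i : 'I_#|{: T}| => en (enum_val i).2 *: b (enum_val i).1),
  (fun i : 'I_#|{: T}| => (enum_val i).2).
split=> [x|m]; first by rewrite scalerA en_idem.
have [c ->] := span m; exists (fun i : 'I_#|{: T}| => c (enum_val i).1).
transitivity (\sum_(i : T) kscale (c i.1) (en i.2 *: b i.1)); last first.
  by rewrite (reindex _ (onW_bij _ (@enum_val_bij T))).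
rewrite -(pair_bigA _ (fun i (j : 'I_n) => kscale (c i) (en j *: b i))) /=; apply: eq_bigr => i _.
by rewrite -kscale_sumr -scaler_suml sum_en scale1r.
Qed.

Lemma homog_span_drop (M : lmodType Lam) D (b : 'I_D.+1 -> M) (v : 'I_D.+1 -> 'I_n) c x0 :
  (forall x, en (v x) *: b x = b x) ->
  (forall m, exists c : 'I_D.+1 -> k, m = \sum_x kscale (c x) (b x)) ->
  \sum_x kscale (c x) (b x) = 0 -> c x0 != 0 -> homog_span M D.
Proof.
move=> bh bs c0 cx0; exists (fun x => b (lift x0 x)), (fun x => v (lift x0 x)).
split=> // m; have [d ->] := bs m.
(* Subtracting this multiple of the relation clears the coordinate at [x0]. *)
exists (fun x => d (lift x0 x) - d x0 * (c x0)^-1 * c (lift x0 x)).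
have -> : \sum_x kscale (d x) (b x) =
    \sum_x kscale (d x - d x0 * (c x0)^-1 * c x) (b x).
  apply/esym; under eq_bigr do rewrite kscaleDl kscaleNl -kscaleA.
  by rewrite big_split /= sumrN -kscale_sumr c0 kscaler0 subr0.
rewrite (bigD1_ord x0) //= mulfVK // subrr kscale0 add0r.
by apply: eq_bigr.
Qed.

(** A homogeneous spanning family of minimal size is free, since any relation would allow one vector
    to be dropped. *)
Lemma hbasis_exists (M : fdmod (@Lambda_rel k n)) : exists D, inhabited (hbasis M D).
Proof.
have exD : exists D, `[< homog_span M D >].
  by have [D hD] := homog_span_exists M; exists D; apply/asboolP.
case: (ex_minnP exD) => D /asboolP[b [v [bh bs]]] Dmin; exists D; constructor.
apply: (@HBasis _ _ b v bh (fun m => projT1 (cid (bs m)))) => [m|c c0 x].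
  exact: projT2 (cid (bs m)).
apply/eqP/negPn/negP => cx; case: D b v bh bs c x c0 cx Dmin => [|D] b v bh bs c x c0 cx Dmin.
  by case: x {cx}.
suff /asboolP/Dmin : homog_span M D by rewrite ltnn.
exact: homog_span_drop bh bs c0 cx.
Qed.

Section Theory.
Variables (M : lmodType Lam) (D : nat) (hb : hbasis M D).
Local Notation vec := (hb_vec hb).
Local Notation vtx := (hb_vtx hb).
Local Notation co := (hb_co hb).

Lemma hb_uniq (c : 'I_D -> k) m : m = \sum_x kscale (c x) (vec x) -> co m =1 c.
Proof.
move=> mE x; apply/eqP; rewrite -subr_eq0; apply/eqP.
apply: (hb_free (h := hb) (c := fun x => co m x - c x)).
under eq_bigr do rewrite kscaleDl kscaleNl.
by rewrite big_split /= sumrN -hb_span -mE subrr.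
Qed.

Lemma hb_coD m m' x : co (m + m') x = co m x + co m' x.
Proof.
apply: (hb_uniq (c := fun x => co m x + co m' x)).
by under eq_bigr do rewrite kscaleDl; rewrite big_split /= -!hb_span.
Qed.
Lemma hb_coZ c m x : co (kscale c m) x = c * co m x.
Proof.
apply: (hb_uniq (c := fun x => c * co m x)).
by under eq_bigr do rewrite -kscaleA; rewrite -kscale_sumr -hb_span.
Qed.
Lemma hb_co0 x : co 0 x = 0.
Proof. by rewrite -(kscale0 0) hb_coZ mul0r. Qed.
Lemma hb_co_sum (I : finType) (F : I -> M) x : co (\sum_i F i) x = \sum_i co (F i) x.
Proof. by apply: (big_morph (co^~ x)) => [m m'|]; rewrite ?hb_coD ?hb_co0. Qed.
Lemma hb_co_vec x y : co (vec y) x = (x == y)%:R.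
Proof.
apply: (hb_uniq (c := fun x => (x == y)%:R)).
rewrite (bigD1 y) //= eqxx kscale1 big1 ?addr0 // => i /negPf ->.
exact: kscale0.
Qed.
Lemma hb_inj m m' : co m =1 co m' -> m = m'.
Proof. by move=> mm; rewrite (hb_span hb m) (hb_span hb m'); under eq_bigr do rewrite mm. Qed.
Lemma hb_act (r : Lam) m : r *: m = \sum_x kscale (co m x) (r *: vec x).
Proof.
rewrite {1}(hb_span hb m) scaler_sumr; apply: eq_bigr => x _; exact: kscale_comm.
Qed.
Lemma hb_en_vec v x : en v *: vec x = if vtx x == v :> nat then vec x else 0.
Proof.
rewrite -(hb_homog hb) scalerA en_mul eq_sym.
by case: eqP => [->|_]; rewrite ?hb_homog ?scale0r.
Qed.
Lemma hb_co_en v m x : co (en v *: m) x = if vtx x == v :> nat then co m x else 0.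
Proof.
apply: (hb_uniq (c := fun x => if vtx x == v :> nat then co m x else 0)).
rewrite hb_act; apply: eq_bigr => y _; rewrite hb_en_vec.
by case: eqP; rewrite ?kscaler0 ?kscale0.
Qed.

(** All arrows alpha share one matrix, and all alpha' share [hbB]: the vertices of the row and the
    column tell which arrow an entry belongs to. *)
Definition hbA x y := co (an (vtx y) *: vec y) x.
Definition hbB x y := co (bn (vtx y) *: vec y) x.

Lemma hb_an_vec v y : an v *: vec y = if vtx y == v :> nat then \sum_x kscale (hbA x y) (vec x) else 0.
Proof.
case: eqP => [<-|/eqP nv]; first exact: hb_span.
by rewrite -(an_r k n v) -scalerA hb_en_vec (negPf nv) scaler0.
Qed.
Lemma hb_bn_vec v y : bn v *: vec y = if vtx y == v :> nat then \sum_x kscale (hbB x y) (vec x) else 0.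
Proof.
case: eqP => [<-|/eqP nv]; first exact: hb_span.
by rewrite -(bn_r k n v) -scalerA hb_en_vec (negPf nv) scaler0.
Qed.
Lemma hbA_vtx x y : hbA x y != 0 -> vtx x = (vtx y).+1 :> nat.
Proof. by apply: contra_neq_eq => nv; rewrite /hbA -an_l -scalerA hb_co_en (negPf nv). Qed.
Lemma hbB_vtx x y : hbB x y != 0 -> vtx y = (vtx x).+1 :> nat.
Proof.
rewrite /hbB; case Ey: (vtx y : nat) => [|w]; first by rewrite bn0 scale0r hb_co0 eqxx.
rewrite -bn_l -scalerA hb_co_en.
by have [->|] := eqVneq (vtx x : nat) w; rewrite ?eqxx.
Qed.

Lemma hb_co_an v m x :
  co (an v *: m) x = \sum_(y | vtx y == v :> nat) hbA x y * co m y.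
Proof.
rewrite hb_act hb_co_sum [RHS]big_mkcond; apply: eq_bigr => y _.
rewrite hb_coZ; case: eqP => [<-|/eqP nv]; first by rewrite mulrC.
by rewrite hb_an_vec (negPf nv) hb_co0 mulr0.
Qed.
Lemma hb_co_bn v m x :
  co (bn v *: m) x = \sum_(y | vtx y == v :> nat) hbB x y * co m y.
Proof.
rewrite hb_act hb_co_sum [RHS]big_mkcond; apply: eq_bigr => y _.
rewrite hb_coZ; case: eqP => [<-|/eqP nv]; first by rewrite mulrC.
by rewrite hb_bn_vec (negPf nv) hb_co0 mulr0.
Qed.

(** The defining relations read on matrices, here and in the next two lemmas; the product [hbB]
    times [hbA] alone stays free. *)
Lemma hbAA x z : \sum_y hbA x y * hbA y z = 0.
Proof.
transitivity (co (an (vtx z).+1 *: (an (vtx z) *: vec z)) x); last first.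
  by rewrite scalerA an_an scale0r hb_co0.
rewrite hb_co_an [RHS]big_mkcond; apply: eq_bigr => y _; case: eqP => [//|nv].
by have [->|/hbA_vtx//] := eqVneq (hbA y z) 0; rewrite mulr0.
Qed.
Lemma hbBB x z : \sum_y hbB x y * hbB y z = 0.
Proof.
transitivity (co (bn (vtx z).-1 *: (bn (vtx z) *: vec z)) x); last first.
  by rewrite scalerA bn_bn scale0r hb_co0.
rewrite hb_co_bn [RHS]big_mkcond; apply: eq_bigr => y _; case: eqP => [//|nv].
by have [->|/hbB_vtx vv] := eqVneq (hbB y z) 0; rewrite ?mulr0 //; case: nv; rewrite vv.
Qed.
Lemma hbAB x z : \sum_y hbA x y * hbB y z = 0.
Proof.
transitivity (co (an (vtx z).-1 *: (bn (vtx z) *: vec z)) x); last first.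
  by rewrite scalerA an_bn scale0r hb_co0.
rewrite hb_co_an [RHS]big_mkcond; apply: eq_bigr => y _; case: eqP => [//|nv].
by have [->|/hbB_vtx vv] := eqVneq (hbB y z) 0; rewrite ?mulr0 //; case: nv; rewrite vv.
Qed.
End Theory.
End HBasis.

(** * Finite sums of projective left ideals *)

Section Free.
Variables (k : fieldType) (n : nat).
Local Notation Lam := (bqa (@Lambda_rel k n)).
Local Notation en := (en k n).
Local Notation an := (an k n).
Local Notation bn := (bn k n).

(* The direct sum of the left ideals [Lam * ep i]. *)
Section Def.
Variables (I : finType) (ep : I -> Lam).

Definition fam_pred : {pred {ffun I -> Lam^o}} :=
  fun f => [forall i, (f i : Lam) * ep i == f i].
Lemma fam_submod : submod_closed fam_pred.
Proof.
split=> [|c f g /forallP Ff /forallP Fg]; apply/forallP => i; rewrite !ffunE.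
  by rewrite mul0r.
by rewrite mulrDl -[c *: f i]/(c * f i) -mulrA (eqP (Ff i)) (eqP (Fg i)).
Qed.
HB.instance Definition _ := GRing.isSubmodClosed.Build Lam {ffun I -> Lam^o} fam_pred fam_submod.

Record fam := Fam { fam_val :> {ffun I -> Lam^o}; _ : fam_val \in fam_pred }.
HB.instance Definition _ := [isSub for fam_val].
HB.instance Definition _ := [Choice of fam by <:].
HB.instance Definition _ := [SubChoice_isSubLmodule of fam by <:].

Lemma fam_ep (f : fam) i : (f i : Lam) * ep i = f i.
Proof. by have /forallP/(_ i)/eqP := valP f. Qed.

Lemma famP (f g : fam) : (forall i, f i = g i) -> f = g.
Proof. by move=> fg; apply: val_inj; apply/ffunP. Qed.
Lemma fam_add (f g : fam) i : (f + g) i = f i + g i.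
Proof. by rewrite -[LHS]/((val f + val g) i) ffunE. Qed.
Lemma fam_scale (c : Lam) (f : fam) i : (c *: f) i = c * (f i : Lam).
Proof. by rewrite -[LHS]/((c *: val f) i) ffunE. Qed.
Lemma fam_zero i : (0 : fam) i = 0.
Proof. by rewrite -[LHS]/((0 : {ffun I -> Lam^o}) i) ffunE. Qed.

Hypothesis ep_idem : forall i, ep i * ep i = ep i.

Lemma mkfam_subproof (F : I -> Lam) : [ffun i => F i * ep i : Lam^o] \in fam_pred.
Proof. by apply/forallP => i; rewrite ffunE -mulrA ep_idem. Qed.
Definition mkfam F : fam := Fam (mkfam_subproof F).
Lemma mkfamE F i : mkfam F i = F i * ep i.
Proof. by rewrite /= ffunE. Qed.

Definition famgen (i : I) : fam := mkfam (fun i' => if i' == i then ep i else 0).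
Lemma fam_sum (J : finType) (F : J -> fam) i : (\sum_j F j) i = \sum_j (F j i : Lam).
Proof. by apply: (big_morph (fun f : fam => f i : Lam)) => [f g|]; rewrite ?fam_add ?fam_zero. Qed.
Lemma famgenE (f : fam) : f = \sum_i (f i : Lam) *: famgen i.
Proof.
apply: famP => i; rewrite fam_sum (bigD1 i) // fam_scale mkfamE eqxx ep_idem fam_ep.
rewrite big1 => [|j /negPf ji]; first by rewrite /= addr0.
by rewrite fam_scale mkfamE eq_sym ji mul0r mulr0.
Qed.

Section Hom.
Variables (N : lmodType Lam) (v : I -> N).
Definition famhom (f : fam) : N := \sum_i (f i : Lam) *: v i.
Lemma famhom_linear : linear famhom.
Proof.
move=> c f g; rewrite /famhom scaler_sumr -big_split /=; apply: eq_bigr => i _.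
by rewrite -[_ i]/(fam_val (c *: f + g) i) fam_add fam_scale scalerDl scalerA.
Qed.
HB.instance Definition _ := GRing.isLinear.Build Lam fam N *:%R famhom famhom_linear.
Lemma famhom_gen i : famhom (famgen i) = ep i *: v i.
Proof.
rewrite /famhom (bigD1 i) // mkfamE eqxx ep_idem big1 => [|j /negPf ji]; first by rewrite /= addr0.
by rewrite mkfamE ji mul0r scale0r.
Qed.
End Hom.

Lemma fam_lin (N : lmodType Lam) (h : {linear fam -> N}) f :
  h f = \sum_i (f i : Lam) *: h (famgen i).
Proof. by rewrite {1}(famgenE f) linear_sum; apply: eq_bigr => i _; rewrite linearZ. Qed.

Lemma Lam_span : exists (d : nat) (b : 'I_d -> Lam),
  forall x : Lam, exists c : 'I_d -> k, x = \sum_i c i *: b i.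
Proof.
pose T := ('I_n * 'I_4)%type.
pose u (i : T) : Lam := nth 0 [:: en i.1; an i.1; bn i.1; bn i.1.+1 * an i.1] i.2.
exists #|{: T}|, (fun i : 'I_#|{: T}| => u (enum_val i)) => x.
have /choice[c Hc] : forall v : 'I_n, exists c : 'I_4 -> k, x * en v = \sum_j c j *: u (v, j).
  move=> v; have [c1 [ca [cb [cba E]]]] := Lam_en_span v x.
  exists (fun j : 'I_4 => nth 0 [:: c1; ca; cb; cba] j).
  by rewrite E !big_ord_recl big_ord0 /u /= addr0 !addrA.
exists (fun i : 'I_#|{: T}| => c (enum_val i).1 (enum_val i).2).
transitivity (\sum_(i : T) c i.1 i.2 *: u i); last first.
  by rewrite (reindex _ (onW_bij _ (@enum_val_bij T))).
rewrite -[LHS]mulr1 -sum_en mulr_sumr.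
rewrite (eq_bigr (fun i : T => c i.1 i.2 *: u (i.1, i.2))) => [|[]//].
rewrite -(pair_bigA _ (fun i (j : 'I_4) => c i j *: u (i, j))) /=.
by apply: eq_bigr => v _; rewrite Hc.
Qed.

Lemma fam_findim : findim fam.
Proof.
have [d [b Hb]] := Lam_span; pose T := (I * 'I_d)%type.
exists #|{: T}|, (fun i : 'I_#|{: T}| => b (enum_val i).2 *: famgen (enum_val i).1) => f.
have /choice[c Hc] : forall i : I, exists c : 'I_d -> k, f i = \sum_j c j *: b j.
  by move=> i; exact: Hb.
exists (fun i : 'I_#|{: T}| => c (enum_val i).1 (enum_val i).2).
transitivity (\sum_(i : T) kscale (c i.1 i.2) (b i.2 *: famgen i.1)); last first.
  by rewrite (reindex _ (onW_bij _ (@enum_val_bij T))).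
rewrite -(pair_bigA _ (fun i (j : 'I_d) => kscale (c i j) (b j *: famgen i))) /=.
rewrite {1}(famgenE f); apply: eq_bigr => i _.
by rewrite {1}Hc scaler_suml; apply: eq_bigr => j _; rewrite kscale_bqa.
Qed.
Definition fd_fam : fdmod (@Lambda_rel k n) := FDMod fam_findim.

Lemma fam_projective : projective fd_fam.
Proof.
move=> M N g f gs.
have /choice[v Hv] : forall i, exists m, g m = f (famgen i) by move=> i; exact: gs.
exists (famhom v : {linear fam -> M}) => x /=.
rewrite /famhom linear_sum (fam_lin f); apply: eq_bigr => i _.
by rewrite linearZ Hv.
Qed.
End Def.
End Free.

(** * The Koszul resolution *)

Section MatOp.
Variables (k : fieldType) (n : nat) (D : nat).
Local Notation Lam := (bqa (@Lambda_rel k n)).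
Implicit Types (P Q : 'I_D -> 'I_D -> k) (f g : 'I_D -> Lam).
Definition mxact P f x : Lam := \sum_y P x y *: f y.

Lemma mxact_comp0 P Q f x : (forall z, \sum_y P x y * Q y z = 0) -> mxact P (mxact Q f) x = 0.
Proof.
move=> PQ; rewrite /mxact; under eq_bigr do rewrite scaler_sumr.
rewrite exchange_big big1 // => z _ /=.
by under eq_bigr do rewrite scalerA; rewrite -scaler_suml PQ scale0r.
Qed.
Lemma mxactMr P f r x : mxact P (fun y => f y * r) x = mxact P f x * r.
Proof. by rewrite /mxact mulr_suml; apply: eq_bigr => y _; rewrite bqa_scaleAl. Qed.
Lemma mxactMl P f r x : mxact P (fun y => r * f y) x = r * mxact P f x.
Proof. by rewrite /mxact mulr_sumr; apply: eq_bigr => y _; rewrite bqa_scaleAr. Qed.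
Lemma mxactD P f g x : mxact P (fun y => f y + g y) x = mxact P f x + mxact P g x.
Proof. by rewrite /mxact -big_split; apply: eq_bigr => y _; rewrite scalerDr. Qed.
Lemma mxactZ P (c : k) f x : mxact P (fun y => c *: f y) x = c *: mxact P f x.
Proof. by rewrite /mxact scaler_sumr; apply: eq_bigr => y _; rewrite !scalerA mulrC. Qed.
Lemma mxact_eq P f g x : (forall y, P x y != 0 -> f y = g y) -> mxact P f x = mxact P g x.
Proof.
move=> fg; apply: eq_bigr => y _.
by have [->|/fg ->//] := eqVneq (P x y) 0; rewrite !scale0r.
Qed.
Lemma mxact0 P f x : (forall y, P x y != 0 -> f y = 0) -> mxact P f x = 0.
Proof. by move=> f0; rewrite (mxact_eq (g := fun=> 0) f0) /mxact big1 // => y _; rewrite scaler0. Qed.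
Lemma mxact_rhoa hn p P f x : rhoa hn p (mxact P f x) = mxact P (fun y => rhoa hn p (f y)) x.
Proof. by rewrite rhoa_sum; apply: eq_bigr => y _; rewrite rhoaZ. Qed.
Lemma mxact_rhob hn p P f x : rhob hn p (mxact P f x) = mxact P (fun y => rhob hn p (f y)) x.
Proof. by rewrite rhob_sum; apply: eq_bigr => y _; rewrite rhobZ. Qed.
Lemma mxact_cba hn p P f x : cba hn p (mxact P f x) *: en k n p = mxact P (fun y => cba hn p (f y) *: en k n p) x.
Proof. by rewrite cba_sum scaler_suml; apply: eq_bigr => y _; rewrite cbaZ scalerA. Qed.
End MatOp.

Arguments rhob : simpl never.

Section Koszul.
Variables (k : fieldType) (n : nat).
Local Notation Lam := (bqa (@Lambda_rel k n)).
Local Notation en := (en k n).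
Local Notation an := (an k n).
Local Notation bn := (bn k n).
Variables (M : lmodType Lam) (D : nat) (hb : hbasis M D).
Local Notation vec := (hb_vec hb).
Local Notation vtx := (hb_vtx hb).
Local Notation co := (hb_co hb).
Local Notation A := (hbA hb).
Local Notation B := (hbB hb).

(* The Koszul words are the paths that descend from a vertex i to j and then
   climb from j to m, their consecutive arrows being exactly the defining
   relations.  The index (j, m, x) stands for [Lam (x) word (x) x], where x is a
   basis vector of M at the vertex i, and the degree is the length of the word. *)
Definition kidx := ('I_n * 'I_n * 'I_D)%type.
Definition kvalid (d j m : nat) (x : 'I_D) : bool :=
  [&& (j <= vtx x)%N, (j <= m)%N & (vtx x - j + (m - j) == d)%N].
(** An index that is not a word of length d contributes the zero ideal, so all degrees share one
    index type. *)
Definition kidem d (i : kidx) : Lam := if kvalid d i.1.1 i.1.2 i.2 then en i.1.2 else 0.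
Lemma kidemK d i : kidem d i * kidem d i = kidem d i.
Proof. by rewrite /kidem; case: ifP => _; rewrite ?en_idem ?mulr0. Qed.

Definition koszul d := fam (kidem d).

(* Coordinates with indices in nat, zero when out of range. *)
Definition kcoord d (f : koszul d) (j m : nat) (x : 'I_D) : Lam :=
  if insub j is Some j' then if insub m is Some m' then (f (j', m', x) : Lam) else 0 else 0.

Lemma kcoordE d (f : koszul d) (i : kidx) : f i = kcoord f i.1.1 i.1.2 i.2.
Proof. by case: i => -[j m] x; rewrite /kcoord /= !valK. Qed.
Lemma kcoord_en d (f : koszul d) j m x : kcoord f j m x * en m = kcoord f j m x.
Proof.
rewrite /kcoord; case: insubP => [j' _ jj|]; last by rewrite mul0r.
case: insubP => [m' _ <-|]; last by rewrite mul0r.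
rewrite -(fam_ep f) -mulrA /kidem /=; case: ifP => _; last by rewrite mul0r.
by rewrite en_idem.
Qed.
Lemma kcoord_invalid d (f : koszul d) j m x : ~~ kvalid d j m x -> kcoord f j m x = 0.
Proof.
rewrite /kcoord; case: insubP => [j' _ <-|//]; case: insubP => [m' _ <-|//].
by rewrite -(fam_ep f) /kidem /= => /negPf ->; rewrite mulr0.
Qed.
Lemma kcoordD d (f g : koszul d) j m x : kcoord (f + g) j m x = kcoord f j m x + kcoord g j m x.
Proof.
rewrite /kcoord; case: insubP => [j' _ _|_]; last by rewrite addr0.
by case: insubP => [m' _ _|_]; rewrite ?addr0 ?fam_add.
Qed.
Lemma kcoordZ d c (f : koszul d) j m x : kcoord (c *: f) j m x = c * kcoord f j m x.
Proof.
rewrite /kcoord; case: insubP => [j' _ _|_]; last by rewrite mulr0.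
by case: insubP => [m' _ _|_]; rewrite ?mulr0 ?fam_scale.
Qed.
Lemma kcoord0 d j m x : kcoord (0 : koszul d) j m x = 0.
Proof. by rewrite -(scale0r (0 : koszul d)) kcoordZ mul0r. Qed.
Lemma koszul_eq d (f g : koszul d) :
  (forall j m x, kvalid d j m x -> kcoord f j m x = kcoord g j m x) -> f = g.
Proof.
move=> fg; apply: famP => i; rewrite !kcoordE.
by case kv: (kvalid d i.1.1 i.1.2 i.2); [exact: fg | rewrite !kcoord_invalid ?kv].
Qed.

Definition mkkoszul d (F : nat -> nat -> 'I_D -> Lam) : koszul d :=
  mkfam (@kidemK d) (fun i => F i.1.1 i.1.2 i.2).
Lemma kcoord_mk d F j m x : kcoord (mkkoszul d F) j m x = if kvalid d j m x then F j m x * en m else 0.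
Proof.
rewrite /kcoord; case: insubP => [j' _ <-|jn].
  case: insubP => [m' _ <-|]; first by rewrite /= ffunE /kidem /=; case: ifP; rewrite ?mulr0.
  by rewrite -leqNgt => nm; rewrite en_out // mulr0 if_same.
case: ifP => // /and3P[jx _ _]; move: jn; rewrite -leqNgt => nj.
by have := ltn_ord (vtx x); lia.
Qed.

(* The first two terms multiply the last arrow of the word into Lam, the
   others apply its first arrow to the basis vector of M. *)
Definition kdiff_at d (f : koszul d.+1) j m x : Lam :=
  kcoord f j m.+1 x * an m + (if j == m then kcoord f j.-1 j.-1 x * bn j else 0) +
  (-1) ^+ d.+1 *: (mxact B (kcoord f j m) x + if j == vtx x :> nat then mxact A (kcoord f j.-1 m) x else 0).

Lemma kdiff_at_en d (f : koszul d.+1) j m x : kdiff_at f j m x * en m = kdiff_at f j m x.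
Proof.
rewrite /kdiff_at !mulrDl -mulrA an_r -bqa_scaleAl mulrDl -mxactMr; congr (_ + _ + _ *: (_ + _)).
- by case: eqP => [->|_]; rewrite ?mul0r // -mulrA bn_r.
- by apply: mxact_eq => y _; exact: kcoord_en.
- case: eqP => _; rewrite ?mul0r // -mxactMr; by apply: mxact_eq => y _; exact: kcoord_en.
Qed.

Definition kdiff d (f : koszul d.+1) : koszul d := mkkoszul d (kdiff_at f).
Lemma kcoord_diff d (f : koszul d.+1) j m x :
  kcoord (kdiff f) j m x = if kvalid d j m x then kdiff_at f j m x else 0.
Proof. by rewrite /kdiff kcoord_mk kdiff_at_en. Qed.

Lemma kdiff_linear d : linear (@kdiff d).
Proof.
move=> c f g; apply: koszul_eq => j m x kv; rewrite kcoordD kcoordZ !kcoord_diff kv /kdiff_at.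
have mxactL P j1 m1 : mxact P (kcoord (c *: f + g) j1 m1) x =
    c * mxact P (kcoord f j1 m1) x + mxact P (kcoord g j1 m1) x.
  by rewrite -mxactMl -mxactD; apply: mxact_eq => y _; rewrite kcoordD kcoordZ.
have lin (u v w u' v' w' : Lam) : (c * u + u') + (c * v + v') + (-1) ^+ d.+1 *: (c * w + w') =
    c * (u + v + (-1) ^+ d.+1 *: w) + (u' + v' + (-1) ^+ d.+1 *: w').
  by rewrite scalerDr bqa_scaleAr !mulrDr [in LHS](addrACA (c * u)) [LHS]addrACA.
rewrite -lin !mxactL !kcoordD !kcoordZ; congr (_ + _ + _ *: _).
- by rewrite mulrDl mulrA.
- by case: eqP => _; rewrite ?mulr0 ?addr0 // mulrDl mulrA.
- by case: eqP => _; rewrite ?addr0 // mulrDr [LHS]addrACA.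
Qed.
HB.instance Definition _ d :=
  GRing.isLinear.Build Lam (koszul d.+1) (koszul d) *:%R (@kdiff d) (@kdiff_linear d).

(** The part of the differential at the Lam end squares to zero by the relations of Lam, the part at
    the M end by those of [hbA] and [hbB]. The two commute up to sign, and the mixed terms [T1],
    [T2], [T3] cancel. *)
Lemma kdiff_at_diff d (f : koszul d.+2) j m x : kvalid d j m x -> kdiff_at (kdiff f) j m x = 0.
Proof.
move=> /and3P[jx jm /eqP dE].
pose T1 := mxact B (fun y => kcoord f j m.+1 y * an m) x.
pose T2 := if j == vtx x :> nat then mxact A (fun y => kcoord f j.-1 m.+1 y * an m) x else 0.
pose T3 := if j == m then mxact B (fun y => kcoord f j.-1 j.-1 y * bn j) x else 0.
have E1 : kcoord (kdiff f) j m.+1 x * an m = (-1) ^+ d.+2 *: (T1 + T2).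
  rewrite kcoord_diff (_ : kvalid _ _ _ _); last by rewrite /kvalid; lia.
  rewrite /kdiff_at (_ : j == m.+1 = false) ?addr0; last by lia.
  rewrite mulrDl -mulrA an_an mulr0 add0r -bqa_scaleAl mulrDl -mxactMr /T2.
  by case: eqP => _; rewrite ?mul0r -?mxactMr.
have E2 : (if j == m then kcoord (kdiff f) j.-1 j.-1 x * bn j else 0) = (-1) ^+ d.+2 *: T3.
  rewrite /T3; case: eqP => [jm'|_]; last by rewrite scaler0.
  case: j jx jm dE @T1 @T2 @T3 E1 jm' => [|j] jx jm dE _ _ _ _ jm'.
    by rewrite bn0 mulr0 mxact0 ?scaler0 // => y _; rewrite mulr0.
  rewrite kcoord_diff (_ : kvalid _ _ _ _); last by rewrite /kvalid; lia.
  (* This word descends strictly below its start, so it begins with alpha' and has no [hbA] term. *)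
  rewrite /kdiff_at /= eqxx (_ : j == vtx x :> nat = false) ?addr0; last by lia.
  by rewrite mulrDl -bqa_scaleAl -mxactMr mulrDl -!mulrA an_bn bn_bn !mulr0 !add0r.
have E3 : mxact B (kcoord (kdiff f) j m) x = T1 + T3.
  rewrite (mxact_eq (g := fun y => kcoord f j m.+1 y * an m +
     ((if j == m then kcoord f j.-1 j.-1 y * bn j else 0) + (-1) ^+ d.+2 *: mxact B (kcoord f j m) y))); last first.
    move=> y /hbB_vtx yx; rewrite kcoord_diff (_ : kvalid _ _ _ _); last by rewrite /kvalid; lia.
    by rewrite /kdiff_at (_ : j == vtx y :> nat = false) ?addr0 ?addrA //; lia.
  rewrite !mxactD mxactZ mxact_comp0 ?scaler0 ?addr0; last by move=> z; exact: hbBB.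
  by congr (_ + _); rewrite /T3; case: eqP => // _; rewrite mxact0.
have E4 : (if j == vtx x :> nat then mxact A (kcoord (kdiff f) j.-1 m) x else 0) = T2.
  rewrite /T2; case: eqP => // jx'.
  rewrite (mxact_eq (g := fun y => kcoord f j.-1 m.+1 y * an m +
     (-1) ^+ d.+2 *: (mxact B (kcoord f j.-1 m) y + mxact A (kcoord f j.-2 m) y))); last first.
    move=> y /hbA_vtx yx; rewrite kcoord_diff (_ : kvalid _ _ _ _); last by rewrite /kvalid; lia.
    rewrite /kdiff_at (_ : j.-1 == m = false) ?addr0; last by lia.
    by rewrite (_ : j.-1 == vtx y :> nat) //; lia.
  rewrite mxactD mxactZ mxactD !mxact_comp0 ?addr0 ?scaler0 ?addr0 // => z; [exact: hbAA | exact: hbAB].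
rewrite /kdiff_at E1 E2 E3 E4 -scalerDr exprS mulN1r scaleNr addrAC.
by rewrite (addrAC T1) addNr.
Qed.

Lemma kdiff_diff d (f : koszul d.+2) : kdiff (kdiff f) = 0.
Proof. by apply: koszul_eq => j m x kv; rewrite kcoord_diff kv kdiff_at_diff // kcoord0. Qed.

Definition kaug : {linear koszul 0 -> M} := famhom (ep := kidem 0) (fun i : kidx => vec i.2).

(** In degree 0 only the trivial word at the vertex of each basis vector survives. *)
Lemma kaugE (f : koszul 0) : kaug f = \sum_x kcoord f (vtx x) (vtx x) x *: vec x.
Proof.
rewrite /kaug /= /famhom (bigID (fun i : kidx => (i.1 == (vtx i.2, vtx i.2)))) /=.
rewrite [X in _ + X]big1 ?addr0 => [|i /eqP ni]; last first.
  rewrite kcoordE kcoord_invalid ?scale0r //; apply/negP => /and3P[ix im /eqP d0]; apply: ni.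
  by case: i ix im d0 => -[j m] x /= ix im d0; congr (_, _); apply: val_inj => /=; lia.
rewrite (reindex_onto (fun x => (vtx x, vtx x, x)) (fun i : kidx => i.2)) /=.
  by apply: eq_big => [x|x _]; rewrite ?eqxx // kcoordE.
by case=> -[j m] x /= /eqP[-> ->].
Qed.

(** A word of length one is an arrow, and moving it into Lam or letting it act on the basis vector
    gives the same element of M; the two contributions carry opposite signs. *)
Lemma kaug_diff (f : koszul 1) : kaug (kdiff f) = 0.
Proof.
rewrite kaugE.
under eq_bigr => x _ do rewrite kcoord_diff (_ : kvalid _ _ _ _) ?/kvalid ?leqnn ?subnn // /kdiff_at !eqxx expr1 scaleN1r
  scalerDl scaleNr 2!scalerDl.
rewrite big_split sumrN 2!big_split /=.
apply/eqP; rewrite subr_eq0; apply/eqP; rewrite [RHS]addrC.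
have tr (P : 'I_D -> 'I_D -> k) (g : 'I_D -> 'I_D -> Lam) (h : 'I_D -> Lam) r :
   (forall y, r y *: vec y = \sum_x kscale (P x y) (vec x)) ->
   (forall x y, P x y != 0 -> g x y = h y) ->
   \sum_x (h x * r x) *: vec x = \sum_x mxact P (g x) x *: vec x.
  move=> Pr gh; under eq_bigr do rewrite -scalerA Pr scaler_sumr.
  rewrite exchange_big; apply: eq_bigr => x _; rewrite scaler_suml; apply: eq_bigr => y _.
  rewrite kscale_comm -kscale_bqa; congr (_ *: _).
  by have [->|/gh ->//] := eqVneq (P x y) 0; rewrite !scale0r.
congr (_ + _).
  apply: (tr A (fun x => kcoord f (vtx x).-1 (vtx x)) (fun x => kcoord f (vtx x) (vtx x).+1 x) (fun x => an (vtx x))).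
    by move=> y; rewrite hb_an_vec eqxx.
  by move=> x y /hbA_vtx ->.
apply: (tr B (fun x => kcoord f (vtx x) (vtx x)) (fun x => kcoord f (vtx x).-1 (vtx x).-1 x) (fun x => bn (vtx x))).
  by move=> y; rewrite hb_bn_vec eqxx.
by move=> x y /hbB_vtx ->.
Qed.

Lemma kaug_surj m : exists f, kaug f = m.
Proof.
exists (mkkoszul 0 (fun j _ x => co m x *: en j)); rewrite kaugE [RHS](hb_span hb m).
apply: eq_bigr => x _; rewrite kcoord_mk (_ : kvalid _ _ _ _); last by rewrite /kvalid; lia.
by rewrite -bqa_scaleAl en_idem kscale_bqa hb_homog.
Qed.

Variable hn : (1 < n)%N.

(** The last arrow is stripped from the coefficient and appended to the word. A target word with
    [j < m] ends in alpha, hence division by a; a word with [j = m] of positive length ends in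
    alpha', hence division by b. *)
Definition khtpy_at d (f : koszul d) (j m : nat) (x : 'I_D) : Lam :=
  if (j < m)%N then rhoa hn m.-1 (kcoord f j m.-1 x) else rhob hn j.+1 (kcoord f j.+1 j.+1 x).
Lemma khtpy_at_en d (f : koszul d) j m x : (j <= m)%N -> khtpy_at f j m x * en m = khtpy_at f j m x.
Proof.
move=> jm; rewrite /khtpy_at; case: ltnP => jm'.
  by case: m jm jm' => // m _ _ /=; rewrite rhoa_en.
by rewrite (_ : m = j) ?rhob_en //; lia.
Qed.
Definition khtpy d (f : koszul d) : koszul d.+1 := mkkoszul d.+1 (khtpy_at f).
Lemma kcoord_htpy d (f : koszul d) j m x :
  kcoord (khtpy f) j m x = if kvalid d.+1 j m x then khtpy_at f j m x else 0.
Proof. by rewrite /khtpy kcoord_mk; case: ifP => // /and3P[_ jm _]; rewrite khtpy_at_en. Qed.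

(* [khtpy] is a contracting homotopy up to a term that a cycle does not see. *)
Lemma koszul_exact d (f : koszul d.+1) : kdiff f = 0 -> kdiff (khtpy f) = f.
Proof.
move=> df0; have bd0 j m x : kvalid d j m x -> kdiff_at f j m x = 0.
  by move=> kv; have := kcoord_diff f j m x; rewrite kv df0 kcoord0.
apply: koszul_eq => j m x kv; rewrite kcoord_diff kv; have /and3P[jx jm /eqP dE] := kv.
have nx := ltn_ord (vtx x).
have T1 : kcoord (khtpy f) j m.+1 x * an m = rhoa hn m (kcoord f j m x) * an m.
  by rewrite kcoord_htpy (_ : kvalid _ _ _ _) /khtpy_at ?ltnS ?jm //; rewrite /kvalid; lia.
have T4 : (if j == vtx x :> nat then mxact A (kcoord (khtpy f) j.-1 m) x else 0) =
    (if j == vtx x :> nat then mxact A (fun y => rhoa hn m.-1 (kcoord f j.-1 m.-1 y)) x else 0).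
  case: eqP => // jx'; apply: mxact_eq => y /hbA_vtx yx.
  rewrite kcoord_htpy (_ : kvalid _ _ _ _); last by rewrite /kvalid; lia.
  by rewrite /khtpy_at (_ : (j.-1 < m)%N) //; lia.
case: (ltnP j m) => jm'.
  have m0 : m = m.-1.+1 by lia.
  have T3 : mxact B (kcoord (khtpy f) j m) x = mxact B (fun y => rhoa hn m.-1 (kcoord f j m.-1 y)) x.
    apply: mxact_eq => y /hbB_vtx yx.
    by rewrite kcoord_htpy (_ : kvalid _ _ _ _) /khtpy_at ?jm' // /kvalid; lia.
  (* [kvalid] does not bound [m] by [n]; beyond the last vertex the idempotent is zero and both
     sides vanish. *)
  case: (ltnP m n) => mn; last by rewrite -kdiff_at_en -[RHS]kcoord_en en_out ?mulr0.
  (* The cycle condition at the word without its last alpha, divided by that alpha, identifies the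
     terms at the M end with the first summand of [rhoa_an]. *)
  have {}bd0 : kdiff_at f j m.-1 x = 0 by apply: bd0; rewrite /kvalid; lia.
  have := congr1 (rhoa hn m.-1) bd0; rewrite /kdiff_at -m0 rhoa0 !rhoaD rhoaZ.
  rewrite (_ : rhoa hn m.-1 (if _ then _ else _) = 0) ?addr0; last first.
    by case: eqP => [->|_]; rewrite ?rhoa0 ?rhoa_bn.
  rewrite rhoaD mxact_rhoa => bd0'.
  rewrite T1 T3 T4 (_ : j == m = false) ?addr0; last by lia.
  have := @rhoa_an _ _ hn m.-1 (kcoord f j m x); rewrite -m0 => /(_ mn (kcoord_en _ _ _ _)).
  have -> : (if j == vtx x :> nat then mxact A (fun y => rhoa hn m.-1 (kcoord f j.-1 m.-1 y)) x else 0) =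
     rhoa hn m.-1 (if j == vtx x :> nat then mxact A (kcoord f j.-1 m.-1) x else 0).
    by case: eqP => _; rewrite ?rhoa0 // mxact_rhoa.
  move: bd0' => /eqP; rewrite addr_eq0 => /eqP -> E; rewrite -[RHS]E.
  by rewrite addrC exprS mulN1r scaleNr.
have mj : m = j by lia.
rewrite mj in kv jm dE T1 T4 * => {m mj jm'}.
have jx' : (j < vtx x)%N by lia.
have T2 : kcoord (khtpy f) j.-1 j.-1 x * bn j = rhob hn j (kcoord f j j x) * bn j.
  case: j jx kv jm dE T1 T4 jx' => [|j] jx kv jm dE _ _ jx'; first by rewrite bn0 !mulr0.
  by rewrite kcoord_htpy (_ : kvalid _ _ _ _) /khtpy_at ?ltnn //= /kvalid; lia.
have T3 : mxact B (kcoord (khtpy f) j j) x = mxact B (fun y => rhob hn j.+1 (kcoord f j.+1 j.+1 y)) x.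
  apply: mxact_eq => y /hbB_vtx yx.
  by rewrite kcoord_htpy (_ : kvalid _ _ _ _) /khtpy_at ?ltnn // /kvalid; lia.
have jx0 : (j == vtx x :> nat) = false by lia.
have := rhob_bn hn (leq_ltn_trans jx' nx) (kcoord_en f j j x).
rewrite /kdiff_at T1 eqxx T2 T3 jx0 addr0 => fE.
(* The cycle condition at the word stopping one vertex higher, to be divided by the missing
   alpha'. *)
have kv1 : kvalid d j.+1 j.+1 x by rewrite /kvalid; lia.
have := congr1 (rhob hn j.+1) (bd0 _ _ _ kv1).
rewrite /kdiff_at /= eqxx rhob0 !rhobD rhobZ rhob_an add0r rhobD mxact_rhob.
rewrite (_ : rhob hn j.+1 (if _ then _ else _) = 0) ?addr0; last first.
  case: eqP => [jx1|_]; last by rewrite rhob0.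
  rewrite mxact_rhob.
  (* The extra term occurs only when [x] sits at [j.+1], so that [d] is 0. The ba part of the cycle
     condition at the trivial word of [y] writes it through [hbB] and [hbA], and a further [hbA]
     kills both. *)
  have bd1 y : A x y != 0 -> rhob hn j.+1 (kcoord f j j.+1 y) =
      mxact B (fun z => cba hn j (kcoord f j j z) *: en j) y +
      mxact A (fun z => cba hn j (kcoord f j.-1 j z) *: en j) y.
    move=> /hbA_vtx yx; have jn : (j.+1 < n)%N by lia.
    rewrite cba_an //; have yj : vtx y = j :> nat by lia.
    have kv2 : kvalid d j j y by rewrite /kvalid; lia.
    have := congr1 (fun r => cba hn j r *: en j) (bd0 _ _ _ kv2).
    rewrite /kdiff_at eqxx yj eqxx cba0 scale0r !cbaD cba_bn addr0 cbaZ cbaD !scalerDl -scalerA scalerDl.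
    have s1 : (-1) ^+ d.+1 = -1 :> k by rewrite (_ : d = 0%N) ?expr1 //; lia.
    rewrite !mxact_cba s1 scaleN1r.
    by move/eqP; rewrite subr_eq0 => /eqP.
  by rewrite (mxact_eq bd1) mxactD !mxact_comp0 ?addr0 // => z; [exact: hbAA | exact: hbAB].
move/eqP; rewrite addr_eq0 => /eqP bd2.
rewrite -[RHS]fE bd2.
by rewrite -[RHS]addrA [RHS]addrC exprS mulN1r scaleNr.
Qed.

Lemma co_act r y x : r * en (vtx y) = r -> let c := coef hn (vtx y) r in
  co (r *: vec y) x = c.1.1.1 * (x == y)%:R + A x y * c.1.1.2 + B x y * c.1.2 +
    (\sum_w B x w * A w y) * c.2.
Proof.
move=> re c; have [_ Ex] := coef_spec hn (vtx y) r; rewrite -[in LHS]re Ex /cvec -/c.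
rewrite !scalerDl !kscale_bqa !hb_coD !hb_coZ hb_homog hb_co_vec.
rewrite [c.1.1.2 * _]mulrC [c.1.2 * _]mulrC [c.2 * _]mulrC; congr (_ + _ + _ + _ * _).
rewrite -scalerA hb_co_bn big_mkcond; apply: eq_bigr => w _; case: eqP => // nw.
by have [->|/hbA_vtx//] := eqVneq (A w y) 0; rewrite mulr0.
Qed.

(* Here the homotopy needs a correction, on the coefficients of ba. *)
Lemma koszul_exact0 (f : koszul 0) : kaug f = 0 -> exists g, kdiff g = f.
Proof.
(* The correction acts twice: at the Lam end it cancels the part of [rhoa] along b, and through
   [hbB] it supplies the BA term of the equation [kaug f = 0]. *)
move=> f0; pose F j m x := khtpy_at f j m x +
  (if j == m then mxact A (fun y => cba hn j (kcoord f j j y) *: en j) x else 0).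
have F_en j m x : (j <= m)%N -> F j m x * en m = F j m x.
  move=> jm; rewrite /F mulrDl khtpy_at_en //; case: eqP => [<-|_]; last by rewrite mul0r.
  by rewrite -mxactMr; congr (_ + _); apply: mxact_eq => y _; rewrite -bqa_scaleAl en_idem.
exists (mkkoszul 1 F); apply: koszul_eq => j m x kv; rewrite kcoord_diff kv.
have [jx mx] : j = vtx x /\ m = vtx x by move: kv => /and3P[ix im /eqP]; lia.
subst j m; set i : nat := vtx x in kv *.
have at_g j m y : kvalid 1 j m y -> kcoord (mkkoszul 1 F) j m y = F j m y.
  by move=> kv1; rewrite kcoord_mk kv1 F_en //; case/and3P: kv1.
have ni : (i < n)%N := ltn_ord (vtx x).
have T1 : kcoord (mkkoszul 1 F) i i.+1 x * an i = rhoa hn i (kcoord f i i x) * an i.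
  rewrite at_g; last by rewrite /kvalid /i; lia.
  by rewrite /F /khtpy_at ltnSn (_ : i == i.+1 = false) ?addr0 //; lia.
have T2 : kcoord (mkkoszul 1 F) i.-1 i.-1 x * bn i = rhob hn i (kcoord f i i x) * bn i +
    mxact A (fun y => cba hn i.-1 (kcoord f i.-1 i.-1 y) *: bn i) x.
  case Ei : i => [|i'].
    by rewrite bn0 !mulr0 mxact0 ?addr0 // => y _; rewrite scaler0.
  rewrite at_g; last by rewrite /kvalid -/i Ei /=; lia.
  rewrite /F /khtpy_at /= ltnn eqxx mulrDl -mxactMr; congr (_ + _); apply: mxact_eq => y _.
  by rewrite -bqa_scaleAl bn_l.
have T3 : mxact B (kcoord (mkkoszul 1 F) i i) x = mxact B (fun y => rhob hn i.+1 (kcoord f i.+1 i.+1 y)) x +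
    mxact B (mxact A (fun z => cba hn i (kcoord f i i z) *: en i)) x.
  rewrite -mxactD; apply: mxact_eq => y /hbB_vtx yx.
  rewrite at_g; last by rewrite /kvalid /i; lia.
  by rewrite /F /khtpy_at ltnn eqxx.
have T4 : mxact A (kcoord (mkkoszul 1 F) i.-1 i) x = mxact A (fun y => (coef hn (vtx y) (kcoord f (vtx y) (vtx y) y)).1.1.2 *: en i) x +
    mxact A (fun y => cba hn i.-1 (kcoord f i.-1 i.-1 y) *: bn i) x.
  rewrite -mxactD; apply: mxact_eq => y /hbA_vtx yx; rewrite -/i in yx.
  rewrite at_g; last by rewrite /kvalid -/i; lia.
  rewrite /F /khtpy_at (_ : (i.-1 < i)%N); last by lia.
  rewrite (_ : i.-1 == i = false) ?addr0; last by lia.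
  by rewrite /rhoa yx.
(* The coordinate at [x] of the augmentation gives the coefficient of e in [f], the one piece that
   division by arrows cannot recover. *)
have := congr1 (fun r => co r x *: en i) f0; rewrite kaugE hb_co0 scale0r hb_co_sum.
under eq_bigr => y _ do rewrite co_act ?kcoord_en //.
rewrite !big_split /= !scalerDl (bigD1 x) //= eqxx mulr1 big1 => [|y]; last first.
  by rewrite eq_sym => /negPf ->; rewrite mulr0.
rewrite addr0 -/i => E.
rewrite [RHS](rho_decomp hn (kcoord_en _ _ _ _)) /kdiff_at eqxx T1 T2 T3 T4 -/i.
move: E; rewrite !scaler_suml.
have -> : \sum_y (A x y * (coef hn (vtx y) (kcoord f (vtx y) (vtx y) y)).1.1.2) *: en i =
   mxact A (fun y => (coef hn (vtx y) (kcoord f (vtx y) (vtx y) y)).1.1.2 *: en i) x.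
  by apply: eq_bigr => y _; rewrite scalerA.
have -> : \sum_y (B x y * (coef hn (vtx y) (kcoord f (vtx y) (vtx y) y)).1.2) *: en i =
   mxact B (fun y => rhob hn i.+1 (kcoord f i.+1 i.+1 y)) x.
  by rewrite [RHS](mxact_eq (g := fun y => (coef hn (vtx y) (kcoord f (vtx y) (vtx y) y)).1.2 *: en i));
    [apply: eq_bigr => y _; rewrite scalerA | move=> y /hbB_vtx yx; rewrite -/i in yx; rewrite yx].
have -> : \sum_y ((\sum_w B x w * A w y) * (coef hn (vtx y) (kcoord f (vtx y) (vtx y) y)).2) *: en i =
   mxact B (mxact A (fun z => cba hn i (kcoord f i i z) *: en i)) x.
  rewrite /mxact; under [RHS]eq_bigr do rewrite scaler_sumr.
  rewrite exchange_big; apply: eq_bigr => z _; rewrite mulr_suml scaler_suml.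
  apply: eq_bigr => w _; rewrite !scalerA.
  have [->|/hbB_vtx yx] := eqVneq (B x w) 0; first by rewrite !mul0r.
  have [->|/hbA_vtx zy] := eqVneq (A w z) 0; first by rewrite !mulr0 !mul0r.
  by rewrite /cba (_ : i = vtx z) // /i; lia.
set X0 := _ *: en i; set Xa := mxact A _ x; set Xb := mxact B _ x; set Xc := mxact B _ x.
set Y := mxact A _ x => E.
have {E} -> : X0 = - (Xa + Xb + Xc) by apply/eqP; rewrite -addr_eq0 !addrA E.
rewrite expr1 scaleN1r; set U := rhoa _ _ _ * _; set V := rhob _ _ _ * _.
have -> : Xb + Xc + (Xa + Y) = Xa + Xb + Xc + Y by rewrite addrA (addrC _ Xa) !addrA.
set S := _ + Xc; by rewrite (addrA U) opprD [LHS]addrACA subrr addr0 addrC addrA.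
Qed.

End Koszul.

(** * The Euler form *)

Lemma linear_factor (A : pzRingType) (P M N : lmodType A) (g : {linear P -> M}) (h : {linear P -> N}) :
  (forall m, exists p, g p = m) -> (forall p, g p = 0 -> h p = 0) ->
  exists f : {linear M -> N}, forall p, f (g p) = h p.
Proof.
move=> gs gh; have [s Hs] := choice gs.
have fE p : h (s (g p)) = h p.
  by apply/eqP; rewrite -subr_eq0 -linearB; apply/eqP/gh; rewrite linearB Hs subrr.
have lin : linear (fun m => h (s m)).
  by move=> c m m'; rewrite -linearP -[RHS]fE linearP !Hs.
pose fl := GRing.isLinear.Build A M N *:%R (fun m => h (s m)) lin.
pose f : {linear M -> N} := HB.pack (fun m => h (s m)) fl.
by exists f.
Qed.

Lemma exact_rank (F : fieldType) p q s (X : 'M[F]_(p, q)) (Y : 'M[F]_(q, s)) :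
  (forall u : 'rV_q, u *m Y = 0 <-> exists w, w *m X = u) -> q = (\rank X + \rank Y)%N.
Proof.
move=> XY; have -> : \rank X = \rank (kermx Y); last by rewrite mxrank_ker subnK // rank_leq_row.
apply/eqmx_rank/andP; split; apply/rV_subP => u.
  by case/submxP => w ->; apply/sub_kermxP/XY; exists w.
by move/sub_kermxP/XY => [w <-]; apply: submxMl.
Qed.

(** For a cochain complex with dimensions [c] and differentials of rank [r]: the extra 1 in degree 0
    is a one-dimensional cohomology, and exactness above makes the alternating sum telescope. *)
Lemma alternating_rank (c r : nat -> nat) L : c 0%N = (r 0%N).+1 ->
  (forall d, c d.+1 = r d + r d.+1)%N ->
  \sum_(d < L.+1) (-1) ^+ d * (c d)%:Z = 1 + (-1) ^+ L * (r L)%:Z.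
Proof.
move=> c0 cS; elim: L => [|L IH]; first by rewrite big_ord1 c0 !expr0 !mul1r; lia.
rewrite big_ord_recr /= IH cS PoszD exprS mulN1r mulrDr !mulNr; lia.
Qed.

Section Hom.
Variables (k : fieldType) (n : nat).
Local Notation R := (@Lambda_rel k n).
Local Notation Lam := (bqa R).
Variables (M N : fdmod R) (D E : nat) (hb : hbasis M D) (hc : hbasis N E).
Local Notation vtx := (hb_vtx hb).

(** A map from the summand [Lam * en m] is an element of [en m] N, so these pairs index a basis of
    the maps from the degree d term to N. *)
Definition khomS d : {set kidx n D * 'I_E} :=
  [set t : kidx n D * 'I_E | kvalid hb d t.1.1.1 t.1.1.2 t.1.2 && (hb_vtx hc t.2 == t.1.1.2)].
Local Notation c d := #|khomS d|.

Definition khomV d (u : 'rV[k]_(c d)) (i : kidx n D) : N :=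
  \sum_(p < c d | (enum_val p).1 == i) kscale (u 0 p) (hb_vec hc (enum_val p).2).
Definition khom d (u : 'rV[k]_(c d)) : {linear koszul hb d -> N} :=
  famhom (ep := kidem hb d) (khomV u).
Definition kco d (f : koszul hb d -> N) : 'rV[k]_(c d) :=
  \row_p hb_co hc (f (famgen (@kidemK _ _ _ _ hb d) (enum_val p).1)) (enum_val p).2.

Lemma khomV_ep d (u : 'rV[k]_(c d)) i : kidem hb d i *: khomV u i = khomV u i.
Proof.
rewrite scaler_sumr; apply: eq_bigr => p /eqP pi; rewrite kscale_comm; congr kscale.
have := enum_valP p; rewrite inE pi => /andP[kv /eqP vm].
by rewrite /kidem kv -vm hb_homog.
Qed.

Lemma kco_khom d (u : 'rV[k]_(c d)) : kco (khom u) = u.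
Proof.
apply/rowP => p; rewrite mxE /khom /= famhom_gen khomV_ep /khomV big_mkcond hb_co_sum (bigD1 p) //= eqxx.
rewrite hb_coZ hb_co_vec eqxx mulr1 big1 ?addr0 // => q qp; case: eqP => [q1|_]; last exact: hb_co0.
rewrite hb_coZ hb_co_vec; case: eqP => [q2|_]; last by rewrite mulr0.
by case/eqP: qp; apply: enum_val_inj; apply: injective_projections.
Qed.

Lemma khom_kco d (f : {linear koszul hb d -> N}) : khom (kco f) =1 f.
Proof.
move=> x; rewrite (fam_lin (@kidemK _ _ _ _ hb d) f) /khom /= /famhom; apply: eq_bigr => i _; congr (_ *: _).
set y := f _; have ye : kidem hb d i *: y = y.
  rewrite /y -linearZ; congr (f _); apply: famP => j; rewrite fam_scale !mkfamE.
  by case: eqP => [->|_]; rewrite ?mul0r ?mulr0 // mulrA !kidemK.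
rewrite [RHS](hb_span hc) /khomV.
have yS q : (i, q) \notin khomS d -> hb_co hc y q = 0.
  rewrite inE negb_and => /orP[kv|qv].
    by rewrite -ye /kidem (negPf kv) scale0r hb_co0.
  by rewrite -ye /kidem; case: ifP => _; rewrite ?scale0r ?hb_co0 // hb_co_en val_eqE (negPf qv).
rewrite [RHS](bigID (fun q => (i, q) \in khomS d)) /= [X in _ + X]big1 ?addr0 => [|q /yS ->]; last exact: kscale0.
transitivity (\sum_(t in khomS d | t.1 == i) kscale (hb_co hc (f (famgen (@kidemK _ _ _ _ hb d) t.1)) t.2) (hb_vec hc t.2)).
  rewrite big_mkcond [RHS]big_mkcondr /= [RHS]big_enum_val /=.
  by apply: eq_bigr => p _; rewrite mxE.
rewrite (reindex_onto (fun q => (i, q)) (fun t => t.2)) /=.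
  by apply: eq_bigl => q; rewrite !eqxx !andbT.
by case=> i' q /= /andP[_ /eqP ->].
Qed.

Lemma kco_linear d (f g : koszul hb d -> N) a :
  kco (fun x => kscale a (f x) + g x) = a *: kco f + kco g.
Proof. by apply/rowP => p; rewrite !mxE hb_coD hb_coZ. Qed.
Lemma kco_eq d (f g : koszul hb d -> N) : f =1 g -> kco f = kco g.
Proof. by move=> fg; apply/rowP => p; rewrite !mxE fg. Qed.
Lemma khom_lin d (u w : 'rV[k]_(c d)) a x : khom (a *: u + w) x = kscale a (khom u x) + khom w x.
Proof.
rewrite /khom /= /famhom kscale_sumr -big_split; apply: eq_bigr => i _ /=.
rewrite -kscale_comm -scalerDr; congr (_ *: _).
rewrite /khomV kscale_sumr -big_split; apply: eq_bigr => p _ /=.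
by rewrite !mxE kscaleDl kscaleA.
Qed.

Definition kdelta d (u : 'rV[k]_(c d)) : 'rV[k]_(c d.+1) := kco (fun x => khom u (kdiff x)).
Lemma kdelta_linear d : linear (@kdelta d).
Proof. by move=> a u w; rewrite /kdelta -kco_linear; apply: kco_eq => x; rewrite khom_lin. Qed.
HB.instance Definition _ d := GRing.isLinear.Build k 'rV[k]_(c d) 'rV[k]_(c d.+1) *:%R
  (@kdelta d) (@kdelta_linear d).
Definition kdmx d := lin1_mx (@kdelta d).
Lemma kdmxE d u : u *m kdmx d = kco (fun x => khom u (kdiff x)).
Proof. exact: mul_rV_lin1. Qed.

Lemma kdmx0P d u : u *m kdmx d = 0 <-> forall x, khom u (kdiff x) = 0.
Proof.
rewrite kdmxE; split=> [u0 x|u0]; last by apply/rowP => p; rewrite !mxE u0 hb_co0.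
have := khom_kco (khom u \o @kdiff _ _ _ _ hb d : {linear koszul hb d.+1 -> N}) x => /= <-.
rewrite [kco _]u0 /= /famhom big1 // => i _; rewrite /khomV big1 ?scaler0 // => p _.
by rewrite mxE kscale0.
Qed.

(** A Koszul word descends and climbs at most [n - 1] steps each. *)
Lemma khomS_out d : (2 * n <= d)%N -> c d = 0%N.
Proof.
move=> nd; apply: eq_card0 => -[[[j m] x] q]; rewrite inE /=; apply/negP.
by case/andP => /and3P[_ _ /eqP]; have := ltn_ord (vtx x); have := ltn_ord m; lia.
Qed.

(* The coefficient a_j of M in the basis [Delta(j)] of the Grothendieck group,
   obtained by solving dim M_v = a_v + a_(v+1). *)
Definition Delta_coef D' (M' : lmodType Lam) (h : hbasis M' D') (j : nat) : int :=
  \sum_x (if (j <= hb_vtx h x)%N then (-1) ^+ (hb_vtx h x - j) else 0).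

(* The classes of the standard modules are orthonormal for the Euler form. *)
Lemma Euler_form L : (2 * n <= L)%N ->
  \sum_(d < L) (-1) ^+ d * (c d)%:Z = \sum_(j < n) Delta_coef hb j * Delta_coef hc j.
Proof.
move=> nL.
have -> : \sum_(d < L) (-1) ^+ d * (c d)%:Z =
    \sum_(d < L) \sum_(t : kidx n D * 'I_E) (if t \in khomS d then (-1) ^+ d else 0).
  apply: eq_bigr => d _; rewrite -big_mkcond sumr_const -mulr_natr; congr (_ * _).
  by rewrite natz.
rewrite exchange_big /=.
(* Each index lies in the single degree given by the length of its word, and the sign splits into a
   factor for the descent and one for the climb. For fixed lowest vertex [j] the sum therefore
   becomes a product. *)
transitivity (\sum_(t : kidx n D * 'I_E)
   (if (t.1.1.1 <= vtx t.1.2)%N && (t.1.1.1 <= hb_vtx hc t.2)%N && (t.1.1.2 == hb_vtx hc t.2)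
    then (-1) ^+ (vtx t.1.2 - t.1.1.1) * (-1) ^+ (hb_vtx hc t.2 - t.1.1.1) else 0 : int)).
  apply: eq_bigr => -[[[j m] x] q] _ /=.
  have dL : (vtx x - j + (m - j) < L)%N by have := ltn_ord (vtx x); have := ltn_ord m; lia.
  rewrite (bigD1 (Ordinal dL)) //= big1 ?addr0 => [|d]; last first.
    rewrite -val_eqE /= => nd; rewrite inE /= /kvalid; case: ifP => // /andP[/and3P[_ _ /eqP dE]].
    by rewrite dE eqxx in nd.
  rewrite inE /= /kvalid eqxx andbT -exprD [m == _]eq_sym.
  by case: eqP => [->|_]; rewrite ?andbF ?andbT.
rewrite -(pair_bigA _ (fun (a : kidx n D) (q : 'I_E) => if (a.1.1 <= vtx a.2)%N && (a.1.1 <= hb_vtx hc q)%N && (a.1.2 == hb_vtx hc q)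
    then (-1) ^+ (vtx a.2 - a.1.1) * (-1) ^+ (hb_vtx hc q - a.1.1) else 0 : int)) /=.
rewrite -(pair_bigA _ (fun (a : 'I_n * 'I_n) (x : 'I_D) => \sum_q (if (a.1 <= vtx x)%N && (a.1 <= hb_vtx hc q)%N && (a.2 == hb_vtx hc q)
    then (-1) ^+ (vtx x - a.1) * (-1) ^+ (hb_vtx hc q - a.1) else 0 : int))) /=.
rewrite -(pair_bigA _ (fun (a b : 'I_n) => \sum_x \sum_q (if (a <= vtx x)%N && (a <= hb_vtx hc q)%N && (b == hb_vtx hc q)
    then (-1) ^+ (vtx x - a) * (-1) ^+ (hb_vtx hc q - a) else 0 : int))) /=.
apply: eq_bigr => j _; rewrite exchange_big /= mulr_suml; apply: eq_bigr => x _.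
rewrite exchange_big /= mulr_sumr; apply: eq_bigr => q _.
rewrite (bigD1 (hb_vtx hc q)) //= eqxx andbT big1 ?addr0 => [|m /negPf ->]; last by rewrite andbF.
by case: leqP => _ /=; case: leqP => _; rewrite ?mulr0 ?mul0r.
Qed.

Variable hn : (1 < n)%N.

Definition koszul_fd d : fdmod R := fd_fam (@kidemK _ _ _ _ hb d).
Lemma koszul_fd_exact0 (x : koszul_fd 0) : kaug hb x = 0 <-> exists y : koszul_fd 1, kdiff y = x.
Proof. by split=> [/(koszul_exact0 hn)//|[y <-]]; apply: kaug_diff. Qed.
Lemma koszul_fd_exact i (x : koszul_fd i.+1) : kdiff x = 0 <-> exists y : koszul_fd i.+2, kdiff y = x.
Proof. by split=> [/(koszul_exact hn) <-|[y <-]]; [exists (khtpy hn x) | apply: kdiff_diff]. Qed.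
Definition koszul_resolution : proj_resolution M :=
  @ProjResolution _ _ R M koszul_fd (fun d => @kdiff _ _ _ _ hb d) (kaug hb)
    (fun d => @fam_projective _ _ _ _ (@kidemK _ _ _ _ hb d)) (kaug_surj hb) koszul_fd_exact0 koszul_fd_exact.

Lemma Ext_vanishesP d : Ext_vanishes d.+1 M N ->
  forall f : {linear koszul hb d.+1 -> N}, (forall x, f (kdiff x) = 0) ->
  exists g : {linear koszul hb d -> N}, f =1 g \o @kdiff _ _ _ _ hb d.
Proof. by move=> ext f f0; exact: (ext koszul_resolution f f0). Qed.

(** At the Koszul resolution, vanishing of Ext says that the Hom complex is exact in degree
    [d.+1]. *)
Lemma khom_rank d : Ext_vanishes d.+1 M N -> c d.+1 = (\rank (kdmx d) + \rank (kdmx d.+1))%N.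
Proof.
move=> ext; apply: exact_rank => u; rewrite kdmx0P; split=> [u0|[w <-] x].
  have [g ug] := Ext_vanishesP ext u0; exists (kco g).
  by rewrite kdmxE -[RHS]kco_khom; apply: kco_eq => x; rewrite khom_kco ug.
have := khom_kco (khom w \o @kdiff _ _ _ _ hb d : {linear koszul hb d.+1 -> N}) (kdiff x).
by rewrite kdmxE => -> /=; rewrite kdiff_diff linear0.
Qed.

Lemma khom_factor (u : 'rV[k]_(c 0)) : u *m kdmx 0 = 0 ->
  exists f : {linear M -> N}, forall x, f (kaug hb x) = khom u x.
Proof.
move=> /kdmx0P u0; apply: linear_factor; first exact: kaug_surj.
by move=> p /(koszul_exact0 hn)[g <-].
Qed.

End Hom.

Section Euler.
Variables (k : fieldType) (n : nat) (hn : (1 < n)%N).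
Local Notation R := (@Lambda_rel k n).

(** The Hom complex of M with itself has cohomology k in degree 0 and none above, so its Euler
    characteristic is 1; [Euler_form] evaluates the same number. *)
Lemma exceptional_Delta_coef (M : fdmod R) D (hb : hbasis M D) :
  exceptional M -> \sum_(j < n) Delta_coef hb j * Delta_coef hb j = 1.
Proof.
case=> _ endk ext.
have r0 : #|khomS hb hb 0| = (\rank (kdmx hb hb 0)).+1.
  have := mxrank_ker (kdmx hb hb 0); suff -> : \rank (kermx (kdmx hb hb 0)) = 1%N.
    by have := rank_leq_row (kdmx hb hb 0); lia.
  (* These coordinates stand for the identity of M. If they vanish, M is zero and the scalars 0 and
     1 both represent the zero map, against uniqueness in [End_is_k]. *)
  have a0 : kco hb (kaug hb) != 0.
    apply/negP => /eqP a0; have [c [_ cu]] := endk \0.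
    have M0 m : m = 0 :> M.
      have [p <-] := kaug_surj hb m; rewrite -(khom_kco hb (kaug hb) p) a0.
      by rewrite /= /famhom big1 // => i _; rewrite /khomV big1 ?scaler0 // => q _; rewrite mxE kscale0.
    have e0 : c = 0 by apply: cu => m; rewrite (M0 m) /= kscaler0.
    have e1 : c = 1 by apply: cu => m; rewrite (M0 m) /= kscaler0.
    by have := oner_neq0 k; rewrite -e1 e0 eqxx.
  transitivity (\rank (kco hb (kaug hb))); last by rewrite rank_rV a0.
  (* Cocycles of degree 0 are endomorphisms of M, all scalar, hence multiples of the
     augmentation. *)
  apply/eqmx_rank/andP; split; last first.
    by apply/sub_kermxP/kdmx0P => x; rewrite khom_kco; exact: kaug_diff.
  apply/rV_subP => u /sub_kermxP/(khom_factor hn)[f fE].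
  have [c [fc _]] := endk f; apply/sub_rVP; exists c.
  by apply/rowP => p; rewrite -{1}(kco_khom u) !mxE -fE fc hb_coZ.
have rS d : #|khomS hb hb d.+1| = (\rank (kdmx hb hb d) + \rank (kdmx hb hb d.+1))%N.
  by apply: khom_rank => //; apply: ext.
have alt := @alternating_rank (fun d => #|khomS hb hb d|) (fun d => \rank (kdmx hb hb d)).
rewrite -(Euler_form hb hb (leqnSn (2 * n)%N)) alt //.
have -> : \rank (kdmx hb hb (2 * n)) = 0%N.
  have := rank_leq_row (kdmx hb hb (2 * n)); have := khomS_out hb hb (leqnn (2 * n)%N).
  by move=> c0 /leq_trans/(_ (eq_leq c0)); rewrite leqn0 => /eqP.
by rewrite mulr0 addr0.
Qed.
End Euler.

(** * Maps and changes of basis *)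

Section Maps.
Variables (k : fieldType) (n : nat).
Local Notation R := (@Lambda_rel k n).
Local Notation Lam := (bqa R).
Local Notation en := (en k n).
Local Notation an := (an k n).
Local Notation bn := (bn k n).

(** By [Lam_linear] compatibility with idempotents and arrows is enough; every homomorphism between
    given modules below is built this way. *)
Lemma hb_extend (M N : lmodType Lam) D (hb : hbasis M D) (w : 'I_D -> N) :
  (forall q, en (hb_vtx hb q) *: w q = w q) ->
  (forall q, an (hb_vtx hb q) *: w q = \sum_p kscale (hbA hb p q) (w p)) ->
  (forall q, bn (hb_vtx hb q) *: w q = \sum_p kscale (hbB hb p q) (w p)) ->
  exists f : {linear M -> N}, forall q, f (hb_vec hb q) = w q.
Proof.
move=> we wa wb; pose f m := \sum_q kscale (hb_co hb m q) (w q).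
have fD : {morph f : x y / x + y}.
  by move=> x y; rewrite /f -big_split; apply: eq_bigr => q _; rewrite hb_coD kscaleDl.
have fZ c m : f (kscale c m) = kscale c (f m).
  by rewrite /f kscale_sumr; apply: eq_bigr => q _; rewrite hb_coZ kscaleA.
have f0 : f 0 = 0 by rewrite -[in LHS](kscale0 0) fZ kscale0.
have fS (I : finType) (F : I -> M) : f (\sum_i F i) = \sum_i f (F i).
  exact: (big_morph f fD f0).
have fv q : f (hb_vec hb q) = w q.
  rewrite /f (bigD1 q) //= hb_co_vec eqxx kscale1 big1 ?addr0 // => p /negPf pq.
  by rewrite hb_co_vec pq kscale0.
have fact (r : Lam) : (forall q, f (r *: hb_vec hb q) = r *: w q) -> forall m, f (r *: m) = r *: f m.
  have fE m : f m = \sum_q kscale (hb_co hb m q) (w q) by [].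
  move=> fr m; rewrite (hb_act hb) fS [in RHS]fE scaler_sumr; apply: eq_bigr => q _.
  by rewrite fZ fr kscale_comm.
have lin : linear f.
  apply: Lam_linear => // v; apply: fact => q.
  - rewrite hb_en_vec -(we q) scalerA en_mul eq_sym.
    by case: eqP => [->|_]; rewrite ?we ?scale0r ?fv.
  - rewrite hb_an_vec; case: eqP => [<-|/eqP nv]; first by rewrite wa fS; apply: eq_bigr => p _; rewrite fZ fv.
    by rewrite f0 -(an_r k n v) -(we q) -scalerA (scalerA (en v)) en_neq 1?eq_sym // scale0r scaler0.
  - rewrite hb_bn_vec; case: eqP => [<-|/eqP nv]; first by rewrite wb fS; apply: eq_bigr => p _; rewrite fZ fv.
    by rewrite f0 -(bn_r k n v) -(we q) -scalerA (scalerA (en v)) en_neq 1?eq_sym // scale0r scaler0.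
pose fl := GRing.isLinear.Build Lam M N *:%R f lin.
by pose g : {linear M -> N} := HB.pack f fl; exists g.
Qed.

Lemma linear_hb (M N : lmodType Lam) D (hb : hbasis M D) (f : {linear M -> N}) m :
  f m = \sum_q kscale (hb_co hb m q) (f (hb_vec hb q)).
Proof.
by rewrite {1}(hb_span hb m) linear_sum; apply: eq_bigr => q _; rewrite kscale_linear.
Qed.

Lemma hb_miso (M N : fdmod R) D (hb : hbasis M D) (hc : hbasis N D) :
  hb_vtx hb =1 hb_vtx hc -> hbA hb =2 hbA hc -> hbB hb =2 hbB hc -> miso M N.
Proof.
move=> vv AA BB.
have [|||f fE] := @hb_extend M N D hb (hb_vec hc).
- by move=> q; rewrite vv hb_homog.
- by move=> q; rewrite vv hb_an_vec eqxx; apply: eq_bigr => p _; rewrite AA.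
- by move=> q; rewrite vv hb_bn_vec eqxx; apply: eq_bigr => p _; rewrite BB.
have [|||g gE] := @hb_extend N M D hc (hb_vec hb).
- by move=> q; rewrite -vv hb_homog.
- by move=> q; rewrite -vv hb_an_vec eqxx; apply: eq_bigr => p _; rewrite AA.
- by move=> q; rewrite -vv hb_bn_vec eqxx; apply: eq_bigr => p _; rewrite BB.
exists f; exists g => m.
- rewrite (linear_hb hb f) linear_sum [RHS](hb_span hb m); apply: eq_bigr => q _.
  by rewrite kscale_linear fE gE.
- rewrite (linear_hb hc g) linear_sum [RHS](hb_span hc m); apply: eq_bigr => q _.
  by rewrite kscale_linear gE fE.
Qed.

(** Reordering by [t] matches the vertex pattern of a standard module; rescaling by [s] normalises
    its structure constant. *)
Lemma hb_change (M : lmodType Lam) D D' (hb : hbasis M D) (t : 'I_D' -> 'I_D) (s : 'I_D' -> k) :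
  bijective t -> (forall p, s p != 0) ->
  exists hc : hbasis M D', (forall p, hb_vtx hc p = hb_vtx hb (t p)) /\
    (forall p q, hbA hc p q = (s p)^-1 * hbA hb (t p) (t q) * s q) /\
    (forall p q, hbB hc p q = (s p)^-1 * hbB hb (t p) (t q) * s q).
Proof.
move=> tb s0; pose vec p := kscale (s p) (hb_vec hb (t p)).
pose co m p := (s p)^-1 * hb_co hb m (t p).
have homog p : en (hb_vtx hb (t p)) *: vec p = vec p by rewrite kscale_comm hb_homog.
have span m : m = \sum_p kscale (co m p) (vec p).
  rewrite {1}(hb_span hb m) (reindex _ (onW_bij _ tb)); apply: eq_bigr => p _ /=.
  by rewrite /vec kscaleA mulrAC mulVf // mul1r.
have free (c : 'I_D' -> k) : \sum_p kscale (c p) (vec p) = 0 -> forall p, c p = 0.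
  have [t' tt' t't] := tb.
  move=> c0 p.
  have c1 : \sum_x kscale (c (t' x) * s (t' x)) (hb_vec hb x) = 0.
    rewrite (reindex _ (onW_bij _ tb)) -[RHS]c0; apply: eq_bigr => q _ /=.
    by rewrite tt' /vec kscaleA.
  have /eqP := hb_free (h := hb) c1 (t p).
  by rewrite tt' mulf_eq0 (negPf (s0 p)) orbF => /eqP.
exists (HBasis homog span free); split=> //; split=> p q; rewrite /hbA /hbB /= /co /vec.
  by rewrite kscale_comm hb_coZ mulrA mulrAC.
by rewrite kscale_comm hb_coZ mulrA mulrAC.
Qed.

Section RepBasis.
Variables (V : qrep k (Lambda_quiver n)) (VR : satisfies V R).
Local Notation M := (rep_fdmod VR).

(** By the grading at most one arrow contributes to each entry, so these sums merely avoid naming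
    it. *)
Lemma rep_hbasis : exists hb : hbasis M (rep_dim V),
  [/\ forall x, hb_vtx hb x = @rep_vtx _ _ V x,
      forall x y, hbA hb x y = \sum_(i : 'I_n.-1) @rep_mx _ _ V (inl i) x y &
      forall x y, hbB hb x y = \sum_(i : 'I_n.-1) @rep_mx _ _ V (inr i) x y].
Proof.
pose vec x : M := delta_mx x 0 : 'cV[k]_(rep_dim V).
pose co (m : M) x : k := (m : 'cV_(rep_dim V)) x 0.
have mulE (X : 'M[k]_(rep_dim V)) x y : (X *m (vec y : 'cV_(rep_dim V))) x 0 = X x y.
  rewrite mxE (bigD1 y) //= mxE !eqxx mulr1 big1 ?addr0 // => z /negPf zy.
  by rewrite mxE zy mulr0.
have homog x : en (@rep_vtx _ _ V x : 'I_n) *: vec x = vec x.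
  rewrite rep_en; apply/matrixP => i j; by rewrite ord1 mulE !mxE !eqxx !andbT.
have span0 (m : M) : m = \sum_x kscale (co m x) (vec x).
  rewrite [LHS](matrix_sum_delta (m : 'cV[k]_(rep_dim V))); apply: eq_bigr => i _.
  by rewrite big_ord1 rep_kscale.
have free (c : 'I_(rep_dim V) -> k) : \sum_p kscale (c p) (vec p) = 0 -> forall p, c p = 0.
  move=> c0 p; have <- : co (\sum_p kscale (c p) (vec p)) p = c p; last by rewrite c0 /co mxE.
  have -> : \sum_p kscale (c p) (vec p) = \col_p c p :> 'cV_(rep_dim V); last by rewrite /co mxE.
  rewrite [RHS]matrix_sum_delta; apply: eq_bigr => i _.
  by rewrite big_ord1 rep_kscale mxE.
exists (HBasis homog span0 free); split=> // x y; rewrite /hbA /hbB /= /co; set v := rep_vtx y.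
  case: (ltnP v n.-1) => vn.
    have /= -> := @rep_an _ _ _ VR (Ordinal vn) (vec y); rewrite mulE (bigD1 (Ordinal vn)) //= big1 ?addr0 // => i.
    apply: contraNeq => /rep_graded[/= yv _]; apply/eqP/val_inj => /=.
    by rewrite -[LHS]/(val (lo i)) -yv.
  rewrite an_out ?scale0r ?mxE; last by lia.
  rewrite big1 // => i _; apply/eqP; apply: contraTT vn => /rep_graded[/= yv _].
  by rewrite -ltnNge /v yv /=; exact: ltn_ord.
case Ev : (v : nat) => [|u].
  rewrite bn0 scale0r mxE big1 // => i _; apply/eqP/negPn/negP => /rep_graded[/= yv _].
  by move: Ev; rewrite /v yv.
have un : (u < n.-1)%N by have := ltn_ord v; lia.
have /= -> := @rep_bn _ _ _ VR (Ordinal un) (vec y); rewrite mulE (bigD1 (Ordinal un)) //= big1 ?addr0 // => i.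
apply: contraNeq => /rep_graded[/= yv _]; apply/eqP/val_inj => /=.
by move: Ev; rewrite /v yv => -[].
Qed.
End RepBasis.
End Maps.

(** * Classification of the exceptional modules *)

Lemma sum_sqr_eq1 (I : finType) (a : I -> int) : \sum_i a i * a i = 1 ->
  exists2 i0, a i0 * a i0 = 1 & forall i, i != i0 -> a i = 0.
Proof.
move=> a1; have [i0 ai0] : exists i0, a i0 != 0.
  apply: contra_eqP a1 => /forallNP a0; rewrite big1 // => i _.
  by have /negP := a0 i; rewrite negbK => /eqP ->; rewrite mulr0.
have sq0 i : 0 <= a i * a i by rewrite -expr2 sqr_ge0.
have sq1 : 1 <= a i0 * a i0 by rewrite -gtz0_ge1 lt_def sq0 mulf_neq0.
move: a1; rewrite (bigD1 i0) //= => a1.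
have S0 : \sum_(i | i != i0) a i * a i = 0.
  by apply/eqP; rewrite eq_le sumr_ge0 ?andbT //; move: sq1 a1; set S := \sum_(i | _) _; lia.
exists i0; first by rewrite -a1 S0 addr0.
move=> i ii0; have := psumr_eq0P (fun i _ => sq0 i) S0 ii0.
by move/eqP; rewrite mulf_eq0 orbb => /eqP.
Qed.

Section Std.
Variables (k : fieldType) (n : nat).
Local Notation R := (@Lambda_rel k n).
Local Notation Lam := (bqa R).
Local Notation an := (an k n).

(** The isomorphism type is recorded by structure matrices, so that abstract modules and given
    representations are compared alike. When [i] is 0 there is one basis vector, and this agrees
    with [is_nabla]. *)
Definition is_Delta (M : lmodType Lam) (i : 'I_n) : Prop :=
  exists hb : hbasis M (std_dim i), [/\ forall p, hb_vtx hb p = std_vtx p,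
    forall p q, hbA hb p q = 0 &
    forall p q, hbB hb p q = ((p == 1 :> nat) && (q == 0 :> nat))%:R].
Definition is_nabla (M : lmodType Lam) (i : 'I_n) : Prop :=
  exists hb : hbasis M (std_dim i), [/\ forall p, hb_vtx hb p = std_vtx p,
    forall p q, hbA hb p q = ((p == 0 :> nat) && (q == 1 :> nat))%:R &
    forall p q, hbB hb p q = 0].

Lemma is_Delta_miso (M N : fdmod R) i : is_Delta M i -> is_Delta N i -> miso M N.
Proof.
move=> [hb [v1 A1 B1]] [hc [v2 A2 B2]].
by apply: (hb_miso (hb := hb) (hc := hc)) => [p|p q|p q]; rewrite ?v1 ?v2 ?A1 ?A2 ?B1 ?B2.
Qed.
Lemma is_nabla_miso (M N : fdmod R) i : is_nabla M i -> is_nabla N i -> miso M N.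
Proof.
move=> [hb [v1 A1 B1]] [hc [v2 A2 B2]].
by apply: (hb_miso (hb := hb) (hc := hc)) => [p|p q|p q]; rewrite ?v1 ?v2 ?A1 ?A2 ?B1 ?B2.
Qed.

Lemma std_ord_lt (i : 'I_n) (p : 'I_(std_dim i)) : (p <= i)%N /\ (p < 2)%N.
Proof. by case: p => p /=; rewrite /std_dim; case: eqP; lia. Qed.

Lemma is_nabla0 (M : lmodType Lam) (i : 'I_n) : i = 0 :> nat -> is_nabla M i -> is_Delta M i.
Proof.
move=> i0 [hb [v1 A1 B1]]; exists hb; split=> // p q.
  by rewrite A1; have [] := std_ord_lt q; rewrite i0; case: (q : nat) => //; rewrite andbF.
by rewrite B1; have [] := std_ord_lt p; rewrite i0; case: (p : nat).
Qed.
Lemma is_Delta0 (M : lmodType Lam) (i : 'I_n) : i = 0 :> nat -> is_Delta M i -> is_nabla M i.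
Proof.
move=> i0 [hb [v1 A1 B1]]; exists hb; split=> // p q.
  by rewrite A1; have [] := std_ord_lt q; rewrite i0; case: (q : nat) => //; rewrite andbF.
by rewrite B1; have [] := std_ord_lt p; rewrite i0; case: (p : nat).
Qed.

Lemma sum_hi (i : 'I_n) (b : bool) : (b -> (0 < i)%N) ->
  \sum_(j : 'I_n.-1) ((hi j == i) && b)%:R = b%:R :> k.
Proof.
case: b => [/(_ isT) i0|_]; last by rewrite big1 // => j _; rewrite andbF.
have jn : (i.-1 < n.-1)%N by have := ltn_ord i; lia.
rewrite (bigD1 (Ordinal jn)) //= andbT -val_eqE /= prednK // eqxx big1 ?addr0 // => j.
by rewrite -!val_eqE /= andbT => /eqP ji; case: eqP => // ij; case: ji; rewrite -ij.
Qed.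

Lemma Delta_is_Delta (i : 'I_n) : is_Delta (Delta k i) i.
Proof.
have [hb [v A B]] := rep_hbasis (@Delta_satisfies k n i); exists hb; split=> // p q.
  by rewrite A big1 // => j _; rewrite mxE.
rewrite B; under eq_bigr do rewrite mxE; apply: sum_hi => /andP[/eqP p1 _].
by have [] := std_ord_lt p; rewrite p1.
Qed.
Lemma nabla_is_nabla (i : 'I_n) : is_nabla (nabla k i) i.
Proof.
have [hb [v A B]] := rep_hbasis (@nabla_satisfies k n i); exists hb; split=> // p q.
  rewrite A; under eq_bigr do rewrite mxE; apply: sum_hi => /andP[_ /eqP q1].
  by have [] := std_ord_lt q; rewrite q1.
by rewrite B big1 // => j _; rewrite mxE.
Qed.
Lemma L_is_Delta (n0 : (0 < n)%N) : is_Delta (L k (Ordinal n0)) (Ordinal n0).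
Proof.
have [hb [v A B]] := rep_hbasis (@L_satisfies k n (Ordinal n0)); exists hb; split=> [p|p q|p q].
- by rewrite v; apply: val_inj => /=; rewrite sub0n.
- by rewrite A big1 // => j _; rewrite mxE.
- by rewrite B big1 => [|j _]; rewrite ?mxE // ord1.
Qed.

Section Class.
Variables (M : lmodType Lam) (D : nat) (hb : hbasis M D).
Local Notation vtx := (hb_vtx hb).

(** Two consecutive alternating sums have opposite signs at every vertex above [v], so only the
    vectors at [v] remain. *)
Lemma Delta_coef_count v : (#|[set x | vtx x == v :> nat]|)%:Z = Delta_coef hb v + Delta_coef hb v.+1.
Proof.
have -> : (#|[set x | vtx x == v :> nat]|)%:Z = \sum_(x in [set x | vtx x == v :> nat]) (1 : int).
  by rewrite sumr_const natz.
rewrite /Delta_coef big_mkcond -big_split /=; apply: eq_bigr => x _; rewrite inE.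
case: (ltngtP (vtx x) v) => [//|xv|->]; last by rewrite subnn expr0 addr0.
by rewrite (_ : (vtx x - v = (vtx x - v.+1).+1)%N) ?exprS ?mulN1r ?addNr //; lia.
Qed.
Lemma Delta_coef_out v : (n <= v)%N -> Delta_coef hb v = 0.
Proof.
by move=> nv; rewrite /Delta_coef big1 // => x _; rewrite leqNgt (leq_trans (ltn_ord _) nv).
Qed.

Lemma std_vtx_inj (i : 'I_n) : injective (@std_vtx n i).
Proof.
move=> p q /(congr1 val) /= pq; apply: val_inj => /=.
by have [] := std_ord_lt p; have [] := std_ord_lt q; lia.
Qed.

(** A single nonzero coefficient, equal to 1, means the dimension vector of a standard module: one
    basis vector at each vertex [std_vtx p] and none elsewhere. *)
Lemma std_hbasis : \sum_(j < n) Delta_coef hb j * Delta_coef hb j = 1 ->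
  exists (i : 'I_n) (hc : hbasis M (std_dim i)), forall p, hb_vtx hc p = std_vtx p.
Proof.
move=> /sum_sqr_eq1[i ai a0]; exists i.
have a0' (v : nat) : v != i -> Delta_coef hb v = 0.
  case: (ltnP v n) => [vn vi|/Delta_coef_out//]; apply: (a0 (Ordinal vn)).
  by apply: contra vi => /eqP <-.
have {ai} ai : Delta_coef hb i = 1.
  (* The next coefficient is zero, so this one is a dimension and cannot be -1. *)
  have := Delta_coef_count i; rewrite (a0' i.+1) ?addr0; last by lia.
  move: ai; set m := #|_|; move=> ai mE; have m0 : 0 <= Delta_coef hb i by rewrite -mE.
  by move: ai; rewrite -expr2 => /eqP; rewrite sqrf_eq1 => /orP[/eqP//|/eqP aN]; move: m0; rewrite aN oppr_ge0 ler10.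
have cnt (p : 'I_(std_dim i)) : exists x, vtx x = std_vtx p /\ forall y, vtx y = std_vtx p -> y = x.
  have /eqP : #|[set x | vtx x == (i - p)%N :> nat]| = 1%N.
    apply/eqP; rewrite -eqz_nat Delta_coef_count; apply/eqP; have [pi p2] := std_ord_lt p.
    case: (p : nat) p2 pi => [|[]]// _ pi.
      by rewrite subn0 ai a0' ?addr0 //; lia.
    by rewrite subn1 prednK // ai a0' ?add0r //; lia.
  case/cards1P=> x /setP xE; exists x; split.
    by have := xE x; rewrite !inE eqxx => /eqP vx; apply: val_inj.
  by move=> y /(congr1 val) /= vy; have := xE y; rewrite !inE vy eqxx => /esym/eqP.
have [t tE] := choice cnt.
have tv x : exists p, t p = x.
  have : (0 < #|[set y | vtx y == vtx x :> nat]|)%N by apply/card_gt0P; exists x; rewrite inE.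
  rewrite -ltz_nat Delta_coef_count => cx.
  have : vtx x = i \/ (vtx x).+1 = i :> nat.
    move: cx; have [xi|xi] := eqVneq (vtx x : nat) i; first by left; apply: val_inj.
    by rewrite (a0' _ xi); have [xi'|xi'] := eqVneq (vtx x).+1 i; [right | rewrite (a0' _ xi')].
  case=> [xi|xi].
    have p0 : (0 < std_dim i)%N by rewrite /std_dim; case: ifP.
    exists (Ordinal p0); have [_ tx] := tE (Ordinal p0); symmetry; apply: tx.
    by rewrite xi; apply: val_inj => /=; rewrite subn0.
  have p0 : (1 < std_dim i)%N by rewrite /std_dim -xi.
  exists (Ordinal p0); have [_ tx] := tE (Ordinal p0); symmetry; apply: tx.
  by apply: val_inj => /=; rewrite -xi subn1.
have [t' t'K] := choice tv.
have tb : bijective t.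
  exists t' => // p; apply: (@std_vtx_inj i).
  have [<- _] := tE p; have [<- _] := tE (t' (t p)); by rewrite t'K.
have [hc [vc _]] := hb_change hb tb (fun _ => oner_neq0 k).
by exists hc => p; rewrite vc; case: (tE p).
Qed.
End Class.

(* If both alpha and alpha' act by 0, the idempotent at i is an endomorphism
   that is not scalar. *)
Lemma exceptional_class (hn : (1 < n)%N) (M : fdmod R) : exceptional M ->
  exists i, is_Delta M i \/ is_nabla M i.
Proof.
move=> exM; have [D [hb]] := hbasis_exists M.
have [i [hc vc]] := std_hbasis (exceptional_Delta_coef hn hb exM); exists i.
have Av p q : hbA hc p q != 0 -> (p = 0 :> nat) /\ (q = 1 :> nat).
  move=> /hbA_vtx; rewrite !vc /=.
  by have [] := std_ord_lt p; have [] := std_ord_lt q; lia.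
have Bv p q : hbB hc p q != 0 -> (p = 1 :> nat) /\ (q = 0 :> nat).
  move=> /hbB_vtx; rewrite !vc /=.
  by have [] := std_ord_lt p; have [] := std_ord_lt q; lia.
case: (eqVneq (i : nat) 0%N) => [i0|i0].
  left; exists hc; split=> // p q.
    apply/eqP; apply: contraT => /Av[_ q1].
    by have [] := std_ord_lt q; rewrite i0 q1.
  transitivity (0 : k).
    apply/eqP; apply: contraT => /Bv[p1 _].
    by have [] := std_ord_lt p; rewrite i0 p1.
  by have [] := std_ord_lt p; rewrite i0; case: (p : nat).
have d2 : std_dim i = 2%N by rewrite /std_dim (negPf i0).
have o0P : (0 < std_dim i)%N by rewrite d2. 
have o1P : (1 < std_dim i)%N by rewrite d2.
pose o0 := Ordinal o0P; pose o1 := Ordinal o1P.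
have oE (p : 'I_(std_dim i)) : p = o0 \/ p = o1.
  have [_] := std_ord_lt p.
  by case E : (p : nat) => [|[]]// _; [left | right]; apply: val_inj.
set al := hbA hc o0 o1; set be := hbB hc o1 o0.
have AE p q : hbA hc p q = al * ((p == 0 :> nat) && (q == 1 :> nat))%:R.
  case: (oE p) => ->; case: (oE q) => ->; rewrite /= ?mulr1 ?mulr0 //;
  by apply/eqP; apply: contraT => /Av[].
have BE p q : hbB hc p q = be * ((p == 1 :> nat) && (q == 0 :> nat))%:R.
  case: (oE p) => ->; case: (oE q) => ->; rewrite /= ?mulr1 ?mulr0 //;
  by apply/eqP; apply: contraT => /Bv[].
(* The relation alpha alpha' = 0 on the vector [o0]: at most one of the two arrows acts. *)
have ab0 : al * be = 0.
  have := hbAB hc o0 o0; rewrite (bigD1 o1) //= big1 ?addr0 // => q.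
  by case: (oE q) => -> //; rewrite AE mulr0 mul0r.
have id_bij (T : Type) : bijective (@id T) by exists id.
(* Rescaling the second vector alone makes the surviving entry 1: by [be] in the Delta case, by
   [al^-1] in the nabla case. *)
pose s (c : k) (p : 'I_(std_dim i)) : k := if p == 0 :> nat then 1 else c.
have s0 c : c != 0 -> forall p, s c p != 0 by move=> c0 p; rewrite /s; case: ifP; rewrite ?oner_neq0.
have [be0|be0] := eqVneq be 0; last first.
  left; have al0 : al = 0 by apply/eqP; move/eqP: ab0; rewrite mulf_eq0 (negPf be0) orbF.
  have [hd [vd [Ad Bd]]] := hb_change hc (id_bij _) (s0 _ be0); exists hd; split=> [p|p q|p q].
  - by rewrite vd vc.
  - by rewrite Ad AE al0 mul0r mulr0 mul0r.
  - rewrite Bd BE /s; case: (oE p) => ->; case: (oE q) => ->; rewrite /= ?mulr0 ?mul0r //.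
    by rewrite !mulr1 mulVf.
have [al0|al0] := eqVneq al 0; last first.
  right; have al0' : al^-1 != 0 by rewrite invr_eq0.
  have [hd [vd [Ad Bd]]] := hb_change hc (id_bij _) (s0 _ al0'); exists hd; split=> [p|p q|p q].
  - by rewrite vd vc.
  - rewrite Ad AE /s; case: (oE p) => ->; case: (oE q) => ->; rewrite /= ?mulr0 ?mul0r //.
    by rewrite invr1 mul1r mulr1 mulfV.
  - by rewrite Bd BE be0 mul0r mulr0 mul0r.
have A0 p q : hbA hc p q = 0 by rewrite AE al0 mul0r.
have B0 p q : hbB hc p q = 0 by rewrite BE be0 mul0r.
pose w (p : 'I_(std_dim i)) : M := if p == 0 :> nat then hb_vec hc p else 0.
have [|||f fE] := @hb_extend _ _ M M _ hc w.
- by move=> q; rewrite /w; case: ifP => _; rewrite ?hb_homog ?scaler0.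
- move=> q; rewrite big1 => [|p _]; last by rewrite A0 kscale0.
  rewrite /w; case: ifP => _; rewrite ?scaler0 // hb_an_vec eqxx big1 // => p _.
  by rewrite A0 kscale0.
- move=> q; rewrite big1 => [|p _]; last by rewrite B0 kscale0.
  rewrite /w; case: ifP => _; rewrite ?scaler0 // hb_bn_vec eqxx big1 // => p _.
  by rewrite B0 kscale0.
case: exM => _ endk _; have [c [fc _]] := endk f.
have c1 : c = 1.
  have := congr1 (fun m => hb_co hc m o0) (fc (hb_vec hc o0)).
  by rewrite /= fE /w /= hb_coZ hb_co_vec eqxx mulr1.
have := congr1 (fun m => hb_co hc m o1) (fc (hb_vec hc o1)).
rewrite /= fE /w /= hb_coZ hb_co_vec hb_co0 eqxx mulr1 c1 => /esym/eqP.
by rewrite oner_eq0.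
Qed.
End Std.

(** * Extensions between standard modules *)

Section NonVanishing.
Variables (k : fieldType) (n : nat) (hn : (1 < n)%N).
Local Notation R := (@Lambda_rel k n).
Local Notation Lam := (bqa R).
Local Notation en := (en k n).
Local Notation an := (an k n).
Local Notation bn := (bn k n).

Lemma hb_vec_neq0 (M : lmodType Lam) D (hb : hbasis M D) x : hb_vec hb x != 0.
Proof.
apply/eqP => v0; have := hb_co_vec hb x x; rewrite v0 hb_co0 eqxx => /eqP.
by rewrite eq_sym oner_eq0.
Qed.

Lemma an_act0 (N : lmodType Lam) E (hc : hbasis N E) v (y : N) :
  (forall p q, hbA hc p q = 0) -> an v *: y = 0.
Proof.
move=> A0; apply: (hb_inj (hb := hc)) => p; rewrite hb_co_an hb_co0 big1 // => q _.
by rewrite A0 mul0r.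
Qed.
Lemma bn_act0 (N : lmodType Lam) E (hc : hbasis N E) v (y : N) :
  (forall p q, hbB hc p q = 0) -> bn v *: y = 0.
Proof.
move=> B0; apply: (hb_inj (hb := hc)) => p; rewrite hb_co_bn hb_co0 big1 // => q _.
by rewrite B0 mul0r.
Qed.

Section Cocycle.
Variables (M N : fdmod R) (D : nat) (hb : hbasis M D) (d : nat).
Variables (i0 : kidx n D) (w : N).
Local Notation gen := (famgen (@kidemK _ _ _ _ hb d.+1)).

Lemma kcoord_gen i j m x :
  kcoord (gen i) j m x = if [&& j == i.1.1, m == i.1.2 & x == i.2] then kidem hb d.+1 i else 0.
Proof.
case: i => -[j' m'] x' /=; rewrite /kcoord.
case: insubP => [j1 _ <-|]; last by case: eqP => // ->; rewrite ltn_ord.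
case: insubP => [m1 _ <-|]; last by case: (m =P m') => [->|]; rewrite ?ltn_ord ?andbF.
rewrite mkfamE !val_eqE !xpair_eqE -andbA.
by case: and3P => [[/eqP-> /eqP-> /eqP->]|_]; rewrite ?mul0r // kidemK.
Qed.

(** The class sends the generator [i0] to [w] and the others to 0. It is no coboundary, because the
    differential of that generator has coordinates annihilating N. *)
Lemma Ext_cocycle : kvalid hb d.+1 i0.1.1 i0.1.2 i0.2 -> en i0.1.2 *: w = w -> w != 0 ->
  (forall f : koszul hb d.+2, kdiff_at f i0.1.1 i0.1.2 i0.2 *: w = 0) ->
  (forall j m x (y : N), kvalid hb d j m x -> kdiff_at (gen i0) j m x *: y = 0) ->
  ~ Ext_vanishes d.+1 M N.
Proof.
move=> kv we w0 cocy cobd ext.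
pose v (i : kidx n D) : N := if i == i0 then w else 0.
pose f : {linear koszul hb d.+1 -> N} := famhom (ep := kidem hb d.+1) v.
have fE (x : koszul hb d.+1) : f x = (x i0 : Lam) *: w.
  by rewrite /f /= /famhom (bigD1 i0) //= /v eqxx big1 ?addr0 // => i /negPf ->; rewrite scaler0.
have [|g gE] := Ext_vanishesP hn ext (f := f).
  by move=> x; rewrite fE kcoordE kcoord_diff kv cocy.
have := gE (gen i0); rewrite fE mkfamE eqxx kidemK /kidem kv we /= => wE.
case/eqP: w0; rewrite wE (fam_lin (@kidemK _ _ _ _ hb d) g) big1 // => i _.
by rewrite kcoordE kcoord_diff; case: ifP => [kvi|_]; rewrite ?scale0r // cobd.
Qed.
End Cocycle.

(* The class is carried by the word of the path from i up to j. *)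
Lemma Ext_Delta (M N : fdmod R) (i j : 'I_n) : is_Delta M i -> is_Delta N j -> (i < j)%N ->
  ~ Ext_vanishes (j - i) M N.
Proof.
move=> [hb [vM AM BM]] [hc [vN AN BN]] ij.
have p0 : (0 < std_dim i)%N by rewrite /std_dim; case: ifP.
have q0 : (0 < std_dim j)%N by rewrite /std_dim; case: ifP.
have -> : (j - i = (j - i).-1.+1)%N by lia.
have v0 : hb_vtx hb (Ordinal p0) = i by rewrite vM; apply: val_inj => /=; rewrite subn0.
have w0 : hb_vtx hc (Ordinal q0) = j by rewrite vN; apply: val_inj => /=; rewrite subn0.
apply: (@Ext_cocycle _ _ _ hb _ (i, j, Ordinal p0) (hb_vec hc (Ordinal q0))) => /=.
- by rewrite /kvalid v0; lia.
- by rewrite -{1}w0 hb_homog.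
- exact: hb_vec_neq0.
- move=> f; rewrite /kdiff_at (_ : (i == j :> nat) = false) ?addr0; last by lia.
  rewrite scalerDl -scalerA (an_act0 _ _ AN) scaler0 add0r !mxact0 ?if_same ?addr0 ?scaler0 ?scale0r //.
    by move=> y; rewrite AM eqxx.
  by move=> y; rewrite BM eqxx.
- move=> j' m' x y /and3P[jx jm /eqP dE].
  rewrite /kdiff_at !scalerDl -scalerA (an_act0 _ _ AN) scaler0 add0r.
  rewrite (_ : (if _ == _ then _ else _) = 0); last first.
    case: eqP => // jm'; rewrite kcoord_gen /=; case: and3P; rewrite ?mul0r // => -[/eqP E1 /eqP E2 _].
    by rewrite E1 in E2; move: ij; rewrite E2 ltnn.
  rewrite scale0r add0r [X in _ + X](_ : _ = 0); last first.
    by case: ifP => // _; rewrite mxact0 // => z; rewrite AM eqxx.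
  rewrite addr0 mxact0 ?scaler0 ?scale0r // => z; rewrite BM.
  (* The vector reached by alpha' sits one vertex below [i], whereas the word never goes below
     [i]. *)
  case: andP => [[/eqP x1 /eqP z0]|]; last by rewrite eqxx.
  rewrite kcoord_gen /= => _; case: eqP => // ji; move: jx; rewrite ji vM /= x1.
  by have [] := std_ord_lt x; lia.
Qed.

(* The class is carried by the word of the path from j down to i. *)
Lemma Ext_nabla (M N : fdmod R) (i j : 'I_n) : is_nabla M j -> is_nabla N i -> (i < j)%N ->
  ~ Ext_vanishes (j - i) M N.
Proof.
move=> [hb [vM AM BM]] [hc [vN AN BN]] ij.
have p0 : (0 < std_dim j)%N by rewrite /std_dim; case: ifP.
have q0 : (0 < std_dim i)%N by rewrite /std_dim; case: ifP.
have -> : (j - i = (j - i).-1.+1)%N by lia.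
have v0 : hb_vtx hb (Ordinal p0) = j by rewrite vM; apply: val_inj => /=; rewrite subn0.
have w0 : hb_vtx hc (Ordinal q0) = i by rewrite vN; apply: val_inj => /=; rewrite subn0.
have hb0 : forall d (f : koszul hb d) j m x, mxact (hbB hb) (kcoord f j m) x = 0.
  by move=> d f j1 m x; rewrite mxact0 // => y; rewrite BM eqxx.
apply: (@Ext_cocycle _ _ _ hb _ (i, i, Ordinal p0) (hb_vec hc (Ordinal q0))) => /=.
- by rewrite /kvalid v0; lia.
- by rewrite -{1}w0 hb_homog.
- exact: hb_vec_neq0.
- move=> f; rewrite /kdiff_at eqxx hb0 v0 (_ : (i == j :> nat) = false) ?addr0 ?scaler0 ?addr0; last by lia.
  rewrite scalerDl -!scalerA (bn_act0 _ _ BN) scaler0 addr0.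
  (* The chosen vector of N lies in its socle, where alpha acts by zero. *)
  rewrite hb_an_vec w0 eqxx big1 ?scaler0 // => p _.
  by rewrite AN /= andbF kscale0.
- move=> j' m' x y /and3P[jx jm /eqP dE].
  rewrite /kdiff_at hb0 add0r !scalerDl -scalerA kcoord_gen /=.
  rewrite (_ : [&& _, _ & _] = false); last by apply/negP => /and3P[/eqP E1 /eqP E2 _]; lia.
  rewrite scale0r add0r (_ : (if _ == _ then _ else _) *: y = 0); last first.
    by case: eqP => _; rewrite ?scale0r // -scalerA (bn_act0 _ _ BN) scaler0.
  rewrite add0r; case: eqP => [jx'|_]; last by rewrite scaler0 scale0r.
  rewrite mxact0 ?scaler0 ?scale0r // => z /hbA_vtx xz; rewrite kcoord_gen /=.
  by case: and3P => // -[/eqP E1 /eqP E2 _]; lia.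
Qed.

(** Modules of the same type are isomorphic; Delta to nabla factors through the simple at [i], nabla
    to Delta through the simple at the preceding vertex. Hence no class occurs twice in an
    exceptional sequence. *)
Lemma Hom_class (M N : fdmod R) (i : 'I_n) :
  is_Delta M i \/ is_nabla M i -> is_Delta N i \/ is_nabla N i -> ~ Ext_vanishes 0 M N.
Proof.
have hom_neq0 (M' N' : fdmod R) (D E : nat) (hb : hbasis M' D) (hc : hbasis N' E) (f : {linear M' -> N'}) p q :
    f (hb_vec hb p) = hb_vec hc q -> ~ Ext_vanishes 0 M' N'.
  by move=> fp /(_ f (hb_vec hb p)); rewrite fp; apply/eqP/hb_vec_neq0.
have p0 : (0 < std_dim i)%N by rewrite /std_dim; case: ifP.
have same (M' N' : lmodType Lam) (hb : hbasis M' (std_dim i)) (hc : hbasis N' (std_dim i)) :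
    hb_vtx hb =1 hb_vtx hc -> hbA hb =2 hbA hc -> hbB hb =2 hbB hc ->
    exists f : {linear M' -> N'}, forall p, f (hb_vec hb p) = hb_vec hc p.
  move=> vv AA BB; apply: hb_extend => q; rewrite vv.
  - exact: hb_homog.
  - by rewrite hb_an_vec eqxx; apply: eq_bigr => p _; rewrite AA.
  - by rewrite hb_bn_vec eqxx; apply: eq_bigr => p _; rewrite BB.
have DD : is_Delta M i -> is_Delta N i -> ~ Ext_vanishes 0 M N.
  move=> [hb [vM AM BM]] [hc [vN AN BN]].
  have [p|p q|p q|f fE] := same _ _ hb hc; rewrite ?vM ?vN ?AM ?AN ?BM ?BN //.
  exact: hom_neq0 (fE (Ordinal p0)).
have NN : is_nabla M i -> is_nabla N i -> ~ Ext_vanishes 0 M N.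
  move=> [hb [vM AM BM]] [hc [vN AN BN]].
  have [p|p q|p q|f fE] := same _ _ hb hc; rewrite ?vM ?vN ?AM ?AN ?BM ?BN //.
  exact: hom_neq0 (fE (Ordinal p0)).
case: (eqVneq (i : nat) 0%N) => [i0|i0].
  by move=> [DM|/(is_nabla0 i0) DM] [DN|/(is_nabla0 i0) DN]; exact: DD.
have p1 : (1 < std_dim i)%N by rewrite /std_dim (negPf i0).
move=> [M1|M1] [N1|N1]; [exact: DD| | |exact: NN].
- case: M1 N1 => [hb [vM AM BM]] [hc [vN AN BN]].
  pose w (p : 'I_(std_dim i)) : N := if p == 0 :> nat then hb_vec hc p else 0.
  have [|||f fE] := @hb_extend _ _ M N _ hb w.
  + by move=> q; rewrite /w vM -vN; case: ifP => _; rewrite ?hb_homog ?scaler0.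
  + move=> q; rewrite big1 => [|p _]; last by rewrite AM kscale0.
    rewrite /w vM -vN; case: ifP => [/eqP q0|_]; rewrite ?scaler0 // hb_an_vec eqxx big1 // => p _.
    by rewrite AN q0 andbF kscale0.
  + move=> q; rewrite (bn_act0 _ _ BN) big1 // => p _; rewrite BM /w.
    by case: eqP => [->|_]; rewrite ?kscaler0 ?kscale0.
  by have := fE (Ordinal p0); rewrite /w /=; exact: hom_neq0.
- case: M1 N1 => [hb [vM AM BM]] [hc [vN AN BN]].
  pose w (p : 'I_(std_dim i)) : N := if p == 1 :> nat then hb_vec hc p else 0.
  have [|||f fE] := @hb_extend _ _ M N _ hb w.
  + by move=> q; rewrite /w vM -vN; case: ifP => _; rewrite ?hb_homog ?scaler0.
  + move=> q; rewrite (an_act0 _ _ AN) big1 // => p _; rewrite AM /w.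
    by case: eqP => [->|_]; rewrite ?kscaler0 ?kscale0.
  + move=> q; rewrite big1 => [|p _]; last by rewrite BM kscale0.
    rewrite /w vM -vN; case: ifP => [/eqP q0|_]; rewrite ?scaler0 // hb_bn_vec eqxx big1 // => p _.
    by rewrite BN q0 andbF kscale0.
  by have := fE (Ordinal p1); rewrite /w /=; exact: hom_neq0.
Qed.
End NonVanishing.

(** * The Grothendieck group *)

Section Rank.
Variables (k : fieldType) (n : nat).
Local Notation R := (@Lambda_rel k n).
Local Notation Lam := (bqa R).
Local Notation en := (en k n).

Definition vset (M : lmodType Lam) D (hb : hbasis M D) (v : nat) : {set 'I_D} :=
  [set x | hb_vtx hb x == v :> nat].
Definition vvec (M : lmodType Lam) D (hb : hbasis M D) v (u : 'rV[k]_#|vset hb v|) : M :=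
  \sum_p kscale (u 0 p) (hb_vec hb (enum_val p)).
Definition vco (M : lmodType Lam) D (hb : hbasis M D) v (m : M) : 'rV[k]_#|vset hb v| :=
  \row_p hb_co hb m (enum_val p).

Section One.
Variables (M : lmodType Lam) (D : nat) (hb : hbasis M D) (v : nat).
Lemma vco_vvec u : vco hb v (vvec u) = u.
Proof.
apply/rowP => p; rewrite mxE hb_co_sum (bigD1 p) //= hb_coZ hb_co_vec eqxx mulr1 big1 ?addr0 // => q qp.
by rewrite hb_coZ hb_co_vec (inj_eq enum_val_inj) eq_sym (negPf qp) mulr0.
Qed.
Lemma vvec_vco m : vvec (vco hb v m) = en v *: m.
Proof.
rewrite (hb_act hb) (bigID (fun x => x \in vset hb v)) /= [X in _ = _ + X]big1 ?addr0 => [|x]; last first.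
  by rewrite inE hb_en_vec => /negPf ->; rewrite kscaler0.
rewrite big_enum_val; apply: eq_bigr => p _; rewrite mxE hb_en_vec.
by have := enum_valP p; rewrite inE => ->.
Qed.
Lemma en_vvec (u : 'rV[k]_#|vset hb v|) : en v *: vvec u = vvec u.
Proof. by rewrite -vvec_vco vco_vvec. Qed.
End One.

Definition vmx (M N : lmodType Lam) D E (hb : hbasis M D) (hc : hbasis N E) v
    (f : {linear M -> N}) : 'M[k]_(#|vset hb v|, #|vset hc v|) :=
  \matrix_(p, q) hb_co hc (f (hb_vec hb (enum_val p))) (enum_val q).

Lemma vmxE (M N : lmodType Lam) D E (hb : hbasis M D) (hc : hbasis N E) v (f : {linear M -> N}) u :
  u *m vmx hb hc v f = vco hc v (f (vvec u)).
Proof.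
apply/rowP => q; rewrite !mxE linear_sum hb_co_sum; apply: eq_bigr => p _.
by rewrite mxE kscale_linear hb_coZ.
Qed.

(** Multiplication by an idempotent is exact, so exactness at N passes to the vertex spaces, where
    it is rank-nullity. *)
Lemma vset_rank (M N P : lmodType Lam) D E F (hb : hbasis M D) (hc : hbasis N E) (hd : hbasis P F)
    (f : {linear M -> N}) (g : {linear N -> P}) v :
  (forall y, g y = 0 <-> exists x, f x = y) ->
  #|vset hc v| = (\rank (vmx hb hc v f) + \rank (vmx hc hd v g))%N.
Proof.
move=> fg; apply: exact_rank => u.
have -> : u *m vmx hc hd v g = 0 <-> g (vvec u) = 0.
  rewrite vmxE; split=> [u0|->]; last by apply/rowP => p; rewrite !mxE hb_co0.
  rewrite -en_vvec linearZ /= -(vvec_vco hd) u0 /vvec big1 // => p _.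
  by rewrite mxE kscale0.
rewrite fg; split=> [[m fm]|[w wf]].
  by exists (vco hb v m); rewrite vmxE vvec_vco linearZ /= fm en_vvec vco_vvec.
by exists (vvec w); rewrite -en_vvec linearZ /= -(vvec_vco hc) -vmxE wf.
Qed.

Lemma zero_mod_vset (M : lmodType Lam) D (hb : hbasis M D) v : (forall m : M, m = 0) -> #|vset hb v| = 0%N.
Proof.
by move=> M0; apply: eq_card0 => x; have /eqP := hb_vec_neq0 hb x; case; exact: M0.
Qed.

Definition cwt (i v : nat) : int := if (i <= v)%N then (-1) ^+ (v - i) else 0.

Lemma Delta_coef_vset (M : lmodType Lam) D (hb : hbasis M D) i :
  Delta_coef hb i = \sum_(v < n) cwt i v * (#|vset hb v|)%:Z.
Proof.
rewrite /Delta_coef (partition_big (hb_vtx hb) xpredT) //=; apply: eq_bigr => v _.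
rewrite (eq_bigr (fun=> cwt i v)) => [|x /eqP ->//].
rewrite sumr_const -mulr_natr natz; congr (_ * Posz _).
by apply: eq_card => x; rewrite inE.
Qed.

Lemma hbasis_inhabited (M : fdmod R) : inhabited {D : nat & hbasis M D}.
Proof. by have [D [hb]] := hbasis_exists M; split; exists D. Qed.
Definition kdim (M : fdmod R) : nat := projT1 (inhabited_witness (hbasis_inhabited M)).
Definition kbas (M : fdmod R) : hbasis M (kdim M) :=
  projT2 (inhabited_witness (hbasis_inhabited M)).

(** The basis [kbas] is an arbitrary choice; [Delta_wt_basis] shows the value to be independent of
    it. *)
Definition Delta_wt i (M : fdmod R) : int := Delta_coef (kbas M) i.
(** The weight of the image of f, written with ranks so that no image module has to be built. *)
Definition Delta_rk i (M N : fdmod R) (f : {linear M -> N}) : int :=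
  \sum_(v < n) cwt i v * (\rank (vmx (kbas M) (kbas N) v f))%:Z.

Lemma Delta_wt_exact i (M N P : fdmod R) (f : {linear M -> N}) (g : {linear N -> P}) :
  (forall y, g y = 0 <-> exists x, f x = y) -> Delta_wt i N = Delta_rk i f + Delta_rk i g.
Proof.
move=> fg; rewrite /Delta_wt Delta_coef_vset /Delta_rk -big_split; apply: eq_bigr => v _ /=.
by rewrite -mulrDr -PoszD -(vset_rank (kbas M) (kbas N) (kbas P) v fg).
Qed.
Lemma Delta_rk_zerol i (M N : fdmod R) (f : {linear M -> N}) : is_zero_mod M -> Delta_rk i f = 0.
Proof.
move=> M0; rewrite /Delta_rk big1 // => v _.
have := rank_leq_row (vmx (kbas M) (kbas N) v f).
move=> /leq_trans/(_ (eq_leq (zero_mod_vset (kbas M) v M0))); rewrite leqn0 => /eqP ->.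
by rewrite mulr0.
Qed.
Lemma Delta_rk_zeror i (M N : fdmod R) (f : {linear M -> N}) : is_zero_mod N -> Delta_rk i f = 0.
Proof.
move=> N0; rewrite /Delta_rk big1 // => v _.
have := rank_leq_col (vmx (kbas M) (kbas N) v f).
move=> /leq_trans/(_ (eq_leq (zero_mod_vset (kbas N) v N0))); rewrite leqn0 => /eqP ->.
by rewrite mulr0.
Qed.
Lemma Delta_wt_zero i (M : fdmod R) : is_zero_mod M -> Delta_wt i M = 0.
Proof.
by move=> M0; rewrite /Delta_wt Delta_coef_vset big1 // => v _; rewrite zero_mod_vset ?mulr0.
Qed.

Lemma fd_zero_zero : is_zero_mod (fd_zero R).
Proof. by move=> m; apply/rowP => -[]. Qed.

(** The identity between zero modules is exact at both ends, so each basis counts the rank of one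
    and the same matrix at every vertex. *)
Lemma Delta_wt_basis i (M : fdmod R) D (hb : hbasis M D) : Delta_wt i M = Delta_coef hb i.
Proof.
rewrite /Delta_wt !Delta_coef_vset; apply: eq_bigr => v _; congr (_ * Posz _).
have Z := fd_zero_zero; have z0 := zero_mod_vset (kbas (fd_zero R)) v Z.
pose idM : {linear M -> M} := idfun.
have e1 : forall y : M, idM y = 0 <-> exists x, (\0 : {linear fd_zero R -> M}) x = y.
  by move=> y; split=> [y0|[x <-]//]; exists 0; exact: (esym y0).
have e2 : forall y : M, (\0 : {linear M -> fd_zero R}) y = 0 <-> exists x, idM x = y.
  by move=> y; split=> // _; exists y.
have := vset_rank (kbas (fd_zero R)) (kbas M) hb v e1.
have := vset_rank (kbas M) hb (kbas (fd_zero R)) v e2.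
have := rank_leq_row (vmx (kbas (fd_zero R)) (kbas M) v \0).
have := rank_leq_col (vmx hb (kbas (fd_zero R)) v \0).
move=> /leq_trans/(_ (eq_leq z0)) + /leq_trans/(_ (eq_leq z0)).
by rewrite !leqn0 => /eqP -> /eqP ->; rewrite addn0 add0n => E1 E2; rewrite [LHS]E2 [RHS]E1.
Qed.

Lemma Delta_wt_prod i (M N : fdmod R) : Delta_wt i (fd_prod M N) = Delta_wt i M + Delta_wt i N.
Proof.
have inl_lin : linear (fun m : M => (m, 0 : N) : fd_prod M N).
  by move=> c x y; congr (_, _); rewrite /= scaler0 addr0.
pose f0 := GRing.isLinear.Build Lam M (fd_prod M N) *:%R _ inl_lin.
pose f : {linear M -> fd_prod M N} := HB.pack (fun m : M => (m, 0 : N) : fd_prod M N) f0.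
have snd_lin : linear (fun m : fd_prod M N => m.2 : N) by [].
pose g0 := GRing.isLinear.Build Lam (fd_prod M N) N *:%R _ snd_lin.
pose g : {linear fd_prod M N -> N} := HB.pack (fun m : fd_prod M N => m.2 : N) g0.
have e1 : forall y, f y = 0 <-> exists x, (\0 : {linear fd_zero R -> M}) x = y.
  by move=> y; split=> [[->]|[x <-]]; [exists 0 | rewrite linear0].
have e2 : forall y, g y = 0 <-> exists x, f x = y.
  by move=> [y1 y2]; split=> [/= ->|[x [_ <-]]//]; exists y1.
have e3 : forall y, (\0 : {linear N -> fd_zero R}) y = 0 <-> exists x, g x = y.
  by move=> y; split=> // _; exists (0, y).
rewrite (Delta_wt_exact i e1) (Delta_wt_exact i e2) (Delta_wt_exact i e3).
by rewrite (Delta_rk_zerol _ _ fd_zero_zero) (Delta_rk_zeror _ _ fd_zero_zero) add0r addr0.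
Qed.
End Rank.

(* Alternating sum over the degrees -2B, ..., 2B-1, the even shift keeping the sign. *)
Definition chi (B : nat) (f : int -> int) : int :=
  \sum_(j < 4 * B) (-1) ^+ j * f (j%:Z - (2 * B)%:Z).

Lemma chi_ext B f g : f =1 g -> chi B f = chi B g.
Proof. by move=> fg; apply: eq_bigr => j _; rewrite fg. Qed.
Lemma chiD B f g : chi B (fun m => f m + g m) = chi B f + chi B g.
Proof. by rewrite /chi -big_split; apply: eq_bigr => j _; rewrite mulrDr. Qed.

Lemma chi_telescope B (r : int -> int) :
  chi B (fun m => r (m - 1) + r m) = r (- (2 * B)%:Z - 1) - r ((2 * B)%:Z - 1).
Proof.
have tel N (c : int) : \sum_(j < N) (-1) ^+ j * (r (j%:Z - c - 1) + r (j%:Z - c)) =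
    r (- c - 1) - (-1) ^+ N * r (N%:Z - c - 1).
  elim: N => [|N IH]; first by rewrite big_ord0 expr0 mul1r sub0r subrr.
  rewrite big_ord_recr /= IH exprS mulN1r mulNr opprK mulrDr addrA subrK.
  by congr (_ + _ * r _); lia.
rewrite /chi tel (_ : (-1) ^+ (4 * B) = 1) ?mul1r; last first.
  by rewrite -signr_odd oddM.
by congr (_ - r _); lia.
Qed.

Definition small (b : nat) (f : int -> int) := forall m : int, (b < `|m|)%N -> f m = 0.

(** The sum of both sides telescopes to values of [f] outside its support. *)
Lemma chi_shift b B f : small b f -> (b < B)%N -> chi B (fun m => f (m + 1)) = - chi B f.
Proof.
move=> fs bB; apply/eqP; rewrite -addr_eq0 -chiD; apply/eqP.
have -> : chi B (fun m => f (m + 1) + f m) = chi B (fun m => f (m - 1 + 1) + f (m + 1)).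
  by apply: chi_ext => m; rewrite subrK addrC.
by rewrite (chi_telescope B (fun m => f (m + 1))) !fs ?subr0 //; lia.
Qed.

(** * Euler characteristics of bounded complexes *)

Section Complexes.
Variables (k : fieldType) (n : nat) (i : nat).
Local Notation R := (@Lambda_rel k n).
Local Notation Delta_wt := (@Delta_wt k n i).
Local Notation Delta_rk := (@Delta_rk k n i).
Implicit Types X Y Z : bcomplex R.

Definition cx_wt X (m : int) : int := Delta_wt (X m).

Lemma cx_wt_small X : exists b, small b (cx_wt X).
Proof. by have [b bX] := cx_bounded X; exists b => m /bX; apply: Delta_wt_zero. Qed.

Lemma chi_acyclic X : (forall (m : int) (x : X (m + 1)), cx_d X (m + 1) x = 0 -> exists y, cx_d X m y = x) ->
  exists b, forall B, (b < B)%N -> chi B (cx_wt X) = 0.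
Proof.
move=> acX; have [b bX] := cx_bounded X; exists b => B bB.
pose r m := Delta_rk (cx_d X m).
have wtE m : cx_wt X m = r (m - 1) + r m.
  (* Differentials land in degrees of the form [i + 1], so [m] must be written as [m - 1 + 1] before
     two consecutive differentials compose. *)
  rewrite -[in LHS](subrK 1 m) -[X in _ + r X](subrK 1 m); apply: Delta_wt_exact => y.
  by split=> [/acX//|[x <-]]; exact: cx_dd.
rewrite (chi_ext _ wtE) chi_telescope /r !Delta_rk_zerol ?subrr //; by apply: bX; lia.
Qed.

Lemma cone_wt X Y (f : chain_map X Y) m : cx_wt (cone f) m = cx_wt X (m + 1) + cx_wt Y m.
Proof. exact: Delta_wt_prod. Qed.

Lemma chi_cone X Y (f : chain_map X Y) :
  exists b, forall B, (b < B)%N -> chi B (cx_wt (cone f)) = chi B (cx_wt Y) - chi B (cx_wt X).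
Proof.
have [b bX] := cx_wt_small X; exists b => B bB.
by rewrite (chi_ext _ (cone_wt f)) (chiD B (fun m => cx_wt X (m + 1))) (chi_shift bX bB) addrC.
Qed.

Lemma cone_acyclic X Y (f : chain_map X Y) : quasi_iso f ->
  forall (m : int) (z : cone f (m + 1)), cx_d (cone f) (m + 1) z = 0 -> exists y, cx_d (cone f) m y = z.
Proof.
move=> [q1 q2] m [x y] dz.
have dx : cx_d X (m + 1 + 1) x = 0 by have /eqP := congr1 fst dz; rewrite /= oppr_eq0 => /eqP.
have dy : f (m + 1 + 1) x + cx_d Y (m + 1) y = 0 by exact: (congr1 snd dz).
have [|x' xE] := q1 (m + 1) x dx.
  by exists (- y); apply/eqP; rewrite linearN -addr_eq0 dy.
have [|x'' dx'' [y' yE]] := q2 m (y + f (m + 1) x').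
  by rewrite linearD /= -cm_comm -xE -[RHS]dy; exact: addrC.
(* [x'] bounds [x], and the cocycle [x''] repairs the second component; the minus sign is that of
   the cone differential. *)
exists (x'' - x', y'); apply: injective_projections => /=.
  by rewrite linearB /= dx'' sub0r opprK -xE.
by rewrite linearB /= addrAC -yE addrK.
Qed.

Lemma chi_quasi_iso X Y (f : chain_map X Y) : quasi_iso f ->
  exists b, forall B, (b < B)%N -> chi B (cx_wt X) = chi B (cx_wt Y).
Proof.
move=> /cone_acyclic/chi_acyclic[b bE]; have [c cE] := chi_cone f.
exists (maxn b c) => B; rewrite gtn_max => /andP[bB cB].
by have := bE B bB; rewrite cE // => /eqP; rewrite subr_eq0 => /eqP.
Qed.

(** The window [B] must contain the support of the complex, and supports move under shifts, cones
    and isomorphisms; hence the condition only for large [B]. *)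
Definition chi0 X := exists b, forall B, (b < B)%N -> chi B (cx_wt X) = 0.

Lemma stalk_chi (M : fdmod R) B : (0 < B)%N -> chi B (cx_wt (stalk M)) = Delta_wt M.
Proof.
move=> B0; have j0 : (2 * B < 4 * B)%N by lia.
rewrite /chi (bigD1 (Ordinal j0)) //= subrr -signr_odd oddM expr0 mul1r /cx_wt /= /stalk_ob eqxx.
rewrite big1 ?addr0 // => j /eqP nj; rewrite ifF ?(Delta_wt_zero _ (@fd_zero_zero k n)) ?mulr0 //.
by apply/eqP => j2; apply: nj; apply: val_inj => /=; lia.
Qed.

Lemma chi0_triangulated : triangulated_subcategory chi0.
Proof.
split.
- by exists 0%N => B B0; rewrite stalk_chi // Delta_wt_zero //; apply: fd_zero_zero.
- move=> X Y [Z [s [t [qs qt]]]] [b bX].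
  have [b1 E1] := chi_quasi_iso qs; have [b2 E2] := chi_quasi_iso qt.
  exists (maxn b (maxn b1 b2)) => B; rewrite !gtn_max => /and3P[bB b1B b2B].
  by rewrite -E2 // E1 // bX.
- move=> X; have [b bX] := cx_wt_small X.
  have sE B : (b < B)%N -> chi B (cx_wt (shift X)) = - chi B (cx_wt X).
    by move=> bB; rewrite -(chi_shift bX bB).
  split=> -[c cE]; exists (maxn b c) => B; rewrite gtn_max => /andP[bB cB].
    by apply/eqP; rewrite -oppr_eq0 -sE // cE.
  by rewrite sE // cE // oppr0.
- move=> X Y f [b bX] [c cY]; have [d dE] := chi_cone f.
  exists (maxn b (maxn c d)) => B; rewrite !gtn_max => /and3P[bB cB dB].
  by rewrite dE // bX // cY // subrr.
Qed.
End Complexes.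

Section Final.
Variables (k : fieldType) (n : nat).
Local Notation R := (@Lambda_rel k n).

Lemma Delta_coef_std (M : lmodType (bqa R)) (j : 'I_n) (hb : hbasis M (std_dim j)) (i : nat) :
  (forall p, hb_vtx hb p = std_vtx p) -> Delta_coef hb i = (i == j)%:R.
Proof.
move=> vE; rewrite /Delta_coef; under eq_bigr do rewrite vE /=.
case: j hb vE => [[|j] jn] hb vE.
  rewrite big_ord_recl big_ord0 addr0 /= subn0 leqn0.
  by case: eqP => [->|].
rewrite !big_ord_recl big_ord0 addr0 /= subn0 subn1 /=.
case: (ltngtP i j.+1) => [ij|ij|->]; last by rewrite ltnn subnn addr0.
  by rewrite -ltnS ij (_ : (j.+1 - i = (j - i).+1)%N) ?exprS ?mulN1r ?addNr //; lia.
by rewrite leqNgt (ltnW ij) addr0.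
Qed.

Definition in_class (M : fdmod R) (i : 'I_n) := is_Delta M i \/ is_nabla M i.

Lemma Delta_wt_class (M : fdmod R) (j : 'I_n) (i : nat) : in_class M j -> Delta_wt i M = (i == j)%:R.
Proof. by case=> -[hb [v _ _]]; rewrite (Delta_wt_basis i hb) (Delta_coef_std i v). Qed.

(* The complexes whose class has coefficient 0 on [Delta(i)] form a triangulated
   subcategory that does not contain [Delta(i)]. *)
Lemma generates_class (r : nat) (M : 'I_r -> fdmod R) (c : 'I_r -> 'I_n) :
  (forall x, in_class (M x) (c x)) -> generates_Db M -> forall i, exists x, c x = i.
Proof.
move=> cM gen i; apply: contrapT => /forallNP nc.
have [|b bE] := gen (@chi0 k n i) (chi0_triangulated _ _ _) _ (stalk (Delta k i)).
  move=> x; exists 0%N => B B0; rewrite stalk_chi // (Delta_wt_class _ (cM x)).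
  by case: eqP => // /val_inj ix; case: (nc x).
have := bE b.+1 (ltnSn b); rewrite stalk_chi // (@Delta_wt_class _ i); last by left; apply: Delta_is_Delta.
by rewrite eqxx.
Qed.
End Final.

(** * The order of the terms *)

Section Order.
Variables (k : fieldType) (n : nat) (hn : (1 < n)%N).
Local Notation R := (@Lambda_rel k n).
Variables (r : nat) (M : 'I_r -> fdmod R) (c : 'I_r -> 'I_n).
Hypothesis cM : forall x, in_class (M x) (c x).
Hypothesis exM : exceptional_sequence M.

Lemma class_inj : injective c.
Proof.
have neq (x y : 'I_r) : (y < x)%N -> c x <> c y.
  move=> yx cxy; have [_ ext] := exM; apply: (Hom_class (cM x) _ (ext x y yx 0%N)).
  by rewrite cxy; exact: cM.
move=> x y cxy; apply/val_inj; case: (ltngtP x y) => // [xy|yx]; last by case: (neq x y yx).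
by case: (neq y x xy).
Qed.

Lemma Delta_increasing (x y : 'I_r) : (y < x)%N -> is_Delta (M y) (c y) -> is_Delta (M x) (c x) ->
  (c y < c x)%N.
Proof.
move=> yx Dy Dx; have [_ ext] := exM; case: ltngtP => // [cxy|/val_inj/class_inj cxy].
  by case: (Ext_Delta hn Dx Dy cxy); exact: ext.
by move: yx; rewrite cxy ltnn.
Qed.

Lemma nabla_decreasing (x y : 'I_r) : (y < x)%N -> is_nabla (M y) (c y) -> is_nabla (M x) (c x) ->
  (c x < c y)%N.
Proof.
move=> yx Dy Dx; have [_ ext] := exM; case: ltngtP => // [cxy|/val_inj/class_inj cxy].
  by case: (Ext_nabla hn Dx Dy cxy); exact: ext.
by move: yx; rewrite cxy ltnn.
Qed.

Section Pivot.
Variables (p : 'I_r) (cp : c p = 0 :> nat).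

Lemma pivot_Delta : is_Delta (M p) (c p).
Proof. by case: (cM p) => // /(is_nabla0 cp). Qed.
Lemma pivot_nabla : is_nabla (M p) (c p).
Proof. by case: (cM p) => // /(is_Delta0 cp). Qed.

(** The pivot counts as standard, so a standard term before it would need a label smaller than 0. *)
Lemma before_pivot (x : 'I_r) : (x < p)%N -> is_nabla (M x) (c x).
Proof.
move=> xp; case: (cM x) => // Dx.
by have := Delta_increasing xp Dx pivot_Delta; rewrite cp.
Qed.
Lemma after_pivot (x : 'I_r) : (p < x)%N -> is_Delta (M x) (c x).
Proof.
move=> px; case: (cM x) => // Dx.
by have := nabla_decreasing px pivot_nabla Dx; rewrite cp.
Qed.
End Pivot.
End Order.

Lemma enum_ord_split (r : nat) (p : 'I_r) :
  enum 'I_r = take p (enum 'I_r) ++ p :: drop p.+1 (enum 'I_r).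
Proof.
rewrite -{1}(cat_take_drop p (enum 'I_r)) (drop_nth p) ?nth_ord_enum //.
by rewrite size_enum_ord.
Qed.

Theorem theorem46 (k : closedFieldType) (n : nat) (hn : (1 < n)%N)
    (r : nat) (M : 'I_r -> fdmod (@Lambda_rel k n)) :
  full_exceptional_sequence M ->
  exists ms ns : seq 'I_n,
    [/\ (size ms + size ns)%N = n.-1,
        forall v : 'I_n, (v \in ms ++ ns) = (0 < v)%N,
        sorted (fun a b : 'I_n => (b < a)%N) ms,
        sorted (fun a b : 'I_n => (a < b)%N) ns &
        let N : seq (fdmod (@Lambda_rel k n)) :=
          [seq nabla k m | m <- ms] ++ L k (Ordinal (ltnW hn)) ::
          [seq Delta k m | m <- ns] in
        r = size N /\
        forall x : 'I_r, miso (M x) (nth (fd_zero (@Lambda_rel k n)) N x)].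
Proof.
move=> [exM gen].
have /choice[c cM] : forall x, exists i, in_class (M x) i.
  by move=> x; apply: (exceptional_class hn); case: exM.
have cinj := class_inj cM exM.
have csurj := generates_class cM gen.
have [p pE] := csurj (Ordinal (ltnW hn)).
have cp : c p = 0 :> nat by rewrite pE.
have rn : r = n.
  (* Labels are distinct by [Hom_class] and exhaust the vertices by generation, so [c] is a
     bijection. *)
  have [c' c'K] := choice csurj.
  rewrite -(card_ord r) -(card_ord n); apply: (bij_eq_card (f := c)).
  by exists c' => // x; apply: cinj; rewrite c'K.
(* The witnesses are the labels of the positions before and after the pivot, read in order. *)
set e := enum 'I_r; set t1 := take p e; set t2 := drop p.+1 e.
have eE : e = t1 ++ p :: t2 by exact: enum_ord_split.
have s1 : size t1 = p by rewrite size_take size_enum_ord ltn_ord.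
have s2 : size t2 = (r - p.+1)%N by rewrite size_drop size_enum_ord.
have es : sorted (relpre (fun x : 'I_r => x : nat) ltn) e.
  by rewrite -sorted_map val_enum_ord iota_ltn_sorted.
have in1 x : x \in t1 -> (x < p)%N.
  move=> /(nthP p)[j]; rewrite s1 => jp <-; rewrite nth_take //.
  by rewrite (@nth_enum_ord r p j) // (ltn_trans jp).
have in2 x : x \in t2 -> (p < x)%N.
  move=> /(nthP p)[j]; rewrite s2 => jp <-; rewrite nth_drop.
  by rewrite (@nth_enum_ord r p (p.+1 + j)) //; lia.
exists (map c t1), (map c t2); split.
- by rewrite !size_map s1 s2; have := ltn_ord p; lia.
(* By injectivity only the pivot carries the label 0, so the other positions carry exactly the
   nonzero labels. *)
- move=> v; rewrite -map_cat; apply/mapP/idP => [[x xt ->]|v0].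
    have xp : x != p.
      by move: xt; rewrite mem_cat => /orP[/in1|/in2]; apply: contraTneq => ->; rewrite ltnn.
    rewrite ssrnat.lt0n; apply: contra xp => /eqP cx0; apply/eqP/cinj/val_inj.
    by rewrite /= cp cx0.
  have [x cx] := csurj v; exists x => //.
  have : x \in e by rewrite mem_enum.
  rewrite eE !mem_cat inE => /or3P[->//|/eqP xp|->]; last by rewrite orbT.
  by move: v0; rewrite -cx xp cp.
- rewrite sorted_map.
  apply: (@sub_in_sorted _ (mem t1) (relpre (fun x : 'I_r => x : nat) ltn)).
  + move=> x y xt yt /= xy; apply: (nabla_decreasing hn cM exM xy);
    by apply: (before_pivot hn cM exM cp); apply: in1.
  + exact: allss.
  + exact: take_sorted.
- rewrite sorted_map.
  apply: (@sub_in_sorted _ (mem t2) (relpre (fun x : 'I_r => x : nat) ltn)).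
  + move=> x y xt yt /= xy; apply: (Delta_increasing hn cM exM xy);
    by apply: (after_pivot hn cM exM cp); apply: in2.
  + exact: allss.
  + exact: drop_sorted.
move=> N; split.
  by rewrite size_cat /= !size_map s1 s2; have := ltn_ord p; lia.
move=> x; rewrite nth_cat !size_map s1; case: (ltngtP x p) => [xp|px|/val_inj xp].
- rewrite -map_comp (nth_map p) ?s1 // nth_take // nth_ord_enum /=.
  by apply: (is_nabla_miso (before_pivot hn cM exM cp xp)); apply: nabla_is_nabla.
- rewrite -(subnSK px) /= -map_comp (nth_map p) ?s2 ?nth_drop; last by have := ltn_ord x; lia.
  rewrite subnKC // nth_ord_enum /=.
  by apply: (is_Delta_miso (after_pivot hn cM exM cp px)); apply: Delta_is_Delta.
- rewrite xp subnn /=; have := pivot_Delta cM cp; rewrite pE => Dp.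
  by apply: (is_Delta_miso Dp); apply: L_is_Delta.
Qed.
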